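(* Fix $k\in\mathbb{Z}_{\ge1}$ and $a\in\mathbb Z$. For $n>k$ let $(s_t)_{t\in\mathbb Z}$ be the periodic extension of a uniformly random sorting network in $\Omega_n$, let $X=\max\{t\le a: s_t=k\}$, $Y=\min\{t>a: s_t=k\}$, and $\mathrm{Sp}_{k,n}=Y-X$. Then as $n\to\infty$, $$\frac{\mathrm{Sp}_{k,n}}{n^{3/2}}\longrightarrow \frac12 Z_k\quad\text{in distribution},$$ where $Z_k$ is a positive random variable with density $$g_k(x)=x\,\frac{\partial^2}{\partial x^2}\Big(\mathbb P\big(\mathbf{T}_{FS}(k)>x\big)\Big),\qquad x>0,$$ and $\mathbf{T}_{FS}(k)$ is the smallest positive eigenvalue of a $2k\times2k$ aGUE matrix.
   Context: For $n\ge2$, $N=\binom n2$, and $1\le k\le n-1$ let $\tau_k=(k,k+1)\in\mathfrak S_n$ be the adjacent transposition. A sorting network of size $n$ is a sequence $(s_1,\dots,s_N)$ with $s_i\in\{1,\dots,n-1\}$ and $\tau_{s_1}\cdots\tau_{s_N}=(n\ n-1\ \dots\ 2\ 1)$; $\Omega_n$ is the set of them, and ''uniformly random'' means uniform on $\Omega_n$. The periodic extension of $(s_1,\dots,s_N)$ is the sequence $(s_t)_{t\in\mathbb Z}$ determined by $s_{t+N}=n-s_t$ for all $t\in\mathbb Z$. An $\ell\times\ell$ aGUE matrix is $\frac{\mathbf i}{2}(Y-Y^T)$ with $Y$ an $\ell\times\ell$ matrix of i.i.d. $N(0,1)$ entries. *)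

(* Defs.v *)
From HB Require Import structures.
From mathcomp Require Import all_boot all_order all_algebra all_fingroup.
From mathcomp Require Import all_classical all_reals all_analysis.
From mathcomp Require Import complex.

Set Implicit Arguments.
Unset Strict Implicit.
Unset Printing Implicit Defensive.

Import Order.TTheory GRing.Theory Num.Theory.
Import numFieldNormedType.Exports.

Local Open Scope classical_set_scope.
Local Open Scope ring_scope.

(* Sorting networks.  Positions {1,...,n} are represented by 'I_n     *)
(* (position p <-> ordinal p-1).  A letter s_i in {1,...,n-1} is       *)
(* represented by an ordinal j : 'I_n with 0 < j, and tau_j swaps the  *)
(* positions j and j+1, i.e. the ordinals j-1 and j.                   *)

Definition Nn (n : nat) : nat := 'C(n, 2).

Definition tau (n : nat) (j : 'I_n) : 'S_n := tperm (ord_pred j) j.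

Definition revp (n : nat) : 'S_n := perm (@rev_ord_inj n).

(* Omega_n : sorting networks (s_1,...,s_N) stored as s : 'I_N -> 'I_n,
   with s_{i+1} = s i *)
Definition Omega (n : nat) : {set {ffun 'I_(Nn n) -> 'I_n}} :=
  [set s : {ffun 'I_(Nn n) -> 'I_n} | [forall i, (0 < (s i : nat))%N] && ((\prod_(i < Nn n) tau (s i))%g == revp n)].

(* s_r as a natural number, for 0 <= r < N, i.e. the letter s_{r+1} *)
Definition s_at (n : nat) (s : {ffun 'I_(Nn n) -> 'I_n}) (r : nat) : nat :=
  if @insub _ (fun r => (r < Nn n)%N) 'I_(Nn n) r is Some i then (s i : nat) else 0%N.

(* periodic extension: s_t for t in Z, with s_{t+N} = n - s_t *)
Definition sext (n : nat) (s : {ffun 'I_(Nn n) -> 'I_n}) (t : int) : nat :=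
  let u := (t - 1)%R in
  let q := (u %/ (Nn n)%:Z)%Z in
  let r := `|(u %% (Nn n)%:Z)%Z|%N in
  if odd `|q|%N then (n - s_at s r)%N else s_at s r.

(* Y = min {t > a : s_t = k}.  The extension is 2N-periodic and every letter
   of {1..n-1} occurs in a sorting network, so the search window of length
   2N always contains such a t. *)
Definition Ynext (n k : nat) (a : int) (s : {ffun 'I_(Nn n) -> 'I_n}) : int :=
  (a + (find (fun d => sext s (a + (d.+1)%:Z) == k) (iota 0 (2 * Nn n)%N)).+1%:Z)%R.

Definition Xprev (n k : nat) (a : int) (s : {ffun 'I_(Nn n) -> 'I_n}) : int :=
  (a - (find (fun d => sext s (a - d%:Z) == k) (iota 0 (2 * Nn n)%N))%:Z)%R.

Definition Sp (n k : nat) (a : int) (s : {ffun 'I_(Nn n) -> 'I_n}) : int :=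
  (Ynext k a s - Xprev k a s)%R.

Definition Sp_cdf {R : realType} (k : nat) (a : int) (x : R) (n : nat) : R :=
  #|[set s in Omega n | (Sp k a s)%:~R / (n%:R `^ (3 / 2 : R)) <= x]|%:R
    / #|Omega n|%:R.

Definition iid_std_gaussian {R : realType} {d : measure_display}
  {T : measurableType d} (P : probability T R) (l : nat)
  (Y : 'I_l -> 'I_l -> T -> R) : Prop :=
  [/\ (forall i j, measurable_fun setT (Y i j)),
      (forall i j (B : set R), measurable B ->
         P (Y i j @^-1` B) = normal_prob 0 1 B) &
      (forall B : 'I_l -> 'I_l -> set R, (forall i j, measurable (B i j)) ->
         fine (P [set w | forall i j, B i j (Y i j w)]) =
         \prod_(i < l) \prod_(j < l) fine (P (Y i j @^-1` B i j)))].

Definition aGUE {R : realType} (l : nat) (Y : 'I_l -> 'I_l -> R) : 'M[R[i]]_l :=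
  \matrix_(i, j) (('i / 2%:R) * ((Y i j)%:C - (Y j i)%:C))%C.

(* smallest positive eigenvalue (+oo if there is none) *)
Definition smallest_pos_eig {R : realType} (l : nat) (M : 'M[R[i]]_l) : \bar R :=
  ereal_inf [set t%:E | t in [set t : R | 0 < t /\ eigenvalue M t%:C%C]].

Definition TFS_tail {R : realType} {d : measure_display}
  {T : measurableType d} (P : probability T R) (l : nat)
  (Y : 'I_l -> 'I_l -> T -> R) (x : R) : R :=
  fine (P [set w | (x%:E < smallest_pos_eig (aGUE (fun i j => Y i j w)))%E]).

(* Main.v *)
(** Let [q m] be the probability that a fixed window of [m] consecutive letters
    of the periodic extension avoids [k]. The cyclic shift
    [(s_1, ..., s_N) |-> (s_2, ..., s_N, n - s_1)] preserves [Omega n], so [q]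
    does not depend on the position of the window, it is convex, and
    [P(Sp > D) = q D + D (q D - q (D + 1))].

    Reduced words are counted by divided differences: applied to the staircase
    monomial, the sum of all divided differences, and the sum of those other
    than the [k]-th, act on exponents through determinants that can be
    differentiated row by row. Hence the Bernstein sum
    [\sum_m 'C(N, m) s^m (1 - s)^(N - m) q m] is a ratio of two [k x k]
    determinants with entries [\int_s^1 x^(2 (i + j)) (1 - x^2)^(n - 2 k) dx].
    At [s = 2 x / sqrt n] these become Gaussian tail moments, and since [q] is
    monotone and convex the Bernstein sum can be inverted: [q] at [x n^(3/2)]
    tends to [Sdet (2 x)], with convergence of the rescaled slopes. Therefore the
    distribution function of the spacing tends to [1 - S y + y S' y] with
    [S = Sdet] and [y = 2 x], whose derivative in [y] is [y S'' y].

    It remains to see that [Sdet] is the tail of the smallest positive eigenvalue.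
    Gaussian integration by parts gives a closed recursion (loop equations) for
    the expected products of power sums of the squared eigenvalues. Independent
    Gaussians reweighted by the squared Vandermonde determinant of their squares
    satisfy the same recursion, so both have the same expectation of
    [\prod_i p (x_i)] for every polynomial [p]; Andreief's identity evaluates the
    second one as a determinant, and polynomials converging to the indicator of a
    half-line under an exponential bound finish the proof. *)
Require Import Defs.
From HB Require Import structures.
From mathcomp Require Import all_boot all_order all_algebra all_fingroup.
From mathcomp Require Import all_classical all_reals all_analysis.
From mathcomp Require Import measurable_realfun.
From mathcomp Require Import complex spectral sesquilinear.
From mathcomp Require Import ring lra zify.
From mathcomp Require mpoly.
Import (canonicals, coercions) mpoly.
Set Implicit Arguments.
Unset Strict Implicit.
Unset Printing Implicit Defensive.
Import Order.TTheory GRing.Theory Num.Theory.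
Import numFieldNormedType.Exports.
Local Open Scope classical_set_scope.
Local Open Scope ring_scope.

(** The determinants come from transposition: divided differences are made to act on functions of
    the exponent vector [a]. On an antisymmetric function of the shifted exponents
    [a i + (n - 1 - i)], the [j]-th one collapses to lowering row [j - 1] by one, and a determinant
    with rows of divided powers performs all these lowerings at once as a time derivative.
    Forbidding the letter [k] means dropping one row from this derivative. That happens by itself
    when the first [k] rows are killed below the level [w = 2 * (n - k)], because operators other
    than the [k]-th keep row [k - 1] exactly at this level. Word counts become, up to constants,
    Taylor coefficients at the time [r = 1 - s] where killing starts; expanding from [r] to 1
    produces the Bernstein sum.

    The other [n - k] rows do not involve [s] and, at the staircase, have even shifted exponents;
    polynomials symmetric about 1 lie in their kernel, which cuts the size down to [k].

    On the matrix side no joint eigenvalue density is computed. The infimum ignores zero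
    eigenvalues; they are excluded almost surely only at the end, by [Sdet 0 = 1]. *)

(** * Integration of a composed function against a nonnegative weight *)

Section WeightedImage.
Local Open Scope ereal_scope.
Import HBNNSimple.
Context {R : realType}.

(** Monotone convergence along the simple approximations of [f] leaves only integrals over
    indicators of [X], so nothing but the law of [X] weighted by [Z] matters. *)
Lemma ge0_integral_comp_simple d (T : measurableType d)
    (mu : {measure set T -> \bar R}) (X : T -> R) (Z : T -> R) (f : R -> R)
    (mf : measurable_fun [set: R] (fun x => (f x)%:E)) :
  measurable_fun setT X -> measurable_fun setT Z ->
  (forall x, 0 <= Z x)%R -> (forall x, 0 <= f x)%R ->
  \int[mu]_x (f (X x) * Z x)%:E =
  limn (fun n => \sum_(r \in range (nnsfun_approx measurableT mf n))
    (r%:E * \int[mu]_x (\1_(nnsfun_approx measurableT mf n @^-1` [set r]) (X x) * Z x)%:E)).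
Proof.
move=> mX mZ Z0 f0; set h := nnsfun_approx measurableT mf.
have mhX n : measurable_fun setT (h n \o X).
  by apply: measurableT_comp => //; exact: measurable_funP.
transitivity (limn (fun n => \int[mu]_x (h n (X x) * Z x)%:E)).
  rewrite -monotone_convergence//.
  - apply: eq_integral => x _; apply/esym/cvg_lim => //.
    rewrite (_ : (fun n => _) = (fun n => (h n (X x))%:E * (Z x)%:E)); last first.
      by apply/funext => n; rewrite EFinM.
    rewrite EFinM; apply: cvgeZr => //.
    by apply: (@cvg_nnsfun_approx _ _ _ _ measurableT _ mf) => // y _; rewrite lee_fin.
  - by move=> n; apply/measurable_EFinP; exact: (measurable_funM (mhX n) mZ).
  - by move=> n x _; rewrite lee_fin mulr_ge0.
  - move=> x _ m n mn; rewrite lee_fin ler_wpM2r//.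
    exact/lefP/nd_nnsfun_approx.
congr (limn _); apply/funext => n.
have mind r : measurable_fun setT (fun x => \1_(h n @^-1` [set r]) (X x) : R).
  by apply: measurableT_comp => //; exact: measurable_indic.
transitivity (\int[mu]_x \sum_(r \in range (h n))
    (r * (\1_(h n @^-1` [set r]) (X x) * Z x))%:E).
  apply: eq_integral => x _; rewrite [in LHS]fimfunE mulr_fsuml -fsumEFin//.
  by under [RHS]eq_fsbigr do rewrite mulrA.
have rg r : r \in range (h n) -> (0 <= r)%R.
  by rewrite inE => -[x _ <-].
have nneg r x : (0 <= r * (\1_(h n @^-1` [set r]) (X x) * Z x))%R.
  have [hr|hr] := boolP (r \in range (h n)).
    apply: mulr_ge0; first exact: rg.
    by apply: mulr_ge0 => //; rewrite indicE.
  rewrite indicE; case: (boolP (X x \in _)) => [|_]; last by rewrite mul0r mulr0.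
  by rewrite inE/= => e; move/negP: hr; case; rewrite inE; exists (X x).
rewrite ge0_integral_fsum//=; last 2 first.
  - by move=> r; apply/measurable_EFinP; apply: measurable_funM => //; exact: measurable_funM.
  - by move=> r x _; rewrite lee_fin.
apply: eq_fsbigr => r hr; under eq_integral do rewrite EFinM.
rewrite ge0_integralZl//.
- by apply/measurable_EFinP; exact: measurable_funM.
- by move=> x _; rewrite lee_fin mulr_ge0.
- by rewrite lee_fin rg.
Qed.

(** This is how independence is later extended from Borel sets to functions, one variable at a
    time. *)
Lemma ge0_integral_comp_eq d1 d2 (T1 : measurableType d1) (T2 : measurableType d2)
    (mu1 : {measure set T1 -> \bar R}) (mu2 : {measure set T2 -> \bar R})
    (X1 Z1 : T1 -> R) (X2 Z2 : T2 -> R) :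
  measurable_fun setT X1 -> measurable_fun setT Z1 ->
  measurable_fun setT X2 -> measurable_fun setT Z2 ->
  (forall x, 0 <= Z1 x)%R -> (forall x, 0 <= Z2 x)%R ->
  (forall B : set R, measurable B ->
     \int[mu1]_x (\1_B (X1 x) * Z1 x)%:E = \int[mu2]_x (\1_B (X2 x) * Z2 x)%:E) ->
  forall f : R -> R, measurable_fun setT f -> (forall x, 0 <= f x)%R ->
  \int[mu1]_x (f (X1 x) * Z1 x)%:E = \int[mu2]_x (f (X2 x) * Z2 x)%:E.
Proof.
move=> mX1 mZ1 mX2 mZ2 Z10 Z20 H f mf f0.
have mf' : measurable_fun [set: R] (fun x => (f x)%:E) by exact/measurable_EFinP.
rewrite (ge0_integral_comp_simple _ mf')// (ge0_integral_comp_simple _ mf')//.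
congr (limn _); apply/funext => n; apply: eq_fsbigr => r _; congr (_ * _).
exact: H.
Qed.

End WeightedImage.

(** * Cyclic shift of sorting networks *)

Section Shift.
Variable n : nat.

(** The map [j] to [n - j] modulo [n]: the ordinal 0, which is no letter, is fixed, so that this is
    an involution on all of ['I_n]. *)
Definition neg_letter (j : 'I_n) : 'I_n := ordS (rev_ord j).

Lemma val_neg_letter (j : 'I_n) : (0 < j)%N -> (neg_letter j : nat) = (n - j)%N.
Proof. by move=> j0; rewrite /= modn_small; have := ltn_ord j; lia. Qed.

Lemma neg_letter_gt0 (j : 'I_n) : (0 < j)%N -> (0 < neg_letter j)%N.
Proof. by move=> j0; rewrite val_neg_letter //; have := ltn_ord j; lia. Qed.

Lemma neg_letter0 (j : 'I_n) : (j : nat) = 0%N -> (neg_letter j : nat) = 0%N.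
Proof. by move=> j0; rewrite /= j0 subn1 prednK ?modnn //; have := ltn_ord j; lia. Qed.

Lemma neg_letterK : involutive neg_letter.
Proof.
move=> j; apply: ord_inj; case: (posnP j) => j0; first by rewrite !neg_letter0.
by rewrite !val_neg_letter ?neg_letter_gt0 //; have := ltn_ord j; lia.
Qed.

Lemma rev_ord_pred (j : 'I_n) : rev_ord (ord_pred j) = ordS (rev_ord j).
Proof.
apply: ord_inj => /=; have := ltn_ord j; case: (posnP j) => [->|j0] nj.
  by rewrite add0n modn_small ?ltn_predL // subn1 prednK // modnn subnn.
rewrite -(prednK j0) addSn /= modnDr !modn_small; lia.
Qed.

Lemma tau_neg_letter (j : 'I_n) : tau (neg_letter j) = (revp n * tau j * revp n)%g.
Proof.
have rV : (revp n)^-1%g = revp n.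
  by apply/eqP; rewrite eq_invg_mul; apply/eqP/permP => i; rewrite permM perm1 !permE rev_ordK.
have := tpermJ (ord_pred j) j (revp n).
rewrite conjgE rV mulgA !permE rev_ord_pred /tau => ->.
by rewrite tpermC; congr (tperm _ _); rewrite /neg_letter ordSK.
Qed.

Lemma revp2 : (revp n * revp n)%g = 1%g.
Proof. by apply/permP => i; rewrite permM perm1 !permE rev_ordK. Qed.

Definition shiftw M (s : {ffun 'I_M -> 'I_n}) : {ffun 'I_M -> 'I_n} :=
  [ffun i : 'I_M => if (i.+1 < M)%N then s (ordS i) else neg_letter (s (ordS i))].

Lemma shiftw_inj M : injective (@shiftw M).
Proof.
move=> s1 s2 /ffunP e; apply/ffunP => i; have := e (ord_pred i).
rewrite !ffunE ord_predK; case: ifP => // _.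
exact: (can_inj neg_letterK).
Qed.

(** Write [w0] for the reversal, [t] for the first transposition and [u] for the product of the
    others. From [t u = w0] one gets [u = t w0], and the appended letter contributes [w0 t w0]; the
    product [t w0 w0 t w0] is again [w0]. *)
Lemma shiftw_prod M (s : {ffun 'I_M -> 'I_n}) : (0 < M)%N ->
  (\prod_(i < M) tau (s i))%g = revp n ->
  (\prod_(i < M) tau (shiftw s i))%g = revp n.
Proof.
case: M s => // m s _; rewrite big_ord_recl big_ord_recr /= => e.
have -> : (\prod_(i < m) tau (shiftw s (widen_ord (leqnSn m) i)))%g
        = (\prod_(i < m) tau (s (lift ord0 i)))%g.
  apply: eq_bigr => i _; rewrite ffunE /= ltnS ltn_ord; congr (tau (s _)).
  by apply: ord_inj; rewrite /= modn_small // ltnS.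
rewrite ffunE /= ltnn.
have -> : ordS (@ord_max m) = ord0 by apply: ord_inj; rewrite /= modnn.
rewrite tau_neg_letter !mulgA.
have t2 : (tau (s ord0) * tau (s ord0))%g = 1%g by exact: tperm2.
have -> : (\prod_(i < m) tau (s (lift ord0 i)))%g = (tau (s ord0) * revp n)%g.
  by rewrite -e mulgA t2 mul1g.
by rewrite -[(_ * revp n * revp n)%g]mulgA revp2 mulg1 t2 mul1g.
Qed.

Lemma shiftw_Omega s : s \in Omega n -> (0 < Nn n)%N -> shiftw s \in Omega n.
Proof.
rewrite !inE => /andP[/forallP pos /eqP e] N0; apply/andP; split.
  apply/forallP => i; rewrite ffunE; case: ifP => _; first exact: pos.
  by apply: neg_letter_gt0; exact: pos.
by rewrite shiftw_prod.
Qed.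

(** An injection of the finite set [Omega n] into itself is onto, so the shift permutes it. *)
Lemma card_shiftw (P : pred {ffun 'I_(Nn n) -> 'I_n}) : (0 < Nn n)%N ->
  #|[set s in Omega n | P (shiftw s)]%SET| = #|[set s in Omega n | P s]%SET|.
Proof.
move=> N0.
have im : [set shiftw s | s in Omega n]%SET = Omega n.
  apply/eqP; rewrite eqEcard card_imset; last exact: shiftw_inj.
  by rewrite leqnn andbT; apply/fintype.subsetP => _ /imsetP[s hs ->]; exact: shiftw_Omega.
rewrite -(card_imset _ (@shiftw_inj (Nn n))); apply: eq_card => s.
apply/imsetP/idP => [[s']|].
  by rewrite inE => /andP[h1 h2] ->; rewrite inE h2 andbT shiftw_Omega.
rewrite inE => /andP[hs Ps].
move: (hs); rewrite -{1}im => /imsetP[s' hs' es]; exists s' => //.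
by rewrite inE hs' -es.
Qed.

Lemma s_at_lt (s : {ffun 'I_(Nn n) -> 'I_n}) r (h : (r < Nn n)%N) : s_at s r = s (Ordinal h).
Proof. by rewrite /s_at insubT. Qed.

(** Within a period both sides read the same letter. At its end the quotient grows by one, and the
    changed parity is matched by the reflection of the appended letter, since reflecting twice gives
    the letter back. *)
Lemma sext_shiftw s t : s \in Omega n -> (0 < Nn n)%N ->
  sext (shiftw s) t = sext s (t + 1).
Proof.
move=> /[!inE] /andP[/forallP pos _] N0; rewrite /sext.
have N0' : (Nn n)%:Z != 0 by lia.
set u := (t - 1)%R; have -> : (t + 1 - 1 = u + 1)%R by rewrite /u; ring.
set q := (u %/ (Nn n)%:Z)%Z; set r := `|(u %% (Nn n)%:Z)%Z|%N.
have eu : u = (q * (Nn n)%:Z + r%:Z)%R.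
  by rewrite {1}(divz_eq u (Nn n)%:Z) gez0_abs // modz_ge0.
have rN : (r < Nn n)%N.
  have := ltz_mod u N0'; rewrite /r; have := modz_ge0 u N0'; lia.
have pn i : (0 < s i)%N && (s i < n)%N by rewrite pos ltn_ord.
have [lt|ge] := ltnP r.+1 (Nn n).
  have -> : ((u + 1) %/ (Nn n)%:Z)%Z = q.
    by rewrite eu -addrA divzMDl // divz_small ?addr0 //; lia.
  have -> : `|((u + 1) %% (Nn n)%:Z)%Z|%N = r.+1.
    by rewrite eu -addrA modzMDl modz_small //; lia.
  rewrite !s_at_lt ffunE /= lt.
  have -> // : ordS (Ordinal rN) = Ordinal lt.
  by apply: ord_inj; rewrite /= modn_small.
have er : r.+1 = Nn n by lia.
have e1 : (u + 1 = (q + 1) * (Nn n)%:Z)%R by rewrite eu -er intS; ring.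
have -> : ((u + 1) %/ (Nn n)%:Z)%Z = q + 1 by rewrite e1 mulzK.
have -> : `|((u + 1) %% (Nn n)%:Z)%Z|%N = 0%N by rewrite e1 modzMl.
rewrite !s_at_lt ffunE /= er ltnn.
have -> : ordS (Ordinal rN) = Ordinal N0 by apply: ord_inj; rewrite /= er modnn.
rewrite val_neg_letter //; have /andP[s0 sn] := pn (Ordinal N0).
have -> : odd `|(q + 1)%R|%N = ~~ odd `|q|%N by lia.
by case: (odd `|q|%N) => //=; rewrite subKn // ltnW.
Qed.

End Shift.

(** * Windows free of a letter and the gap around a position *)

Definition avoid (p : int -> bool) (t : int) (m : nat) : bool :=
  all (fun d : nat => ~~ p (t + d%:Z)) (iota 0 m).

Lemma avoidP (p : int -> bool) t m :
  reflect (forall d : nat, (d < m)%N -> ~~ p (t + d%:Z)) (avoid p t m).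
Proof.
apply: (iffP allP) => H d; first by move=> dm; apply: H; rewrite mem_iota.
by rewrite mem_iota add0n => /andP[_]; exact: H.
Qed.

Lemma leq_find_iota (p : nat -> bool) M j : (j <= M)%N ->
  (j <= find p (iota 0 M))%N = all (fun d => ~~ p d) (iota 0 j).
Proof.
move=> jM; apply/idP/allP => [jf d|H].
  rewrite mem_iota add0n => /andP[_ dj].
  have := @before_find _ 0%N p (iota 0 M) d; rewrite nth_iota ?add0n; last by lia.
  by move=> -> //; lia.
rewrite leqNgt; apply/negP => lt.
have hp : has p (iota 0 M) by rewrite has_find size_iota; lia.
have := nth_find 0%N hp; rewrite nth_iota ?add0n; last by lia.
by apply/negP; apply: H; rewrite mem_iota; lia.
Qed.

(* Split according to the position [a + j + 1] of the first hit after [a]. *)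
Lemma gap_window (p : int -> bool) (a : int) M D : (D < M)%N ->
  nat_of_bool (D <= find (fun d : nat => p (a + d.+1%:Z)%R) (iota 0 M)
                  + find (fun d : nat => p (a - d%:Z)%R) (iota 0 M))%N =
  (avoid p (a + 1)%R D +
   \sum_(j < D) (avoid p (a + 1 - D%:Z + j%:Z)%R D && ~~ avoid p (a + 1 - D%:Z + j%:Z)%R D.+1))%N.
Proof.
move=> DM; set f := find _ _; set b := find _ _.
have hf j : (j <= M)%N -> (j <= f)%N = avoid p (a + 1) j.
  move=> jM; rewrite leq_find_iota //; apply: eq_all => d.
  by rewrite intS addrA.
have fhit : (f < M)%N -> p (a + f.+1%:Z).
  move=> fM; have hp : has (fun d : nat => p (a + d.+1%:Z)) (iota 0 M) by rewrite has_find size_iota.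
  by have := nth_find 0%N hp; rewrite nth_iota ?add0n.
have hb j : (j <= M)%N -> (j <= b)%N = avoid p (a + 1 - j%:Z) j.
  move=> jM; rewrite leq_find_iota //; apply/allP/avoidP => H d.
    move=> dj; have := H (j - d.+1)%N; rewrite mem_iota add0n.
    by rewrite (_ : a - (j - d.+1)%N%:Z = a + 1 - j%:Z + d%:Z); [apply; lia|lia].
  rewrite mem_iota add0n => /andP[_ dj]; have := H (j - d.+1)%N.
  by rewrite (_ : a + 1 - j%:Z + (j - d.+1)%N%:Z = a - d%:Z); [apply; lia|lia].
have [Df|fD] := leqP D f.
  rewrite -hf ?(ltnW DM) // Df (leq_trans Df (leq_addr _ _)) big1 ?addn0 // => j _.
  apply/eqP; rewrite eqb0; apply/negP => /andP[/avoidP h1 /negP]; apply; apply/avoidP => d.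
  rewrite ltnS leq_eqVlt => /orP[/eqP ->|]; last exact: h1.
  have /avoidP/(_ j) : avoid p (a + 1) D by rewrite -hf // ltnW.
  by rewrite (_ : a + 1 - D%:Z + j%:Z + D%:Z = a + 1 + j%:Z); [apply; exact: ltn_ord|lia].
rewrite -hf ?(ltnW DM) // [(D <= f)%N]leqNgt fD add0n (bigD1 (Ordinal fD)) //=.
rewrite [X in _ = (_ + X)%N]big1 ?addn0; last first.
  move=> j jf; apply/eqP; rewrite eqb0; apply/negP => /andP[/avoidP h1 /negP]; apply.
  have {}jf : (j : nat) != f by move: jf; rewrite -val_eqE.
  have [lt|gt|e] := ltngtP (j : nat) f; last by rewrite e eqxx in jf.
    apply/avoidP => d; rewrite ltnS leq_eqVlt => /orP[/eqP ->|]; last exact: h1.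
    have /avoidP/(_ j) : avoid p (a + 1) f by rewrite -hf ?leqnn //; lia.
    by rewrite (_ : a + 1 - D%:Z + j%:Z + D%:Z = a + 1 + j%:Z); [apply|lia].
  have := h1 (D + f - j)%N; rewrite (_ : a + 1 - D%:Z + j%:Z + (D + f - j)%N%:Z = a + f.+1%:Z); last first.
    by have := ltn_ord j; lia.
  by rewrite fhit ?(ltn_trans fD) //; have := ltn_ord j => jD /(_ ltac:(lia)).
congr nat_of_bool.
have -> : ~~ avoid p (a + 1 - D%:Z + f%:Z) D.+1.
  apply/avoidP => /(_ D (ltnSn D)); rewrite (_ : _ + D%:Z = a + f.+1%:Z); last by lia.
  by rewrite fhit // (ltn_trans fD).
rewrite andbT -leq_subLR hb; last by lia.
apply/avoidP/avoidP => H d dD.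
  have [lt|ge] := ltnP d (D - f).
    by have := H d lt; rewrite (_ : a + 1 - (D - f)%N%:Z + d%:Z = a + 1 - D%:Z + f%:Z + d%:Z) //; lia.
  have /avoidP/(_ (d - (D - f))%N) : avoid p (a + 1) f by rewrite -hf ?leqnn //; lia.
  by rewrite (_ : a + 1 + (d - (D - f))%N%:Z = a + 1 - D%:Z + f%:Z + d%:Z); [apply; lia|lia].
have := H d; rewrite (_ : a + 1 - D%:Z + f%:Z + d%:Z = a + 1 - (D - f)%N%:Z + d%:Z); last by lia.
by apply; lia.
Qed.

Lemma in_sep (T : finType) (A : {set T}) (P : pred T) x :
  (x \in [set y in A | P y]%SET) = (x \in A) && P x.
Proof. by rewrite inE. Qed.

Section WindowCounts.
Variables (n k : nat).
Hypothesis N0 : (0 < Nn n)%N.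

Definition hit (s : {ffun 'I_(Nn n) -> 'I_n}) (t : int) : bool := sext s t == k.

Definition wcount (m : nat) : nat := #|[set s in Omega n | avoid (hit s) 1 m]%SET|.

Lemma shift_invariant_const (F : int -> nat) : (forall u, F (u + 1) = F u) ->
  forall u, F u = F 0.
Proof.
move=> step [j|j]; first by elim: j => // j IH; rewrite -addn1 PoszD step.
elim: j => [|j IH]; first by rewrite -(step (Negz 0)).
by rewrite -IH (_ : Negz j = Negz j.+1 + 1) ?step //; lia.
Qed.

Lemma wcountE (t : int) m : #|[set s in Omega n | avoid (hit s) t m]%SET| = wcount m.
Proof.
have step u : #|[set s in Omega n | avoid (hit s) (u + 1)%R m]%SET| =
              #|[set s in Omega n | avoid (hit s) u m]%SET|.
  rewrite -[RHS](card_shiftw (fun s => avoid (hit s) u m)) //.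
  apply: eq_card => s; rewrite !in_sep; case: (boolP (s \in Omega n)) => // hs /=.
  by apply: eq_all => d; rewrite /hit sext_shiftw // addrAC.
have inv u := shift_invariant_const step u.
exact: etrans (inv t) (esym (inv 1)).
Qed.

Lemma wcount_diff (t : int) m :
  #|[set s in Omega n | avoid (hit s) t m && ~~ avoid (hit s) t m.+1]%SET| =
  (wcount m - wcount m.+1)%N.
Proof.
rewrite -(wcountE t m) -(wcountE t m.+1).
have sub : ([set s in Omega n | avoid (hit s) t m.+1] \subset
            [set s in Omega n | avoid (hit s) t m])%SET.
  apply/fintype.subsetP => s; rewrite !in_sep => /andP[-> /avoidP h]; apply/avoidP => d dm.
  by apply: h; lia.
rewrite -(cardsDS sub); apply: eq_card => s; rewrite finset.in_setD !in_sep.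
by case: (s \in Omega n) => //=; rewrite andbC.
Qed.

Lemma wcount_mono m : (wcount m.+1 <= wcount m)%N.
Proof.
apply: subset_leq_card; apply/fintype.subsetP => s; rewrite !in_sep => /andP[-> /avoidP h].
by apply/avoidP => d dm; apply: h; lia.
Qed.

Lemma wcount0 : wcount 0 = #|Omega n|.
Proof. by apply: eq_card => s; rewrite in_sep andbT. Qed.

(** The decrement at [m] counts the networks whose window of length [m] is free and followed by [k].
    A free window that starts one position earlier and is followed by [k] at the same place is a
    special case. *)
Lemma wcount_convex m : (wcount m.+1 - wcount m.+2 <= wcount m - wcount m.+1)%N.
Proof.
rewrite -(wcount_diff 0 m.+1) -(wcount_diff 1 m); apply: subset_leq_card.
apply/fintype.subsetP => s; rewrite !in_sep => /and3P[-> /avoidP h1 /negP h2] /=.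
apply/andP; split.
  by apply/avoidP => d dm; rewrite (_ : 1 + d%:Z = 0 + d.+1%:Z); [apply: h1; lia|lia].
apply/negP => /avoidP h3; apply: h2; apply/avoidP => -[|d] dm; first exact: h1.
by rewrite (_ : 0 + d.+1%:Z = 1 + d%:Z); [apply: h3; lia|lia].
Qed.

(** The spacing is one more than the sum of the two searches, so it exceeds [D] iff that sum is at
    least [D]. By shift invariance each of the [D] summands of [gap_window] has the same count. The
    bound on [D] keeps the searches inside their range. *)
Lemma card_Sp_gt (a : int) (D : nat) : (D < 2 * Nn n)%N ->
  #|[set s in Omega n | ~~ (Sp k a s <= D%:Z)%R]%SET| =
  (wcount D + D * (wcount D - wcount D.+1))%N.
Proof.
move=> DN; rewrite -sum1_card.
transitivity (\sum_(s in Omega n) (~~ (Sp k a s <= D%:Z)%R : nat))%N.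
  by rewrite big_mkcond [RHS]big_mkcond /=; apply: eq_bigr => s _; rewrite in_sep; case: (s \in _).
have e s : (~~ (Sp k a s <= D%:Z)%R : nat) = (avoid (hit s) (a + 1)%R D +
   \sum_(j < D) (avoid (hit s) (a + 1 - D%:Z + j%:Z)%R D && ~~ avoid (hit s) (a + 1 - D%:Z + j%:Z)%R D.+1))%N.
  rewrite -(gap_window _ _ DN); congr nat_of_bool.
  by rewrite /Sp /Ynext /Xprev /hit; lia.
rewrite (eq_bigr _ (fun s _ => e s)) big_split /= exchange_big /=.
have cnt (Q : pred {ffun 'I_(Nn n) -> 'I_n}) :
    (\sum_(s in Omega n) (Q s : nat) = #|[set s in Omega n | Q s]%SET|)%N.
  rewrite -sum1_card big_mkcond [RHS]big_mkcond /=; apply: eq_bigr => s _.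
  by rewrite in_sep; case: (s \in _).
rewrite cnt wcountE; congr (_ + _)%N.
under eq_bigr => j _ do rewrite cnt wcount_diff.
by rewrite sum_nat_const card_ord.
Qed.

End WindowCounts.

(** * Inversions of permutations *)

#[local] Arguments ord_pred : simpl never.

Lemma ord_eqE n (a b : 'I_n) : (a == b) = (nat_of_ord a == nat_of_ord b).
Proof. by []. Qed.

(** Both sides are conjugates equal to [tperm a c]. *)
Lemma tperm_braid (T : finType) (a b c : T) : a != b -> a != c -> b != c ->
  (tperm a b * (tperm b c * tperm a b) = tperm b c * (tperm a b * tperm b c))%g.
Proof.
move=> ab ac bc.
have := tpermJ a b (tperm b c); rewrite conjgE tpermV tpermL tpermD 1?eq_sym // => ->.
by have := tpermJ b c (tperm a b); rewrite conjgE tpermV tpermR tpermD.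
Qed.

Section Inversions.
Variable n : nat.
Implicit Types (w : 'S_n) (j : 'I_n).

Definition invs w : {set 'I_n * 'I_n} := [set p : 'I_n * 'I_n | (p.1 < p.2)%N && (w p.2 < w p.1)%N].
Definition ninv w := #|invs w|.

Lemma val_ord_pred j : (0 < j)%N -> (ord_pred j : nat) = j.-1.
Proof.
move=> j0; rewrite /ord_pred /= -{1}(prednK j0) addSn /= modnDr modn_small //.
by rewrite prednK // ltnW.
Qed.

Lemma ord_pred_neq j : (0 < j)%N -> ord_pred j != j.
Proof. by move=> j0; rewrite ord_eqE val_ord_pred //; lia. Qed.

Lemma tau_invol j : (tau j * tau j)%g = 1%g.
Proof. exact: tperm2. Qed.

Lemma val_tau j (a : 'I_n) : (0 < j)%N -> (tau j a : nat) =
  (if (a : nat) == j.-1 then j : nat else if (a : nat) == j then j.-1 else a).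
Proof.
move=> j0; have pj := val_ord_pred j0; rewrite /tau.
case: tpermP => [->|->|/eqP a1 /eqP a2].
- by rewrite pj eqxx.
- by rewrite pj eqxx; case: eqP => // e; lia.
- by move: a1 a2; rewrite !ord_eqE pj => /negbTE -> /negbTE ->.
Qed.

Lemma tau_lt j (a b : 'I_n) : (0 < j)%N -> (a, b) != (ord_pred j, j) ->
  (a < b)%N -> (tau j a < tau j b)%N.
Proof.
move=> j0; rewrite xpair_eqE !ord_eqE val_ord_pred // => ab lab.
by rewrite !val_tau //; do ! case: ifP; lia.
Qed.

(** Left multiplication by [tau j] exchanges the values at the positions [j - 1] and [j]. Applying
    [tau j] to both coordinates of a pair is a bijection from the old inversions to the new ones
    other than [(j - 1, j)]. *)
Lemma ninv_tau_lt w j : (0 < j)%N -> (w (ord_pred j) < w j)%N ->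
  ninv (tau j * w)%g = (ninv w).+1.
Proof.
move=> j0 lw; have pj := val_ord_pred j0.
pose q := (ord_pred j, j).
have tq1 : tau j (ord_pred j) = j by rewrite /tau tpermL.
have tq2 : tau j j = ord_pred j by rewrite /tau tpermR.
have qin : q \in invs (tau j * w)%g.
  have lq : (ord_pred j < j)%N by rewrite pj; lia.
  by rewrite inE /q !permM tq1 tq2 lw lq.
have qnin : q \notin invs w by rewrite inE /q /= [(w j < _)%N]ltnNge (ltnW lw) andbF.
rewrite /ninv (cardsD1 q) qin add1n; congr _.+1.
pose h (p : 'I_n * 'I_n) := (tau j p.1, tau j p.2).
have hK : involutive h by case=> a b; rewrite /h /= -!permM tau_invol !perm1.
rewrite -(card_imset _ (inv_inj hK)); apply: eq_card => p.
apply/imsetP/idP => [[[a b]]|].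
  rewrite !inE /= !permM => /andP[abq /andP[lab lwab]] ->.
  by rewrite /h /= tau_lt.
case: p => a b; rewrite inE /= => /andP[lab lwab].
have abq : (a, b) != q by apply: contraNneq qnin => <-; rewrite inE /= lab.
exists (h (a, b)); last by rewrite hK.
rewrite !inE /= !permM -!permM !mulgA tau_invol !mul1g lwab tau_lt // andbT.
rewrite andbT /h /q xpair_eqE; apply/negP => /andP[/eqP e1 /eqP e2].
have ea : a = j by rewrite -tq1 -e1 -permM tau_invol perm1.
have eb : b = ord_pred j by apply: (@perm_inj _ (tau j)); rewrite tq1.
by move: lab; rewrite ea eb pj; lia.
Qed.

Lemma ninv_tau_gt w j : (0 < j)%N -> (w j < w (ord_pred j))%N ->
  (ninv (tau j * w)%g).+1 = ninv w.
Proof.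
move=> j0 lw; have := @ninv_tau_lt (tau j * w)%g j j0.
rewrite !permM mulgA tau_invol mul1g /tau tpermL tpermR => -> //.
Qed.

Lemma tau_ltgt w j : (0 < j)%N -> (w (ord_pred j) < w j)%N || (w j < w (ord_pred j))%N.
Proof.
move=> j0; rewrite -neq_ltn; apply: contra_neq (ord_pred_neq j0) => e.
by apply: (@perm_inj _ w); apply: val_inj.
Qed.

Lemma ninv_revp : ninv (revp n) = 'C(n, 2).
Proof.
rewrite /ninv -[in RHS](card_ord n) -card_draws.
pose h (p : 'I_n * 'I_n) := [set p.1; p.2]%SET.
have hinj : {in invs (revp n) &, injective h}.
  case=> a b [c e]; rewrite !inE /= => /andP[lab _] /andP[lce _] /finset.setP he.
  have := he a; have := he b; have := he c; have := he e; rewrite !inE -!val_eqE /=.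
  move=> h1 h2 h3 h4; congr (_, _); apply: val_inj => /=; lia.
rewrite -(card_in_imset hinj); apply: eq_card => A; rewrite !inE.
apply/imsetP/idP => [[[a b]]|/cards2P[a [b [ab ->]]]].
  rewrite inE /= => /andP[lab _] ->; rewrite cards2 -val_eqE /=.
  by rewrite neq_ltn lab.
have [lab|lba|e] := ltngtP a b; last by case/eqP: ab; apply: val_inj.
  by exists (a, b) => //; rewrite inE /= lab !permE /=; have := ltn_ord b; lia.
by exists (b, a); [rewrite inE /= lba !permE /=; have := ltn_ord a; lia|rewrite finset.setUC].
Qed.

(** An increasing permutation satisfies [a <= w a] by induction upwards and [w a <= a] by induction
    downwards. *)
Lemma sorted_perm1 w : (forall j, (0 < j)%N -> (w (ord_pred j) < w j)%N) -> w = 1%g.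
Proof.
move=> H.
have mono (a b : 'I_n) : (a < b)%N -> (w a < w b)%N.
  have [m] := ubnP (b - a); elim: m a b => // m IH a b lm lab.
  have b0 : (0 < b)%N by lia.
  have pb := val_ord_pred b0.
  have [e|ne] := eqVneq a (ord_pred b); first by rewrite e; exact: H.
  move: ne; rewrite ord_eqE pb => ne.
  by apply: (ltn_trans _ (H b b0)); apply: IH; rewrite pb; lia.
have ge (a : 'I_n) : (a <= w a)%N.
  case: a => m; elim: m => [|m IH] lm //=.
  have lm' : (m < n)%N by lia.
  by apply: leq_ltn_trans (IH lm') _; apply: mono.
have le (a : 'I_n) : (w a <= a)%N.
  have [m] := ubnP (n - a); elim: m a => // m IH a lm.
  have [la|la] := ltnP a.+1 n; last by have := ltn_ord (w a); lia.
  have := IH (Ordinal la); have := mono a (Ordinal la); rewrite /= ltnSn => /(_ isT) h1 h2.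
  by have := h2 ltac:(lia); lia.
by apply/permP => a; rewrite perm1; apply: val_inj; apply/eqP; rewrite eqn_leq ge le.
Qed.

Lemma ninv0 w : ninv w = 0%N -> w = 1%g.
Proof.
move=> w0; apply: sorted_perm1 => j j0.
case/orP: (tau_ltgt w j0) => // lw.
by have := ninv_tau_gt j0 lw; rewrite w0.
Qed.

Lemma ninv_le w : (ninv w <= 'C(n, 2))%N.
Proof.
rewrite -ninv_revp; apply: subset_leq_card; apply/fintype.subsetP => -[a b].
by rewrite !inE /= !permE /= => /andP[lab _]; rewrite lab /=; have := ltn_ord b; lia.
Qed.

End Inversions.

(** * Divided differences and Schubert functions *)

Section DividedDifferences.
Variables (R : realFieldType) (n : nat).
Implicit Types (x : 'I_n -> R) (f g : ('I_n -> R) -> R) (i j : 'I_n) (w : 'S_n).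

Definition ddiff j f : ('I_n -> R) -> R :=
  fun x => (f x - f (x \o tau j)) / (x (ord_pred j) - x j).

(** Where two coordinates coincide the division has a default value; identities between divided
    differences are therefore stated at points with distinct coordinates, a set stable under
    permutation. *)
Definition eq_inj f g := forall x, injective x -> f x = g x.

Lemma comp_tau_inj x j : injective x -> injective (x \o tau j).
Proof. by move=> xi; apply: inj_comp => //; exact: perm_inj. Qed.

Lemma ddiff_eq j f g : eq_inj f g -> eq_inj (ddiff j f) (ddiff j g).
Proof. by move=> fg x xi; rewrite /ddiff !fg //; exact: comp_tau_inj. Qed.

Lemma ddiff_ddiff j f x : (0 < j)%N -> injective x -> ddiff j (ddiff j f) x = 0.
Proof.
move=> j0 xi; rewrite /ddiff /= /tau tpermL tpermR.
have -> : (x \o tperm (ord_pred j) j) \o tperm (ord_pred j) j = x.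
  by apply/funext => i /=; rewrite tpermK.
have d : x (ord_pred j) - x j != 0.
  by rewrite subr_eq0; apply: contra_neq (ord_pred_neq j0) => /xi.
have d' : x j - x (ord_pred j) != 0 by rewrite -oppr_eq0 opprB.
by rewrite -[x j - _]opprB invrN mulrN -mulNr opprB subrr mul0r.
Qed.

Lemma inj_sub_neq0 x (a b : 'I_n) : injective x -> a != b -> x a - x b != 0.
Proof. by move=> xi; rewrite subr_eq0; apply: contra_neq => /xi. Qed.

Lemma ddiff_comm i j f x : (0 < i)%N -> (i.+1 < j)%N -> injective x ->
  ddiff i (ddiff j f) x = ddiff j (ddiff i f) x.
Proof.
move=> i0 ij xi; have j0 : (0 < j)%N by lia.
have pi := val_ord_pred i0; have pj := val_ord_pred j0.
have neq (a b : 'I_n) : (a : nat) != b -> a != b by rewrite ord_eqE.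
have n1 : ord_pred i != ord_pred j by apply: neq; rewrite pi pj; lia.
have n2 : ord_pred i != j by apply: neq; rewrite pi; lia.
have n3 : i != ord_pred j by apply: neq; rewrite pj; lia.
have n4 : i != j by apply: neq; lia.
rewrite /ddiff /= /tau.
rewrite (tpermD n1 n3) (tpermD n2 n4).
have m1 : ord_pred j != ord_pred i by rewrite eq_sym.
have m2 : j != ord_pred i by rewrite eq_sym.
have m3 : ord_pred j != i by rewrite eq_sym.
have m4 : j != i by rewrite eq_sym.
rewrite (tpermD m1 m2) (tpermD m3 m4).
have -> : (x \o tperm (ord_pred i) i) \o tperm (ord_pred j) j =
          (x \o tperm (ord_pred j) j) \o tperm (ord_pred i) i.
  apply/funext => a /=; congr (x _).
  case: (tpermP (ord_pred j) j a) => [->|->|/eqP a1 /eqP a2].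
  - by rewrite [tperm (ord_pred i) i (ord_pred j)]tpermD // tpermL tpermD.
  - by rewrite [tperm (ord_pred i) i j]tpermD // tpermR tpermD.
  case: (tpermP (ord_pred i) i a) => [_|_|_ _].
  - by rewrite tpermD // eq_sym.
  - by rewrite tpermD // eq_sym.
  - by rewrite tpermD // eq_sym.
field; rewrite !inj_sub_neq0 //; exact: ord_pred_neq.
Qed.

Lemma ddiff_braid i j f x : (0 < i)%N -> (j : nat) = i.+1 -> injective x ->
  ddiff i (ddiff j (ddiff i f)) x = ddiff j (ddiff i (ddiff j f)) x.
Proof.
move=> i0 ij xi; have j0 : (0 < j)%N by lia.
have pi := val_ord_pred i0.
have pj : ord_pred j = i by apply/eqP; rewrite ord_eqE val_ord_pred // ij.
set p := ord_pred i.
have npi : p != i by exact: ord_pred_neq.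
have npj : p != j by rewrite ord_eqE pi; lia.
have nij : i != j by rewrite ord_eqE ij; lia.
have nip : i != p by rewrite eq_sym.
have njp : j != p by rewrite eq_sym.
have nji : j != i by rewrite eq_sym.
rewrite /ddiff /= /tau pj -/p.
rewrite !(tpermL, tpermR, (tpermD nip njp), (tpermD npj nij)).
have c (y : 'I_n -> R) a b : (y \o tperm a b) \o tperm a b = y.
  by apply/funext => z /=; rewrite tpermK.
rewrite !c.
have -> : ((x \o tperm i j) \o tperm p i) \o tperm i j =
          ((x \o tperm p i) \o tperm i j) \o tperm p i.
  have e := tperm_braid npi npj nij.
  apply/funext => z /=; congr (x _).
  by have /permP/(_ z) := e; rewrite !permM.
field; rewrite !inj_sub_neq0 //.
Qed.


Variable top : ('I_n -> R) -> R.

(* [schub_rec m w] is the Schubert function of [w], when [w] has [m]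
   non-inversions and [top] is the Schubert function of the reversal *)
Fixpoint schub_rec (m : nat) w : ('I_n -> R) -> R :=
  if m is m'.+1 then
    if [pick j : 'I_n | (0 < j)%N && (w (ord_pred j) < w j)%N] is Some j
    then ddiff j (schub_rec m' (tau j * w)%g) else top
  else top.

Definition schub w := schub_rec ('C(n, 2) - ninv w) w.

Lemma schub_revp : schub (revp n) = top.
Proof. by rewrite /schub ninv_revp subnn. Qed.

(** The recursion picks one ascent, and any other has to give the same function. Two distinct
    ascents are completed to a common longer permutation, by one more letter each when they are not
    adjacent and by two more each when they are. Commutation or the braid relation closes the
    diagram, and the intermediate steps follow by induction on the number of non-inversions. *)
Lemma schub_ascent w j : (0 < j)%N -> (w (ord_pred j) < w j)%N ->
  eq_inj (schub w) (ddiff j (schub (tau j * w)%g)).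
Proof.
have [m] := ubnP ('C(n, 2) - ninv w); elim: m w j => // m IH w j lm j0 lw.
have nw := ninv_tau_lt j0 lw.
have := ninv_le (tau j * w)%g; rewrite nw => le1.
have : exists2 i : 'I_n, (0 < i)%N && (w (ord_pred i) < w i)%N &
    schub w = ddiff i (schub (tau i * w)%g).
  rewrite {1}/schub (_ : 'C(n, 2) - ninv w = ('C(n, 2) - (ninv w).+1).+1)%N; last by lia.
  rewrite /=; case: pickP => [i ia|/(_ j)]; last by rewrite j0 lw.
  by exists i => //; case/andP: (ia) => i0 li; rewrite /schub ninv_tau_lt.
case=> i /andP[i0 li] ->.
have lt_swap (a b : 'I_n) : (0 < a)%N -> (0 < b)%N -> (a.+1 < b)%N ->
    ((tau a * w)%g (ord_pred b) < (tau a * w)%g b)%N = (w (ord_pred b) < w b)%N /\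
    ((tau b * w)%g (ord_pred a) < (tau b * w)%g a)%N = (w (ord_pred a) < w a)%N.
  move=> a0 b0 ab; have pa := val_ord_pred a0; have pb := val_ord_pred b0.
  by rewrite !permM /tau !tpermD // ord_eqE ?pa ?pb; lia.
have tau_comm (a b : 'I_n) : (0 < a)%N -> (a.+1 < b)%N -> (tau a * tau b)%g = (tau b * tau a)%g.
  move=> a0 ab; have b0 : (0 < b)%N by lia.
  have pa := val_ord_pred a0; have pb := val_ord_pred b0.
  apply/permP => c; rewrite !permM; apply: ord_inj; rewrite !val_tau //.
  by do ! case: ifP; lia.
have ltm v : (ninv w < ninv v)%N -> ('C(n, 2) - ninv v < m)%N.
  by have := ninv_le v; lia.
have far (a b : 'I_n) : (0 < a)%N -> (a.+1 < b)%N -> (w (ord_pred a) < w a)%N ->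
    (w (ord_pred b) < w b)%N ->
    eq_inj (ddiff a (schub (tau a * w)%g)) (ddiff b (schub (tau b * w)%g)).
  move=> a0 ab la lb; have b0 : (0 < b)%N by lia.
  have [e1 e2] := lt_swap a b a0 b0 ab.
  have h1 : eq_inj (schub (tau a * w)%g) (ddiff b (schub (tau b * (tau a * w))%g)).
    by apply: IH => //; [rewrite ltm // ninv_tau_lt|rewrite e1].
  have h2 : eq_inj (schub (tau b * w)%g) (ddiff a (schub (tau a * (tau b * w))%g)).
    by apply: IH => //; [rewrite ltm // ninv_tau_lt|rewrite e2].
  move=> x xi; rewrite (ddiff_eq a h1) // (ddiff_eq b h2) // ddiff_comm //.
  by rewrite !mulgA (tau_comm a b).
have near (a b : 'I_n) : (0 < a)%N -> (b : nat) = a.+1 -> (w (ord_pred a) < w a)%N ->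
    (w (ord_pred b) < w b)%N ->
    eq_inj (ddiff a (schub (tau a * w)%g)) (ddiff b (schub (tau b * w)%g)).
  move=> a0 ab la lb; have b0 : (0 < b)%N by lia.
  have pa := val_ord_pred a0.
  have pb : ord_pred b = a by apply/eqP; rewrite ord_eqE val_ord_pred // ab.
  have n1 : ord_pred a != a by exact: ord_pred_neq.
  have n2 : ord_pred a != b by rewrite ord_eqE pa; lia.
  have n3 : a != b by rewrite ord_eqE; lia.
  rewrite pb in lb.
  have ta1 : tau a a = ord_pred a by rewrite /tau tpermR.
  have ta2 : tau a (ord_pred a) = a by rewrite /tau tpermL.
  have ta3 : tau a b = b by rewrite /tau tpermD.
  have tb1 : tau b b = a by rewrite /tau tpermR pb.
  have tb2 : tau b a = b by rewrite /tau pb tpermL.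
  have tb3 : tau b (ord_pred a) = ord_pred a by rewrite /tau pb tpermD // eq_sym.
  have lab := ltn_trans la lb.
  have g1 := ninv_tau_lt a0 la.
  have g2 : ninv (tau b * w)%g = (ninv w).+1 by apply: ninv_tau_lt; rewrite ?pb.
  have l1 : ((tau a * w)%g (ord_pred b) < (tau a * w)%g b)%N by rewrite pb !permM ta1 ta3.
  have l2 : ((tau b * w)%g (ord_pred a) < (tau b * w)%g a)%N by rewrite !permM tb2 tb3.
  have g3 := ninv_tau_lt b0 l1; have g4 := ninv_tau_lt a0 l2.
  have l3 : ((tau b * (tau a * w))%g (ord_pred a) < (tau b * (tau a * w))%g a)%N.
    by rewrite !permM tb2 tb3 ta2 ta3.
  have l4 : ((tau a * (tau b * w))%g (ord_pred b) < (tau a * (tau b * w))%g b)%N.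
    by rewrite pb !permM ta1 ta3 tb3 tb1.
  have h1 : eq_inj (schub (tau a * w)%g) (ddiff b (schub (tau b * (tau a * w))%g)).
    by apply: IH => //; rewrite ltm // g1.
  have h2 : eq_inj (schub (tau b * w)%g) (ddiff a (schub (tau a * (tau b * w))%g)).
    by apply: IH => //; rewrite ltm // g2.
  have h3 : eq_inj (schub (tau b * (tau a * w))%g) (ddiff a (schub (tau a * (tau b * (tau a * w)))%g)).
    by apply: IH => //; rewrite ltm // g3 g1; lia.
  have h4 : eq_inj (schub (tau a * (tau b * w))%g) (ddiff b (schub (tau b * (tau a * (tau b * w)))%g)).
    by apply: IH => //; rewrite ltm // g4 g2; lia.
  have br : (tau a * (tau b * (tau a * w)) = tau b * (tau a * (tau b * w)))%g.
    by have := tperm_braid n1 n2 n3; rewrite /tau pb !mulgA => ->.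
  move=> x xi; rewrite (ddiff_eq a h1) // (ddiff_eq b h2) //.
  rewrite (ddiff_eq a (ddiff_eq b h3)) // (ddiff_eq b (ddiff_eq a h4)) // br.
  exact: ddiff_braid.
have [e|ne] := eqVneq i j; first by rewrite e.
have [ij|ji|e] := ltngtP i j; last by case/eqP: ne; apply: ord_inj.
  have [ij'|ij'] := ltnP i.+1 j; first exact: far.
  by apply: near => //; lia.
have [ij'|ij'] := ltnP j.+1 i; first by move=> x xi; rewrite (far j i).
by move=> x xi; rewrite (near j i) //; lia.
Qed.

Lemma schub_descent w j : (0 < j)%N -> (w j < w (ord_pred j))%N ->
  eq_inj (ddiff j (schub w)) (schub (tau j * w)%g).
Proof.
move=> j0 lw x xi; rewrite (@schub_ascent (tau j * w)%g j) //.
  by rewrite mulgA tau_invol mul1g.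
by rewrite !permM /tau tpermL tpermR.
Qed.

Lemma ddiff_schub_ascent w j : (0 < j)%N -> (w (ord_pred j) < w j)%N ->
  eq_inj (ddiff j (schub w)) (fun=> 0).
Proof.
move=> j0 lw x xi; rewrite (ddiff_eq j (schub_ascent j0 lw)) //.
exact: ddiff_ddiff.
Qed.

Definition ddiffs (l : seq 'I_n) f := foldl (fun g j => ddiff j g) f l.

Lemma ddiffs_eq l f g : eq_inj f g -> eq_inj (ddiffs l f) (ddiffs l g).
Proof. by elim: l f g => //= j l IH f g fg; apply: IH; exact: ddiff_eq. Qed.

Lemma ddiffs0 l x : ddiffs l (fun=> 0) x = 0.
Proof.
elim: l x => //= j l IH x.
rewrite (_ : ddiff j (fun=> 0) = fun=> 0); first exact: IH.
by apply/funext => y; rewrite /ddiff subrr mul0r.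
Qed.

Definition word_act (l : seq 'I_n) w := foldl (fun v j => (tau j * v)%g) w l.

Lemma ninv_word_act l w : all (fun j : 'I_n => (0 < j)%N) l ->
  (ninv w <= ninv (word_act l w) + size l)%N.
Proof.
elim: l w => [|j l IH] w /=; first by rewrite addn0.
case/andP => j0 lpos; have := IH (tau j * w)%g lpos.
by case/orP: (tau_ltgt w j0) => lw; [have := ninv_tau_lt j0 lw|have := ninv_tau_gt j0 lw]; lia.
Qed.

(** A letter met at an ascent annihilates, because divided differences square to zero, and the
    remaining letters are then too few to reach the identity. Otherwise each letter removes one
    inversion. Hence all reduced words contribute the same amount. *)
Lemma ddiffs_schub l w : all (fun j : 'I_n => (0 < j)%N) l -> size l = ninv w ->
  eq_inj (ddiffs l (schub w)) (fun x => if word_act l w == 1%g then schub 1%g x else 0).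
Proof.
elim: l w => [|j l IH] w /=.
  by move=> _ /esym/ninv0 -> x xi; rewrite eqxx.
case/andP => j0 lpos sz x xi.
case/orP: (tau_ltgt w j0) => lw.
  rewrite (ddiffs_eq l (ddiff_schub_ascent j0 lw)) // ddiffs0.
  case: eqP => // e; have := ninv_word_act (tau j * w)%g lpos.
  rewrite (ninv_tau_lt j0 lw) e; have -> : ninv (1%g : 'S_n) = 0%N.
    by apply/eqP; rewrite cards_eq0; apply/eqP/finset.setP => -[a b]; rewrite !inE !perm1 /=; lia.
  by lia.
rewrite (ddiffs_eq l (schub_descent j0 lw)) // IH //.
by have := ninv_tau_gt j0 lw; lia.
Qed.

End DividedDifferences.

(** * Exponent vectors and transposed divided differences *)

Section ExponentPaths.
Variable n : nat.
Implicit Types (a b : 'I_n -> nat) (j p q : 'I_n).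

Definition upd2 a p q (c d : nat) : 'I_n -> nat :=
  fun i => if i == p then c else if i == q then d else a i.

Section DualOperators.
Variable A : zmodType.
Implicit Types Phi Psi : ('I_n -> nat) -> A.

(* the transpose of the divided difference on exponents: [ddiff j] sends the
   monomial of exponent [a] to the signed sum of the monomials listed here *)
Definition dual_dd j Phi a : A :=
  \sum_(a j <= c < a (ord_pred j)) Phi (upd2 a (ord_pred j) j c (a (ord_pred j) + a j - c).-1)
  - \sum_(a (ord_pred j) <= c < a j) Phi (upd2 a (ord_pred j) j c (a (ord_pred j) + a j - c).-1).

Definition dual_sum (Q : pred 'I_n) Phi a : A := \sum_(j | Q j) dual_dd j Phi a.

Lemma dual_dd_sum j I (r : seq I) (P : pred I) (F : I -> ('I_n -> nat) -> A) a :
  dual_dd j (fun b => \sum_(i <- r | P i) F i b) a = \sum_(i <- r | P i) dual_dd j (F i) a.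
Proof. by rewrite /dual_dd sumrB; congr (_ - _); rewrite exchange_big. Qed.

Lemma dual_dd0 j a : dual_dd j (fun=> 0) a = 0 :> A.
Proof. by rewrite /dual_dd !big1 ?subr0. Qed.

End DualOperators.

Lemma dual_dd_morph (A B : zmodType) (h : {additive A -> B}) j (Phi : ('I_n -> nat) -> A) a :
  dual_dd j (fun b => h (Phi b)) a = h (dual_dd j Phi a).
Proof. by rewrite /dual_dd raddfB !raddf_sum. Qed.

Lemma dual_sum_morph (A B : zmodType) (h : {additive A -> B}) Q (Phi : ('I_n -> nat) -> A) a :
  dual_sum Q (fun b => h (Phi b)) a = h (dual_sum Q Phi a).
Proof. by rewrite /dual_sum raddf_sum; apply: eq_bigr => j _; rewrite dual_dd_morph. Qed.

Definition letters (Q : nat -> bool) : pred 'I_n := fun j : 'I_n => (0 < j)%N && Q j.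

(** An invariant of the exponents reached from the staircase without the letter [k]: they stay under
    the staircase, and the first [k] of them cannot fall below [n - k], the least value they have at
    the start. *)
Definition expo_set k (M : nat) a : Prop :=
  [/\ (forall i : 'I_n, (a i <= n.-1 - i)%N),
      (forall i : 'I_n, (i < k)%N -> (n - k <= a i)%N) &
      (\sum_i a i)%N = M].

Lemma sum_upd2 a p q c d : p != q ->
  (\sum_i upd2 a p q c d i + a p + a q = \sum_i a i + c + d)%N.
Proof.
move=> pq; have qp : q != p by rewrite eq_sym.
rewrite (bigD1 p) //= (bigD1 q) //= [in RHS](bigD1 p) //= [in RHS](bigD1 q) //=.
rewrite {1 2}/upd2 eqxx (negbTE qp) eqxx.
rewrite (eq_bigr a) => [|i /andP[ip iq]]; last by rewrite /upd2 (negbTE ip) (negbTE iq).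
lia.
Qed.

(** Both new exponents lie between the smaller old one and the larger old one minus 1. The minus 1
    preserves the staircase bound, and the lower bound survives because only the letter [k] mixes
    the first [k] positions with the others. *)
Lemma expo_set_step k M a j c : (k <= n)%N -> letters (fun i => i != k) j ->
  expo_set k M.+1 a ->
  (a j <= c < a (ord_pred j))%N || (a (ord_pred j) <= c < a j)%N ->
  expo_set k M (upd2 a (ord_pred j) j c (a (ord_pred j) + a j - c).-1).
Proof.
move=> kn /andP[j0 jk] [ha1 ha2 ha3] hc; have pj := val_ord_pred j0.
have h1 := ha1 j; have h2 := ha1 (ord_pred j); rewrite pj in h2.
have h3 := ha2 j; have h4 := ha2 (ord_pred j); rewrite pj in h4.
have nj := ltn_ord j.
split=> [i|i ik|].
- rewrite /upd2; case: eqP => [->|_]; first by rewrite pj; lia.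
  by case: eqP => [->|_]; [lia|exact: ha1].
- rewrite /upd2; case: eqP => [e|_]; first by move: ik; rewrite e pj => ik; lia.
  by case: eqP => [e|_]; [move: ik; rewrite e => ik; lia|exact: ha2].
- have := sum_upd2 a c (a (ord_pred j) + a j - c).-1 (ord_pred_neq j0).
  by rewrite ha3; lia.
Qed.

Lemma dual_dd_congr (A : zmodType) k M (Phi Psi : ('I_n -> nat) -> A) a j :
  (k <= n)%N -> letters (fun i => i != k) j -> expo_set k M.+1 a ->
  (forall b, expo_set k M b -> Phi b = Psi b) ->
  dual_dd j Phi a = dual_dd j Psi a.
Proof.
move=> kn jk ha H; rewrite /dual_dd; congr (_ - _); apply: eq_big_nat => c hc;
  by apply: H; apply: expo_set_step ha _; rewrite ?hc ?orbT.
Qed.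

Lemma dual_sum_congr (A : zmodType) k M (Phi Psi : ('I_n -> nat) -> A) a :
  (k <= n)%N -> expo_set k M.+1 a ->
  (forall b, expo_set k M b -> Phi b = Psi b) ->
  dual_sum (letters (fun i => i != k)) Phi a = dual_sum (letters (fun i => i != k)) Psi a.
Proof. by move=> kn ha H; apply: eq_bigr => j jk; exact: dual_dd_congr H. Qed.

Lemma dual_sum_expo0 (A : zmodType) k Q (Phi : ('I_n -> nat) -> A) a :
  expo_set k 0 a -> dual_sum Q Phi a = 0.
Proof.
case=> _ _ /eqP; rewrite sum_nat_eq0 => /forallP a0; apply: big1 => j _.
have h i : a i = 0%N by apply/eqP; exact: (a0 i).
by rewrite /dual_dd !h !big_nil subr0.
Qed.

End ExponentPaths.

(** * Divided differences of monomials *)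

Section Monomials.
Variables (R : realFieldType) (n : nat).
Implicit Types (a : 'I_n -> nat) (x : 'I_n -> R) (j : 'I_n).

Definition mono x a : R := \prod_i x i ^+ a i.

Lemma mono_upd2 x a p q c d : p != q ->
  mono x (upd2 a p q c d) = x p ^+ c * x q ^+ d * \prod_(i | (i != p) && (i != q)) x i ^+ a i.
Proof.
move=> pq; have qp : q != p by rewrite eq_sym.
rewrite /mono (bigD1 p) //= (bigD1 q) //= /upd2 eqxx (negbTE qp) eqxx mulrA.
by congr (_ * _); apply: eq_bigr => i /andP[/negbTE -> /negbTE ->].
Qed.

Lemma upd2_id a p q : upd2 a p q (a p) (a q) = a.
Proof. by apply/funext => i; rewrite /upd2; case: eqP => [->//|_]; case: eqP => [->|]. Qed.

Lemma mono_tau x a j : (0 < j)%N ->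
  mono (x \o tau j) a = mono x (upd2 a (ord_pred j) j (a j) (a (ord_pred j))).
Proof.
move=> j0; have pq := ord_pred_neq j0.
rewrite -{1}(upd2_id a (ord_pred j) j) !mono_upd2 //= /tau tpermL tpermR.
congr (_ * _); first by rewrite mulrC.
by apply: eq_bigr => i /andP[i1 i2]; rewrite tpermD // eq_sym.
Qed.

(** The usual factorisation of a difference of powers. The two sums cover the two orders of [a] and
    [b]; at least one of them is empty. *)
Lemma geometric_dd (u v : R) (a b : nat) : u - v != 0 ->
  (u ^+ a * v ^+ b - u ^+ b * v ^+ a) / (u - v) =
  \sum_(b <= c < a) u ^+ c * v ^+ (a + b - c).-1 - \sum_(a <= c < b) u ^+ c * v ^+ (a + b - c).-1.
Proof.
move=> uv.
have tel (s t : nat) : (t <= s)%N ->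
    (\sum_(t <= c < s) u ^+ c * v ^+ (s + t - c).-1) * (u - v) = u ^+ s * v ^+ t - u ^+ t * v ^+ s.
  move=> ts; rewrite mulr_suml.
  rewrite (eq_big_nat _ _ (F2 := fun c => u ^+ c.+1 * v ^+ (s + t - c.+1) - u ^+ c * v ^+ (s + t - c))).
    by rewrite telescope_sumr // addKn addnK.
  move=> c /andP[c1 c2].
  rewrite (_ : (s + t - c)%N = (s + t - c.+1).+1); last by lia.
  by rewrite -pred_Sn !exprS; ring.
apply: (mulIf uv); rewrite divfK //.
have [ba|ab] := leqP b a.
  by rewrite mulrBl tel // (big_geq ba) mul0r subr0.
rewrite (big_geq (ltnW ab)) sub0r mulNr addnC tel ?(ltnW ab) //.
by ring.
Qed.

Lemma ddiff_mono x a j : (0 < j)%N -> injective x ->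
  ddiff j (fun y => mono y a) x = dual_dd j (mono x) a.
Proof.
move=> j0 xi; have pq := ord_pred_neq j0; have d := inj_sub_neq0 xi pq.
rewrite /ddiff /= mono_tau // -{1}(upd2_id a (ord_pred j) j) !mono_upd2 // -mulrBl mulrAC.
rewrite geometric_dd // mulrBl !mulr_suml /dual_dd; congr (_ - _).
  by apply: eq_bigr => c _; rewrite mono_upd2.
by apply: eq_bigr => c _; rewrite mono_upd2.
Qed.

Lemma ddiffs_sum (l : seq 'I_n) I (r : seq I) (F : I -> ('I_n -> R) -> R) x :
  ddiffs l (fun y => \sum_(i <- r) F i y) x = \sum_(i <- r) ddiffs l (F i) x.
Proof.
elim: l F => //= j l IH F; rewrite -IH; congr (ddiffs l _ x); apply/funext => y.
by rewrite /ddiff -sumrB mulr_suml.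
Qed.

Lemma ddiffsB (l : seq 'I_n) f g x :
  ddiffs l (fun y : 'I_n -> R => f y - g y) x = ddiffs l f x - ddiffs l g x.
Proof.
elim: l f g => //= j l IH f g; rewrite -IH; congr (ddiffs l _ x); apply/funext => y.
by rewrite /ddiff -mulrBl; congr (_ / _); ring.
Qed.

(** Transposition reverses the nesting: the first letter, applied first to the function, becomes the
    outermost operator on the exponent side. *)
Lemma ddiffs_mono (l : seq 'I_n) x a : all (fun j : 'I_n => (0 < j)%N) l -> injective x ->
  ddiffs l (fun y => mono y a) x = foldr (fun j Phi => dual_dd j Phi) (mono x) l a.
Proof.
move=> + xi; elim: l a => [|j l IH] a //= /andP[j0 lpos].
have e : eq_inj (ddiff j (fun y => mono y a)) (fun y => dual_dd j (mono y) a).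
  by move=> y yi; exact: ddiff_mono.
rewrite (ddiffs_eq l e) // /dual_dd ddiffsB !ddiffs_sum; congr (_ - _).
  by apply: eq_bigr => c _; exact: IH.
by apply: eq_bigr => c _; exact: IH.
Qed.

(** One predicate per position: the sum over all words allowed position by position factors into a
    composition of summed operators. *)
Lemma sum_words (qs : seq (pred 'I_n)) (Phi : ('I_n -> nat) -> R) a :
  \sum_(t : (size qs).-tuple 'I_n | all2 (fun (q : pred 'I_n) j => q j) qs t)
     foldr (fun j F => dual_dd j F) Phi t a =
  foldr (fun q F => dual_sum q F) Phi qs a.
Proof.
elim: qs a => [|q qs IH] a /=.
  rewrite (big_pred1 [tuple]) //= => t; rewrite tuple0 eqxx /=.
rewrite (reindex (fun u : 'I_n * (size qs).-tuple 'I_n => [tuple of u.1 :: u.2])) /=; last first.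
  exists (fun t => (thead t, [tuple of behead t])) => [[j t] _|t _] /=.
    by rewrite theadE; congr (_, _); apply: val_inj.
  by rewrite -tuple_eta.
rewrite -(pair_big_dep q (fun _ (t : (size qs).-tuple 'I_n) => all2 (fun (q : pred 'I_n) j => q j) qs t)
   (fun j (t : (size qs).-tuple 'I_n) => dual_dd j (foldr (fun j F => dual_dd j F) Phi t) a)) /=.
apply: eq_bigr => j qj; rewrite -dual_dd_sum.
by rewrite /dual_dd; congr (_ - _); apply: eq_bigr => c _; rewrite IH.
Qed.

End Monomials.

(** * Counting words that avoid a letter *)

Section CountWords.
Variables (R : realFieldType) (n k : nat).
Hypothesis N0 : (0 < Nn n)%N.
Hypothesis k0 : (0 < k)%N.

Definition stair (i : 'I_n) : nat := (n.-1 - i)%N.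

Lemma word_act_prod (l : seq 'I_n) (w : 'S_n) :
  (word_act l w == 1%g) = ((\prod_(j <- l) tau j)%g == w).
Proof.
elim: l w => [|j l IH] w /=; first by rewrite big_nil eq_sym.
rewrite IH big_cons -(inj_eq (mulgI (tau j))) mulgA tau_invol mul1g.
by [].
Qed.

Lemma avoid_hit_letters (s : {ffun 'I_(Nn n) -> 'I_n}) m : (m <= Nn n)%N ->
  avoid (hit k s) 1 m = [forall i : 'I_(Nn n), (i < m)%N ==> ((s i : nat) != k)].
Proof.
move=> mN.
have e (d : nat) (dN : (d < Nn n)%N) : sext s (1 + d%:Z) = s (Ordinal dN).
  rewrite /sext (_ : 1 + d%:Z - 1 = d%:Z); last by ring.
  by rewrite divz_small ?modz_small //=; try lia; rewrite s_at_lt.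
apply/avoidP/forallP => H.
  move=> i; apply/implyP => im; have := H i im; rewrite /hit (e _ (ltn_ord i)).
  by rewrite (_ : Ordinal _ = i) //; apply: ord_inj.
move=> d dm; have dN := leq_trans dm mN; have := H (Ordinal dN).
by rewrite /= dm /hit (e _ dN).
Qed.

(** Every word of length [N] whose first [m] letters differ from [k] is applied to the staircase
    monomial, the Schubert function of the reversal. A word contributes [schub] at the identity if
    it is a sorting network, and 0 otherwise. This common factor is not evaluated; it cancels in the
    end. *)
Lemma wcount_dual x m : (m <= Nn n)%N -> injective x ->
  (wcount n k m)%:R * schub (fun y : 'I_n -> R => mono y stair) 1%g x =
  iter m (dual_sum (letters (fun i => i != k)))
    (iter (Nn n - m) (dual_sum (letters (fun i => true))) (mono x)) stair.
Proof.
move=> mN xi.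
pose qs := nseq m (@letters n (fun i => i != k)) ++ nseq (Nn n - m) (@letters n (fun i => true)).
have sz : size qs = Nn n by rewrite size_cat !size_nseq subnKC.
have -> : iter m (dual_sum (letters (fun i => i != k)))
    (iter (Nn n - m) (dual_sum (letters (fun i => true))) (mono x)) stair =
    foldr (fun q F => dual_sum q F) (mono x) qs stair.
  rewrite foldr_cat; congr (_ stair).
  have it (q : pred 'I_n) r F : foldr (fun q F => dual_sum q F) F (nseq r q) = iter r (dual_sum q) F :> (_ -> R).
    by elim: r => //= r ->.
  by rewrite !it.
rewrite -sum_words.
have all2P (t : (size qs).-tuple 'I_n) : all2 (fun (q : pred 'I_n) j => q j) qs t =
    all (fun j : 'I_n => (0 < j)%N) t && [forall i : 'I_(size qs), (i < m)%N ==> ((tnth t i : nat) != k)].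
  have nq i : (i < size qs)%N -> nth xpred0 qs i = letters (fun b => (i < m)%N ==> (b != k)).
    rewrite sz => iN; rewrite nth_cat size_nseq; case: ltnP => im; rewrite nth_nseq ?im //.
    by rewrite ltn_sub2r //; apply: leq_ltn_trans im iN.
  have n0 : (0 < n)%N by move: N0; rewrite /Nn bin_gt0; lia.
  rewrite all2E size_tuple eqxx /=; apply/(all_nthP (xpred0, Ordinal n0))/andP.
    move=> H; have H' (i : 'I_(size qs)) : letters (fun b => (i < m)%N ==> (b != k)) (tnth t i).
      have := H i; rewrite size_zip size_tuple minnn => /(_ (ltn_ord i)).
      by rewrite nth_zip ?size_tuple //= nq ?ltn_ord // -tnth_nth.
    split; last by apply/forallP => i; case/andP: (H' i).
    by apply/all_tnthP => i; case/andP: (H' i).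
  case=> /all_tnthP h1 /forallP h2 i; rewrite size_zip size_tuple minnn => il.
  rewrite nth_zip ?size_tuple //= nq //.
  by rewrite -(tnth_nth _ t (Ordinal il)); apply/andP; split; [exact: h1|exact: (h2 (Ordinal il))].
transitivity (\sum_(t : (size qs).-tuple 'I_n | all2 (fun (q : pred 'I_n) j => q j) qs t)
   (if (\prod_(j <- t) tau j)%g == revp n then schub (fun y : 'I_n -> R => mono y stair) 1%g x else 0)).
  rewrite -big_mkcondr /=.
  transitivity (#|[set t : (size qs).-tuple 'I_n | all2 (fun (q : pred 'I_n) j => q j) qs t
      && ((\prod_(j <- t) tau j)%g == revp n)]%SET|%:R *
      schub (fun y : 'I_n -> R => mono y stair) 1%g x); last first.
    by rewrite mulr_natl -sumr_const; apply: eq_bigl => t; rewrite inE.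
  congr (_%:R * _).
  rewrite /wcount; move: all2P; rewrite sz => all2P.
  pose h (t : (Nn n).-tuple 'I_n) : {ffun 'I_(Nn n) -> 'I_n} := [ffun i => tnth t i].
  have hinj : injective h.
    by move=> t1 t2 /ffunP e; apply: eq_from_tnth => i; have := e i; rewrite !ffunE.
  rewrite -(card_imset _ hinj); apply: eq_card => s; rewrite in_sep avoid_hit_letters //.
  have hs : h [tuple s i | i < Nn n] = s by apply/ffunP => i; rewrite ffunE tnth_mktuple.
  have prodh (t : (Nn n).-tuple 'I_n) : (\prod_(i < Nn n) tau (h t i))%g = (\prod_(j <- t) tau j)%g.
    by rewrite [RHS]big_tuple; apply: eq_bigr => i _; rewrite ffunE.
  apply/andP/imsetP => [[]|[t]].
    rewrite inE => /andP[/forallP h1 /eqP h2] /forallP h3.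
    exists [tuple s i | i < Nn n]; last by rewrite hs.
    rewrite inE all2P -prodh hs h2 eqxx andbT; apply/andP; split.
      by apply/all_tnthP => i; rewrite tnth_mktuple.
    by apply/forallP => i; rewrite tnth_mktuple; exact: h3.
  rewrite inE all2P => /andP[/andP[/all_tnthP h1 /forallP h3] /eqP h2] ->.
  rewrite inE prodh h2 eqxx andbT; split; apply/forallP => i; rewrite ffunE; first exact: h1.
  exact: h3.
apply: eq_bigr => t; rewrite all2P => /andP[tpos _].
rewrite -ddiffs_mono // -word_act_prod.
rewrite -[in RHS](schub_revp (fun y : 'I_n -> R => mono y stair)).
by rewrite ddiffs_schub // size_tuple sz ninv_revp.
Qed.

End CountWords.

(** * Determinants with killed rows *)

Lemma deriv_prod_seq (R : comNzRingType) (I : eqType) (s : seq I) (f : I -> {poly R}) : uniq s ->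
  (\prod_(i <- s) f i)^`() = \sum_(p <- s) \prod_(i <- s) (if i == p then (f i)^`() else f i).
Proof.
elim: s => [|i0 s IH] /=; first by rewrite !big_nil -polyC1 derivC.
case/andP=> ni us; rewrite !big_cons derivM IH // eqxx; congr (_ + _).
  congr (_ * _); apply: eq_big_seq => i si; case: eqP => // e.
  by move: ni; rewrite -e si.
rewrite mulr_sumr; apply: eq_big_seq => p sp; rewrite big_cons.
by case: eqP => // e; move: ni; rewrite e sp.
Qed.

Lemma deriv_det (R : comNzRingType) n (M : 'M[{poly R}]_n) : (\det M)^`() =
  \sum_p \det (\matrix_(i, j) if i == p then (M i j)^`() else M i j).
Proof.
rewrite /determinant raddf_sum /= exchange_big /=; apply: eq_bigr => s _.
have sgn (q : {poly R}) : ((-1) ^+ s * q)^`() = (-1) ^+ s * q^`().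
  by case: (s : bool); rewrite ?expr0 ?expr1 ?mul1r // !mulN1r derivN.
rewrite sgn deriv_prod_seq ?index_enum_uniq // mulr_sumr; apply: eq_bigr => p _.
by congr (_ * _); apply: eq_bigr => i _; rewrite mxE.
Qed.

Lemma double_eq0 (R : realFieldType) (z : {poly R}) : z = - z -> z = 0.
Proof.
move/eqP; rewrite -subr_eq0 opprK -mulr2n -scaler_nat scaler_eq0 pnatr_eq0 /=.
by move/eqP.
Qed.

(** Reflecting [c] exchanges the two arguments, so all terms cancel in pairs except the last one of
    the nonempty sum. *)
Lemma antisym_sum (R : realFieldType) (g : nat -> nat -> {poly R}) (a b e : nat) :
  (forall c d, g c d = - g d c) ->
  \sum_(b <= c < a) g (c + e.+1)%N ((a + b - c).-1 + e)%N
  - \sum_(a <= c < b) g (c + e.+1)%N ((a + b - c).-1 + e)%N = g (a + e)%N (b + e)%N.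
Proof.
move=> gA.
have key (s t : nat) : \sum_(s <= c < t) g (c + e.+1)%N ((t.+1 + s - c).-1 + e)%N = 0.
  apply: double_eq0; rewrite {1}big_nat_rev /= -sumrN; apply: eq_big_nat => c /andP[c1 c2].
  by rewrite gA; congr (- g _ _); lia.
have [ab|ba|->] := ltngtP a b.
- rewrite (big_geq (ltnW ab)) sub0r; case: b ab => // t at_.
  have -> : \sum_(a <= c < t.+1) g (c + e.+1)%N ((a + t.+1 - c).-1 + e)%N = g (t.+1 + e)%N (a + e)%N.
    rewrite big_nat_recr //= [X in X + _](_ : _ = 0); last first.
      by rewrite -[RHS](key a t); apply: eq_bigr => c _; rewrite [(a + t.+1)%N]addnC.
    by rewrite add0r; congr (g _ _); lia.
  by rewrite -gA.
- rewrite (big_geq (ltnW ba)) subr0; case: a ba => // t bt.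
  by rewrite big_nat_recr //= key add0r; congr (g _ _); lia.
- rewrite !big_geq // subr0; apply/esym/double_eq0; exact: gA.
Qed.

Section KilledDeterminant.
Variables (R : realFieldType) (n k w : nat) (r : R).
Implicit Types (i j p q : 'I_n) (L a : 'I_n -> nat).

(** The divided power [t^(l - j) / (l - j)!], over an arbitrary algebra because it serves both for
    numbers and for polynomials in the time variable. *)
Definition pw (S : comAlgType R) (t : S) (l j : nat) : S :=
  if (j <= l)%N then ((l - j)`!%:R^-1) *: t ^+ (l - j) else 0.

(* for [i < k], the generating polynomial (in the time variable) of walks that
   go down from [l] without passing below [w] *)
Definition psi (i l j : nat) : {poly R} :=
  if (i < k)%N then
    \sum_(w <= m < l.+1) pw ('X - r%:P) (l - m) 0 * (pw (r : R^o) m j)%:P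
  else pw ('X - 0%:P) l j.

Lemma deriv_pw (c : R) (l j : nat) : (pw ('X - c%:P) l.+1 j)^`() = pw ('X - c%:P) l j.
Proof.
rewrite /pw; case: (ltngtP j l.+1) => [jl|jl|->].
- rewrite ltnS in jl; rewrite jl derivZ deriv_exp derivXsubC mul1r.
  rewrite subSn // -[_ *+ _.+1]scaler_nat scalerA; congr (_ *: _).
  by rewrite factS natrM invfM mulrAC mulVf ?mul1r // pnatr_eq0.
- by rewrite leqNgt (ltnW jl) deriv0.
- by rewrite ltnn subnn expr0 derivZ -polyC1 derivC scaler0.
Qed.

Lemma deriv_pw0 (c : R) (j : nat) : (pw ('X - c%:P) 0 j)^`() = 0.
Proof.
rewrite /pw; case: ifP => _; rewrite ?deriv0 // sub0n expr0 derivZ -polyC1 derivC.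
by rewrite scaler0.
Qed.

Lemma deriv_psi (i0 l j0 : nat) : (psi i0 l.+1 j0)^`() = psi i0 l j0.
Proof.
rewrite /psi; case: ifP => _; last exact: deriv_pw.
have [lw|wl] := ltnP l.+1 w; first by rewrite !big_geq ?deriv0 // ltnW.
rewrite big_nat_recr //= derivD derivM derivC mulr0 addr0 subnn deriv_pw0 mul0r addr0.
rewrite raddf_sum /=; apply: eq_big_nat => m /andP[wm ml].
by rewrite derivM derivC mulr0 addr0 subSn // deriv_pw.
Qed.

Lemma deriv_psi0 (i0 j0 : nat) : (psi i0 0 j0)^`() = 0.
Proof.
rewrite /psi; case: ifP => _; last exact: deriv_pw0.
rewrite raddf_sum /= big_nat_cond big1 // => m /andP[/andP[_ m1] _].
by rewrite derivM derivC mulr0 addr0 sub0n deriv_pw0 mul0r.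
Qed.

Lemma psi_below (i0 l j0 : nat) : (i0 < k)%N -> (l < w)%N -> psi i0 l j0 = 0.
Proof. by move=> ik lw; rewrite /psi ik big_geq. Qed.

Definition detL L : {poly R} := \det (\matrix_(i < n, j < n) psi i (L i) j).

Definition lowrow p L : 'I_n -> nat := fun i => if i == p then (L p).-1 else L i.

Lemma deriv_detL L : (detL L)^`() =
  \sum_p (if L p is _.+1 then detL (lowrow p L) else 0).
Proof.
rewrite /detL deriv_det; apply: eq_bigr => p _.
case e : (L p) => [|l].
  rewrite (expand_det_row _ p) big1 // => j _.
  by rewrite !mxE eqxx e deriv_psi0 mul0r.
congr (\det _); apply/matrixP => i j; rewrite !mxE /lowrow.
by case: eqP => // ->; rewrite e deriv_psi.
Qed.

(** Antisymmetry holds only inside each block, killed and free rows having different entries. The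
    two rows touched by a letter lie in different blocks only for the letter [k]. *)
Lemma detL_swap L p q c d : p != q -> (p < k)%N = (q < k)%N ->
  detL (upd2 L p q c d) = - detL (upd2 L p q d c).
Proof.
move=> pq pqk; have qp : q != p by rewrite eq_sym.
have -> : detL (upd2 L p q c d) = \det (row_perm (tperm p q) (\matrix_(i < n, j < n) psi i (upd2 L p q d c i) j)).
  congr (\det _); apply/matrixP => i j; rewrite !mxE /upd2.
  case: tpermP => [->|->|/eqP ip /eqP iq].
  - by rewrite eqxx (negbTE qp) eqxx /psi pqk.
  - by rewrite (negbTE qp) !eqxx /psi pqk.
  - by rewrite (negbTE ip) (negbTE iq).
by rewrite row_permE det_mulmx det_perm odd_tperm pq expr1 mulN1r.
Qed.

Definition shape_of a : 'I_n -> nat := fun i => (a i + (n.-1 - i))%N.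
Definition detE a : {poly R} := detL (shape_of a).

(** In the shifted exponents the two rows enter antisymmetrically, so [antisym_sum] leaves a single
    term; the shift of row [j - 1] exceeds that of row [j] by one, and this is the unit lost. *)
Lemma dual_dd_detE a j : letters (fun i : nat => i != k) j ->
  dual_dd j detE a = detL (lowrow (ord_pred j) (shape_of a)).
Proof.
case/andP=> j0 jk; have pj := val_ord_pred j0; have pq := ord_pred_neq j0.
set p := ord_pred j; pose L := shape_of a.
have blk : (p < k)%N = (j < k)%N by rewrite pj; lia.
have nj := ltn_ord j.
pose g c d := detL (upd2 L p j c d).
have gA c d : g c d = - g d c by apply: detL_swap.
pose e := (n.-1 - j)%N.
have ep : (n.-1 - p = e.+1)%N by rewrite /e pj; lia.
have gE c d : detE (upd2 a p j c d) = g (c + e.+1)%N (d + e)%N.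
  rewrite /detE /g; congr detL; apply/funext => i; rewrite /shape_of /upd2 /L /shape_of.
  by case: eqP => [->|_]; [rewrite ep|case: eqP => [->|_]].
rewrite /dual_dd -/p.
under eq_bigr do rewrite gE.
under [X in _ - X]eq_bigr do rewrite gE.
rewrite (antisym_sum _ _ _ gA) /g; congr detL; apply/funext => i.
rewrite /upd2 /lowrow /L /shape_of; case: eqP => [_|_]; first by rewrite ep addnS.
by case: eqP => [->|].
Qed.

Hypothesis kn : (k <= n)%N.
Hypothesis wE : w = (2 * (n - k))%N.

(** The derivative lowers each row in turn, and row [j - 1] belongs to the letter [j]. Two rows have
    no allowed letter, and their terms vanish: the last row, whose shifted exponent is 0, and row
    [k - 1], which sits exactly at the killing level [w]. *)
Lemma dual_sum_detE M a : expo_set k M a ->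
  dual_sum (letters (fun i : nat => i != k)) detE a = (detE a)^`().
Proof.
case=> h1 h2 _; rewrite /detE deriv_detL.
pose F p := if shape_of a p is _.+1 then detL (lowrow p (shape_of a)) else 0 : {poly R}.
rewrite -/(\sum_p F p).
(* [ord_pred] is cyclic: the index 0, which is no letter, is sent to the last row. *)
rewrite [RHS](reindex_inj (@ord_pred_inj n)) /= /dual_sum.
rewrite big_mkcond; apply: eq_bigr => j _.
case: ifP => [jk|/negbT]; rewrite /letters.
  rewrite dual_dd_detE //; case/andP: (jk) => j0 _; have pj := val_ord_pred j0.
  rewrite /F; case e : (shape_of a (ord_pred j)) => [|l] //.
  by move: e; rewrite /shape_of pj; have := ltn_ord j; lia.
rewrite negb_and -leqNgt leqn0 negbK => /orP[/eqP j0|/eqP jk].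
  have pj : (ord_pred j : nat) = n.-1 by rewrite /ord_pred /= j0 add0n modn_small //; have := ltn_ord j; lia.
  have := h1 (ord_pred j); rewrite pj subnn leqn0 => /eqP a0.
  by rewrite /F /shape_of a0 pj subnn.
have [k0|k0] := posnP k.
  have pj : (ord_pred j : nat) = n.-1 by rewrite /ord_pred /= jk k0 add0n modn_small //; have := ltn_ord j; lia.
  have := h1 (ord_pred j); rewrite pj subnn leqn0 => /eqP a0.
  by rewrite /F /shape_of a0 pj subnn.
have j0 : (0 < j)%N by rewrite jk.
have pj := val_ord_pred j0; have nj := ltn_ord j.
have pk : (ord_pred j < k)%N by rewrite pj; lia.
have := h1 (ord_pred j); have := h2 _ pk; rewrite pj => g1 g2.
(* For row [k - 1] the upper and the lower bound on the exponent coincide. *)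
have e : shape_of a (ord_pred j) = w by rewrite /shape_of wE pj; lia.
rewrite /F e; case ew : w => [|w'] //.
rewrite /detL (expand_det_row _ (ord_pred j)) big1 // => c _.
by rewrite !mxE /lowrow eqxx e psi_below ?mul0r // ew.
Qed.

Lemma iter_dual_sum_detE m M a : expo_set k M a ->
  iter m (dual_sum (letters (fun i : nat => i != k))) detE a = (detE a)^`(m).
Proof.
elim: m M a => [|m IH] M a ha; first by rewrite derivn0.
rewrite iterS derivSn -(dual_sum_detE ha).
case: M ha => [|M] ha.
  by rewrite !(dual_sum_expo0 _ _ ha) linear0.
rewrite (dual_sum_congr (Psi := fun b => (detE b)^`(m)) kn ha); last exact: IH.
by rewrite (dual_sum_morph (derivn m)).
Qed.

(** Each operator lowers the degree of the exponents by one. This bounds the degree of [detE]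
    without expanding it. *)
Lemma derivn_detE_gt m M a : expo_set k M a -> (M < m)%N -> (detE a)^`(m) = 0.
Proof.
move=> ha Mm; rewrite -(iter_dual_sum_detE m ha).
elim: m M a ha Mm => // m IH [|M] a ha Mm; rewrite iterS.
  exact: dual_sum_expo0 ha.
rewrite (dual_sum_congr (Psi := fun=> 0) kn ha) => [|b hb]; last exact: IH hb _.
by rewrite /dual_sum big1 // => j _; rewrite dual_dd0.
Qed.

End KilledDeterminant.

(** * Evaluation of the determinants *)

Section DetEvaluation.
Variables (R : realFieldType) (n : nat).
Implicit Types (a : 'I_n -> nat).

(** For a partition [a] this is, up to sign, Aitken's determinant: the number of standard tableaux
    of shape [a] divided by the factorial of their size. *)
Definition hookV a : R := \det (\matrix_(i < n, j < n) pw (1 : R^o) (shape_of a i) j).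

Lemma pwX_mul (l j : nat) : pw ('X - 0%:P : {poly R}) l j * 'X^j = 'X^l * (pw (1 : R^o) l j)%:P.
Proof.
rewrite /pw polyC0 subr0; case: leqP => jl; last by rewrite mul0r polyC0 mulr0.
rewrite -scalerAl -exprD subnK // expr1n mulrC mul_polyC.
by congr (_ *: _); rewrite /GRing.scale /= mulr1.
Qed.

Lemma sum_stair_rev : (\sum_(i < n) (n.-1 - i) = \sum_(j < n) j)%N.
Proof.
rewrite (reindex_inj rev_ord_inj) /=; apply: eq_bigr => i _; have := ltn_ord i; lia.
Qed.

(** Without killed rows the determinant is homogeneous: powers of the time variable factor out of
    rows and columns. *)
Lemma detE_nocut w r a : detE 0 w r a = (hookV a)%:P * 'X^(\sum_i a i).
Proof.
pose A := \matrix_(i < n, j < n) psi 0 w r i (shape_of a i) j.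
pose B := \matrix_(i < n, j < n) pw (1 : R^o) (shape_of a i) j.
have e : A *m diag_mx (\row_(j < n) 'X^j) =
         diag_mx (\row_(i < n) 'X^(shape_of a i)) *m map_mx polyC B.
  by apply/matrixP => i j; rewrite mul_mx_diag mul_diag_mx !mxE /psi ltn0 pwX_mul.
have := congr1 determinant e; rewrite !det_mulmx !det_diag det_map_mx.
rewrite -[\det A]/(detE 0 w r a) -[\det B]/(hookV a).
under eq_bigr do rewrite mxE.
under [in RHS]eq_bigr do rewrite mxE.
rewrite !prodrXr /shape_of big_split /= sum_stair_rev exprD => h.
have Xn0 : 'X^(\sum_(j < n) j) != 0 :> {poly R} by rewrite monic_neq0 // monicXn.
by apply: (mulIf Xn0); rewrite h; ring.
Qed.

Lemma horner_detE k w (r t : R) a : (detE k w r a).[t] =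
  \det (\matrix_(i < n, j < n) (psi k w r i (shape_of a i) j).[t]).
Proof.
rewrite -[LHS]/(horner_eval t (detE k w r a)) -det_map_mx.
by congr (\det _); apply/matrixP => i j; rewrite !mxE.
Qed.

Lemma horner_pw (c t : R) (l j : nat) : (pw ('X - c%:P) l j).[t] = pw (t - c : R^o) l j.
Proof. by rewrite /pw; case: ifP => _; rewrite ?horner0 // hornerZ horner_exp hornerXsubC. Qed.

(** At time [r] the powers of [X - r] leave only the term [m = l], which is present as long as [l]
    is not below [w]. *)
Lemma horner_psi_start k w r (i l j : nat) : ((i < k)%N -> (w <= l)%N) ->
  (psi k w r i l j).[r] = pw (r : R^o) l j.
Proof.
move=> h; rewrite /psi; case: ifP => [ik|_]; last by rewrite horner_pw subr0.
rewrite big_nat_recr ?h //= hornerD hornerM hornerC horner_pw subrr subnn.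
rewrite [pw _ 0 0]/pw subnn fact0 invr1 scale1r expr0 mul1r.
rewrite [X in X + _](_ : _ = 0) ?add0r //.
rewrite -[LHS]/(horner_eval r _) raddf_sum /= big_nat_cond big1 // => m /andP[/andP[_ ml] _].
rewrite /horner_eval hornerM horner_pw subrr /pw subn0 expr0n.
by have -> : (l - m == 0)%N = false by [lia]; rewrite scaler0 mul0r.
Qed.

Lemma horner_detE_start k w r M a : (k <= n)%N -> w = (2 * (n - k))%N -> expo_set k M a ->
  (detE k w r a).[r] = r ^+ M * hookV a.
Proof.
move=> kn wE [h1 h2 h3].
transitivity ((detE 0 w r a).[r]); last first.
  by rewrite detE_nocut h3 hornerM hornerC hornerXn mulrC.
rewrite !horner_detE; congr (\det _); apply/matrixP => i j; rewrite !mxE.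
rewrite !horner_psi_start // => ik; rewrite /shape_of wE; have := h2 i ik; lia.
Qed.

(** An Euler relation: for [k = 0] no row is killed and every letter is allowed, and the derivative
    at time 1 of a multiple of ['X^M] brings out the factor [M]. *)
Lemma dual_sum_hookV M a : expo_set 0 M a ->
  dual_sum (letters (fun i : nat => true)) hookV a = M%:R * hookV a.
Proof.
move=> ha; have := @dual_sum_detE R n 0 (2 * n) 0 isT _ M a ha; rewrite subn0 => /(_ erefl).
move/(congr1 (horner_eval 1)); rewrite -dual_sum_morph.
have e b : horner_eval 1 (detE 0 (2 * n) 0 b) = hookV b.
  by rewrite /horner_eval detE_nocut hornerM hornerC hornerXn expr1n mulr1.
have -> : dual_sum (letters (fun i : nat => i != 0%N))
     (fun b => horner_eval 1 (detE 0 (2 * n) 0 b)) a =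
   dual_sum (letters (fun i : nat => true)) hookV a.
  rewrite /dual_sum; apply: eq_big => [j|j _].
    by rewrite /letters andbT lt0n andbb.
  by rewrite /dual_dd; congr (_ - _); apply: eq_bigr => c _; rewrite e.
move=> ->; rewrite /horner_eval detE_nocut; case: ha => _ _ ->.
by rewrite derivM derivC mul0r add0r derivXn hornerM hornerC hornerMn hornerXn expr1n mulrC.
Qed.

Lemma dual_sum_scale (Q : pred 'I_n) (c : R) (Phi : ('I_n -> nat) -> R) a :
  dual_sum Q (fun b => c * Phi b) a = c * dual_sum Q Phi a.
Proof.
rewrite /dual_sum mulr_sumr; apply: eq_bigr => j _.
by rewrite /dual_dd mulrBr !mulr_sumr.
Qed.

(** After [M] steps only the exponent 0 is seen, where [mono x] is 1, that is, [hookV] up to a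
    constant; on the way, each step multiplies [hookV] by the current degree. *)
Lemma iter_dual_mono (x : 'I_n -> R) M a : expo_set 0 M a ->
  iter M (dual_sum (letters (fun i : nat => true))) (mono x) a * hookV (fun=> 0%N) =
  M`!%:R * hookV a.
Proof.
have lt : letters (fun i : nat => true) =1 letters (fun i : nat => i != 0%N) :> pred 'I_n.
  by move=> j; rewrite /letters andbT lt0n andbb.
elim: M a => [|M IH] a ha.
  have a0 : a = fun=> 0%N.
    case: ha => _ _ /eqP; rewrite sum_nat_eq0 => /forallP h.
    by apply/funext => i; apply/eqP; exact: (h i).
  by rewrite a0 /= fact0 mul1r /mono big1 ?mul1r // => i _; rewrite expr0.
rewrite iterS -[_ * _]mulrC.
rewrite -[LHS]/( *%R (hookV (fun=> 0%N)) _).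
have -> : hookV (fun=> 0%N) * dual_sum (letters (fun i : nat => true))
     (iter M (dual_sum (letters (fun i : nat => true))) (mono x)) a =
   dual_sum (letters (fun i : nat => i != 0%N)) (fun b => hookV (fun=> 0%N) *
     iter M (dual_sum (letters (fun i : nat => true))) (mono x) b) a.
  rewrite dual_sum_scale; congr (_ * _).
  by rewrite /dual_sum; apply: eq_bigl.
rewrite (dual_sum_congr (Psi := fun b => M`!%:R * hookV b) _ ha) //; last first.
  by move=> b hb; rewrite mulrC IH.
rewrite dual_sum_scale.
have -> : dual_sum (letters (fun i : nat => i != 0%N)) hookV a =
          dual_sum (letters (fun i : nat => true)) hookV a.
  by rewrite /dual_sum; apply: eq_bigl => j; rewrite lt.
by rewrite (dual_sum_hookV ha) factS natrM; ring.
Qed.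

Lemma expo_set_sub k M a : expo_set k M a -> expo_set 0 M a.
Proof. by case=> h1 _ h3; split. Qed.

Lemma expo_set_stair k : (k <= n)%N -> expo_set k (Nn n) (@stair n).
Proof.
move=> kn; split=> // [i ik|]; first by rewrite /stair; have := ltn_ord i; lia.
by rewrite /stair sum_stair_rev /Nn -bin2_sum big_mkord.
Qed.

Lemma horner_falling (l j : nat) :
  (\prod_(0 <= t < j) ('X - t%:R%:P : {poly R})).[l%:R] = (l ^_ j)%:R.
Proof.
elim: j => [|j IH]; first by rewrite big_geq // hornerC ffactn0.
rewrite big_nat_recr //= hornerM IH hornerXsubC ffactnSr natrM.
have [jl|lj] := leqP j l; first by rewrite natrB.
by rewrite ffact_small // !mul0r.
Qed.

Lemma pw1_fact (l j : nat) : pw (1 : R^o) l j * l`!%:R = (l ^_ j)%:R.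
Proof.
rewrite /pw; case: leqP => jl; last by rewrite ffact_small // mul0r.
rewrite expr1n -(ffact_fact jl) natrM /GRing.scale /= mulr1 mulrCA mulVf ?mulr1 //.
Qed.

(** A kernel vector gives, in the basis of falling factorials, a polynomial of degree less than [n]
    that vanishes at the [n] distinct shifted exponents. *)
Lemma hookV_stair_neq0 : hookV (@stair n) != 0.
Proof.
rewrite /hookV -det_tr; apply/negP => /det0P[v v0 /matrixP vA]; case/negP: v0; apply/eqP.
pose ff (j : nat) : {poly R} := \prod_(0 <= t < j) ('X - t%:R%:P).
pose P : {poly R} := \sum_(j < n) v 0 j *: ff j.
have PE (l : nat) : P.[l%:R] = \sum_(j < n) v 0 j * (l ^_ j)%:R.
  rewrite /P -[LHS]/(horner_eval l%:R _) raddf_sum /=; apply: eq_bigr => j _.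
  by rewrite /horner_eval hornerZ horner_falling.
have Pr (i : 'I_n) : P.[(shape_of (@stair n) i)%:R] = 0.
  have := vA 0 i; rewrite !mxE => e0; rewrite PE.
  have /(congr1 (fun z => z * (shape_of (@stair n) i)`!%:R)) := e0; rewrite mul0r mulr_suml => e1.
  rewrite -[RHS]e1; apply: eq_bigr => j _; rewrite !mxE -mulrA; congr (_ * _).
  by rewrite pw1_fact.
have sP : (size P <= n)%N.
  apply: (leq_trans (size_sum _ _ _)); apply/bigmax_leqP => j _.
  apply: (leq_trans (size_scale_leq _ _)).
  by rewrite /ff size_prod_XsubC size_iota subn0.
have P0 : P = 0.
  apply/eqP; apply/negP => /negP Pn0.
  pose rs := [seq (shape_of (@stair n) i)%:R : R | i <- enum 'I_n].
  have : (size rs < size P)%N.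
    apply: max_poly_roots => //.
      by apply/allP => z /mapP[i _ ->]; apply/eqP; exact: Pr.
    rewrite map_inj_uniq ?enum_uniq // => i1 i2 /eqP; rewrite eqr_nat => /eqP.
    rewrite /shape_of /stair => e; apply/val_inj => /=.
    by have := ltn_ord i1; have := ltn_ord i2; lia.
  by rewrite size_map size_enum_ord ltnNge sP.
(* Evaluation at [m] isolates the coefficient of the [m]-th falling factorial once the earlier ones
   vanish. *)
have vz m (j : 'I_n) : (j < m)%N -> v 0 j = 0.
  elim: m j => // m IH j; rewrite ltnS leq_eqVlt => /orP[/eqP jm|]; last exact: IH.
  have := PE m; rewrite P0 horner0 (bigD1 j) //= jm ffactnn big1 ?addr0.
    by move/esym/eqP; rewrite mulf_eq0 pnatr_eq0 -[_`! == _]negbK -lt0n fact_gt0 orbF => /eqP.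
  move=> i ij; have [im|mi] := ltnP i m; first by rewrite IH ?mul0r.
  rewrite ffact_small ?mulr0 // ltn_neqAle mi andbT.
  by apply: contra ij => /eqP e; apply/eqP/val_inj; rewrite /= -e jm.
by apply/rowP => j; rewrite mxE (vz n).
Qed.

End DetEvaluation.

(** * Bernstein sums as determinants *)

Section BernsteinTransform.
Variables (R : realFieldType) (n k : nat).
Hypothesis N0 : (0 < Nn n)%N.
Hypothesis k0 : (0 < k)%N.
Hypothesis kn : (k <= n)%N.

Lemma iter_dual_congr (A : zmodType) m M (Phi Psi : ('I_n -> nat) -> A) a :
  expo_set k (m + M) a -> (forall b, expo_set k M b -> Phi b = Psi b) ->
  iter m (dual_sum (letters (fun i : nat => i != k))) Phi a =
  iter m (dual_sum (letters (fun i : nat => i != k))) Psi a.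
Proof.
move=> ha h; elim: m a ha => [|m IH] a ha; first exact: h.
by rewrite !iterS; apply: (dual_sum_congr kn ha) => b /IH.
Qed.

Lemma iter_dual_scale m (c : R) (Phi : ('I_n -> nat) -> R) a :
  iter m (dual_sum (letters (fun i : nat => i != k))) (fun b => c * Phi b) a =
  c * iter m (dual_sum (letters (fun i : nat => i != k))) Phi a.
Proof.
elim: m a => [//|m IH] a; rewrite !iterS -dual_sum_scale.
by congr dual_sum; apply/funext => b; exact: IH.
Qed.

Lemma iter_dual_morph (A B : zmodType) (h : {additive A -> B}) m (Phi : ('I_n -> nat) -> A) a :
  iter m (dual_sum (letters (fun i : nat => i != k))) (fun b => h (Phi b)) a =
  h (iter m (dual_sum (letters (fun i : nat => i != k))) Phi a).
Proof.
elim: m a => [//|m IH] a; rewrite !iterS -dual_sum_morph.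
by congr dual_sum; apply/funext => b; exact: IH.
Qed.

(** The product of the two constants left unevaluated. Comparison with the case [s = 0] eliminates
    it and shows that it is nonzero. *)
Definition wnorm : R :=
  schub (fun y : 'I_n -> R => mono y (@stair n)) 1%g (fun i => (i : nat)%:R) * @hookV R n (fun=> 0%N).

(** The [N - m] unrestricted operators produce [hookV], which times [r^(N - m)] is the killed
    determinant at time [r]; the [m] restricted operators then differentiate it. *)
Lemma wcount_derivn (r : R) m : (m <= Nn n)%N ->
  r ^+ (Nn n - m) * (wcount n k m)%:R * wnorm =
  (Nn n - m)`!%:R * ((detE k (2 * (n - k)) r (@stair n))^`(m)).[r].
Proof.
move=> mN; set x := fun i : 'I_n => (i : nat)%:R : R.
have xi : injective x by move=> i j /eqP; rewrite eqr_nat => /eqP /val_inj.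
have hs := expo_set_stair kn.
have hs' : expo_set k (m + (Nn n - m)) (@stair n) by rewrite subnKC.
have := congr1 (fun z => r ^+ (Nn n - m) * hookV R (fun _ : 'I_n => 0%N) * z)
  (@wcount_dual R n k N0 k0 x m mN xi).
rewrite -iter_dual_scale (iter_dual_congr (Psi := fun b => (Nn n - m)`!%:R *
    horner_eval r (detE k (2 * (n - k)) r b)) hs'); last first.
  move=> b hb; rewrite /horner_eval (horner_detE_start r kn erefl hb).
  by rewrite -[LHS]mulrA [hookV _ _ * _]mulrC (iter_dual_mono x (expo_set_sub hb)); ring.
rewrite iter_dual_scale iter_dual_morph (iter_dual_sum_detE r kn erefl m hs) => <-.
by rewrite /wnorm; ring.
Qed.

Lemma size_detE_stair (r : R) : (size (detE k (2 * (n - k)) r (@stair n)) <= (Nn n).+1)%N.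
Proof.
have := derivn_detE_gt r kn erefl (expo_set_stair kn) (leqnn (Nn n).+1).
move/polyP => h; apply/leq_sizeP => j Nj; have := h (j - (Nn n).+1)%N.
rewrite coef_derivn coef0 subnKC // => /eqP; rewrite -mulr_natr mulf_eq0 => /orP[/eqP //|].
by rewrite pnatr_eq0 eqn0Ngt ffact_gt0 Nj.
Qed.

Lemma bernstein_wcount_det (r s : R) : r + s = 1 ->
  (\sum_(m < (Nn n).+1) 'C(Nn n, m)%:R * s ^+ m * r ^+ (Nn n - m) * (wcount n k m)%:R) * wnorm
  = (Nn n)`!%:R * (detE k (2 * (n - k)) r (@stair n)).[1].
Proof.
move=> rs; have -> : (detE k (2 * (n - k)) r (@stair n)).[1] = (detE k (2 * (n - k)) r (@stair n)).[r + s].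
  by rewrite rs.
rewrite (nderiv_taylor_wide _ (size_detE_stair r)); last exact: mulrC.
rewrite mulr_suml mulr_sumr; apply: eq_bigr => m _.
have mN : (m <= Nn n)%N by rewrite -ltnS.
have := wcount_derivn r mN; rewrite nderivn_def hornerMn => e.
have -> : 'C(Nn n, m)%:R * s ^+ m * r ^+ (Nn n - m) * (wcount n k m)%:R * wnorm =
   'C(Nn n, m)%:R * s ^+ m * (r ^+ (Nn n - m) * (wcount n k m)%:R * wnorm) by ring.
rewrite e -(bin_fact mN) -mulr_natr !natrM; ring.
Qed.

End BernsteinTransform.

(** * Reduction to determinants of size k *)

(** The quotient of [W] by [W0] has lower rows [(0, 1)], so its determinant is that of its upper
    left block, and the same block carries [usubmx W0 *m a] to [usubmx W *m a]. *)
Lemma det_col_ratio (F : fieldType) k m (W W0 : 'M[F]_(k + m)) (a : 'M[F]_(k + m, k)) :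
  W0 \in unitmx -> dsubmx W = dsubmx W0 -> dsubmx W0 *m a = 0 ->
  \det W * \det (usubmx W0 *m a) = \det W0 * \det (usubmx W *m a).
Proof.
move=> uW0 eW a0; pose H := W *m invmx W0.
have HW : W = H *m W0 by rewrite /H mulmxKV.
have dH : dsubmx H = row_mx 0 1%:M.
  rewrite /H -mul_dsub_mx eW mul_dsub_mx mulmxV //.
  by rewrite (scalar_mx_block k m (1 : F)) /block_mx col_mxKd.
have -> : \det W = \det (lsubmx (usubmx H)) * \det W0.
  rewrite {1}HW det_mulmx; congr (_ * _).
  rewrite -{1}[H]vsubmxK dH -{1}[usubmx H]hsubmxK -/(block_mx _ _ _ _).
  by rewrite det_ublock det1 mulr1.
have -> : usubmx W *m a = lsubmx (usubmx H) *m (usubmx W0 *m a).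
  rewrite {1}HW -mul_usub_mx -mulmxA -{1}[W0]vsubmxK mul_col_mx a0.
  by rewrite -{1}[usubmx H]hsubmxK mul_row_col mulmx0 addr0.
by rewrite det_mulmx; ring.
Qed.

Section EvenKernel.
Variables (R : realFieldType) (w n : nat).
Implicit Types q : {poly R}.

(** For [q] with degrees from [w - n] to [w - 1] this is [q] at [l = w - 1], and differentiation
    lowers [l]: smaller indices give the derivatives of [q], larger ones its iterated primitives
    vanishing at 0. *)
Definition Jpoly (q : {poly R}) (l : nat) : {poly R} :=
  \sum_(j < n) pw ('X - 0%:P) l j * ((w.-1 - j)`!%:R * q`_(w.-1 - j))%:P.

Lemma deriv_Jpoly q l : (Jpoly q l.+1)^`() = Jpoly q l.
Proof.
rewrite /Jpoly raddf_sum /=; apply: eq_bigr => j _.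
by rewrite derivM derivC mulr0 addr0 deriv_pw.
Qed.

Lemma Jpoly_start q : (0 < n <= w)%N -> (size q <= w)%N ->
  (forall e, (e + n < w)%N -> q`_e = 0) -> Jpoly q w.-1 = q.
Proof.
case/andP=> n0 nw sq q0; apply/polyP => e; rewrite /Jpoly coef_sum.
have term (j : 'I_n) : (pw ('X - 0%:P) w.-1 j * ((w.-1 - j)`!%:R * q`_(w.-1 - j))%:P)`_e =
    if (w.-1 - j == e)%N then q`_e else 0.
  have jw : (j <= w.-1)%N by have := ltn_ord j; lia.
  rewrite coefMC /pw jw polyC0 subr0 coefZ coefXn eq_sym; case: eqP => [<-|_]; last by rewrite mulr0 mul0r.
  by rewrite mulr1 mulrA mulVf ?mul1r // pnatr_eq0 -lt0n fact_gt0.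
rewrite (eq_bigr _ (fun j _ => term j)).
have [ew|we] := leqP w e.
  rewrite nth_default ?(leq_trans sq) // big1 // => j _.
  by case: ifP.
have [en|ne] := ltnP (e + n) w.
  by rewrite q0 // big1 // => j _; case: ifP.
have jn : (w.-1 - e < n)%N by lia.
rewrite (bigD1 (Ordinal jn)) //= subKn ?eqxx; last by lia.
rewrite big1 ?addr0 // => j jne; case: eqP => // je; case/eqP: jne; apply/val_inj => /=.
by have := ltn_ord j; lia.
Qed.

Lemma Jpoly_derivn q d : (0 < n <= w)%N -> (size q <= w)%N ->
  (forall e, (e + n < w)%N -> q`_e = 0) -> (d < w)%N -> Jpoly q (w.-1 - d) = q^`(d).
Proof.
move=> nw sq q0; elim: d => [|d IH] dw; first by rewrite subn0 derivn0 Jpoly_start.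
rewrite derivnS -IH ?(ltnW dw) // -deriv_Jpoly; congr ((Jpoly q _)^`()).
by lia.
Qed.

Lemma Jpoly_at0 q l : (n <= l)%N -> (Jpoly q l).[0] = 0.
Proof.
move=> nl; rewrite /Jpoly -[LHS]/(horner_eval 0 _) raddf_sum /= big1 // => j _.
have jl : (j < l)%N := leq_trans (ltn_ord j) nl.
rewrite /horner_eval hornerM horner_pw subr0 /pw (ltnW jl) expr0n subn_eq0 leqNgt jl /=.
by rewrite scaler0 mul0r.
Qed.

(** Repeated integration by parts of the integral of [(1 - y)^l / l!] times [q] from 0, in terms of
    the iterated primitives of [q]. *)
Definition Kpoly q l : {poly R} :=
  \sum_(0 <= t < l.+1) pw (1 - 'X) (l - t) 0 * Jpoly q (w + t).

Lemma deriv_pw1X l : (pw (1 - 'X : {poly R}) l.+1 0)^`() = - pw (1 - 'X) l 0.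
Proof.
rewrite /pw /= !subn0 derivZ deriv_exp derivB derivX -polyC1 derivC sub0r mulN1r polyC1.
rewrite mulNrn scalerN -[_ *+ _.+1]scaler_nat scalerA; congr (- (_ *: _)).
by rewrite factS natrM invfM mulrAC mulVf ?mul1r // pnatr_eq0.
Qed.

Lemma deriv_Kpoly q l : (0 < n <= w)%N -> (size q <= w)%N ->
  (forall e, (e + n < w)%N -> q`_e = 0) ->
  (Kpoly q l)^`() = pw (1 - 'X) l 0 * q.
Proof.
move=> nw sq q0; pose u t := if t == l.+1 then 0 else pw (1 - 'X) (l - t) 0 * Jpoly q (w.-1 + t).
have e : (Kpoly q l)^`() = - \sum_(0 <= t < l.+1) (u t.+1 - u t).
  rewrite /Kpoly raddf_sum /= -sumrN; apply: eq_big_nat => t /andP[_ tl]; rewrite opprB.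
  have e1 : (Jpoly q (w + t))^`() = Jpoly q (w.-1 + t).
    by have -> : (w + t = (w.-1 + t).+1)%N by [lia]; rewrite deriv_Jpoly.
  rewrite derivM e1 /u (ltn_eqF tl) addrC; congr (_ + _); rewrite eqSS.
  case: eqP => [->|/eqP tne].
    by rewrite subnn oppr0 /pw subnn expr0 derivZ -polyC1 derivC scaler0 mul0r.
  have -> : (l - t = (l - t.+1).+1)%N by lia.
  rewrite deriv_pw1X mulNr; congr (- (_ * Jpoly q _)); lia.
rewrite e telescope_sumr // {1}/u eqxx sub0r opprK /u /= subn0 addn0.
by rewrite Jpoly_start.
Qed.

Lemma Kpoly_at0 q l : (n <= w)%N -> (Kpoly q l).[0] = 0.
Proof.
move=> nw; rewrite /Kpoly -[LHS]/(horner_eval 0 _) raddf_sum /= big_nat_cond big1 //.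
move=> t _; rewrite /horner_eval hornerM Jpoly_at0 ?mulr0 //; exact: leq_trans (leq_addr _ _).
Qed.

End EvenKernel.

(** The derivatives of a polynomial symmetric about 1 are alternately symmetric and antisymmetric
    about 1. *)
Lemma odd_derivn_reflect (R : realFieldType) (q : {poly R}) d :
  q \Po (2%:R%:P - 'X) = q -> odd d -> (q^`(d)).[1] = 0.
Proof.
move=> qe od.
have h e : q^`(e) \Po (2%:R%:P - 'X) = (-1) ^+ e *: q^`(e).
  elim: e => [|e IH]; first by rewrite derivn0 expr0 scale1r.
  have := congr1 (@deriv R) IH; rewrite deriv_comp derivZ -!derivnS derivB derivC derivX sub0r.
  by rewrite mulrN1 exprS mulN1r scaleNr => <-; rewrite opprK.
have := congr1 (horner_eval 1) (h d); rewrite /horner_eval horner_comp hornerZ.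
rewrite hornerD hornerN hornerC hornerX -signr_odd od expr1 mulN1r.
have -> : 2%:R - 1 = 1 :> R by ring.
by move=> e; lra.
Qed.

Lemma eq_poly_deriv (R : realFieldType) (p q : {poly R}) (x : R) :
  p^`() = q^`() -> p.[x] = q.[x] -> p = q.
Proof.
move=> dpq pqx; apply/eqP; rewrite -subr_eq0; apply/eqP.
have /polyP d0 : (p - q)^`() = 0 by rewrite derivB dpq subrr.
have c0 : p - q = ((p - q)`_0)%:P.
  apply/polyP => -[|i]; rewrite coefC //=; have := d0 i; rewrite coef_deriv coef0.
  by move/eqP; rewrite -mulr_natr mulf_eq0 pnatr_eq0 orbF => /eqP.
have : (p - q).[x] = 0 by rewrite hornerD hornerN pqx subrr.
by rewrite c0 hornerC => ->.
Qed.

(** * Exact formula for the window probabilities *)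

Section ExactFormula.
Variables (R : realFieldType) (k m : nat).
Let n := (k + m)%N.
Let w := (2 * (n - k))%N.
Hypothesis N0 : (0 < Nn n)%N.
Hypothesis k0 : (0 < k)%N.
Hypothesis km : (k <= m)%N.
Variable Q : nat -> {poly R}.
Hypothesis dQ : forall l, (Q l)^`() = - ('X^(2 * l) * (1 - 'X^2) ^+ (m - k)).
Hypothesis Q1 : forall l, (Q l).[1] = 0.

(** In the variable [x = 1 - X] this is [x^(2 c) (1 - x^2)^(m - k)]: symmetric about [X = 1] and,
    for [c < k], with degrees between [w - n] and [w - 1], the range covered by the [n] columns. *)
Definition qpoly c : {poly R} := ((1 - 'X) ^+ 2) ^+ c * (1 - (1 - 'X) ^+ 2) ^+ (m - k).

Lemma size_qpoly c : (c < k)%N -> (size (qpoly c) <= w)%N.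
Proof.
move=> ck; rewrite /qpoly; apply: (leq_trans (size_polyMleq _ _)).
have s1 : (size (1 - 'X : {poly R})%R <= 2)%N.
  by rewrite -opprB size_polyN size_XsubC.
have s2 : (size ((1 - 'X : {poly R}) ^+ 2)%R <= 3)%N.
  by apply: (leq_trans (size_poly_exp_leq _ _)); lia.
have s3 : (size (1 - (1 - 'X : {poly R}) ^+ 2)%R <= 3)%N.
  by apply: (leq_trans (size_polyD _ _)); rewrite geq_max size_polyN size_poly1 s2.
have := size_poly_exp_leq ((1 - 'X : {poly R}) ^+ 2) c.
have := size_poly_exp_leq (1 - (1 - 'X : {poly R}) ^+ 2) (m - k).
have a1 : (((size ((1 - 'X : {poly R}) ^+ 2)%R).-1 * c) <= 2 * c)%N.
  by rewrite leq_mul2r; apply/orP; right; lia.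
have a2 : (((size (1 - (1 - 'X : {poly R}) ^+ 2)%R).-1 * (m - k)) <= 2 * (m - k))%N.
  by rewrite leq_mul2r; apply/orP; right; lia.
move=> b2 b1; rewrite -subn1 leq_subLR.
apply: (leq_trans (leq_add b1 b2)); rewrite addSn addnS.
apply: (@leq_trans ((2 * c + 2 * (m - k)).+2)); last by rewrite /w /n; lia.
by rewrite !ltnS leq_add.
Qed.

Lemma qpoly_low c e : (e + n < w)%N -> (qpoly c)`_e = 0.
Proof.
move=> h; have -> : qpoly c = 'X^(m - k) * (((1 - 'X) ^+ 2) ^+ c * (2%:R - 'X) ^+ (m - k)).
  rewrite /qpoly mulrCA -exprMn; congr (_ * _ ^+ _); ring.
by rewrite coefXnM; have -> : (e < m - k)%N by rewrite /w /n in h; lia.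
Qed.

Lemma comp_poly_expr (p q : {poly R}) d : (p ^+ d) \Po q = (p \Po q) ^+ d.
Proof. exact: (rmorphXn (comp_poly q)). Qed.

Lemma comp_poly1 (q : {poly R}) : 1 \Po q = 1.
Proof. exact: (rmorph1 (comp_poly q)). Qed.

Lemma qpoly_reflect c : qpoly c \Po (2%:R%:P - 'X) = qpoly c.
Proof.
rewrite /qpoly comp_polyM !(comp_poly_expr, comp_polyB, comp_poly1, comp_polyX).
have -> : (1 - (2%:R%:P - 'X)) ^+ 2 = (1 - 'X) ^+ 2 :> {poly R}.
  by rewrite polyC_natr; ring.
by [].
Qed.

Definition Wmat (r : R) : 'M[R]_n := \matrix_(i, j) (psi k w r i (shape_of (@stair n) i) j).[1].
Definition amat : 'M[R]_(n, k) := \matrix_(j, c) ((w.-1 - j)`!%:R * (qpoly c)`_(w.-1 - j)).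

Lemma dsub_Wmat r r' : dsubmx (Wmat r) = dsubmx (Wmat r').
Proof.
apply/matrixP => i j; rewrite !mxE /psi.
by have -> : (rshift k i < k)%N = false by rewrite /= ltnNge leq_addr.
Qed.

Lemma wn : (0 < n <= w)%N. Proof. by rewrite /w /n; lia. Qed.

(** Row [k + i] has shifted exponent [w - 1 - (2 i + 1)], so it evaluates a derivative of odd order
    at 1. *)
Lemma dsub_Wmat_amat r : dsubmx (Wmat r) *m amat = 0.
Proof.
apply/matrixP => i c; rewrite !mxE.
have -> : \sum_j dsubmx (Wmat r) i j * amat j c =
   (Jpoly w n (qpoly c) (w.-1 - i.*2.+1)).[1].
  rewrite /Jpoly -[RHS]/(horner_eval 1 _) raddf_sum /=; apply: eq_bigr => j _.
  rewrite !mxE /psi; have -> : (rshift k i < k)%N = false by rewrite /= ltnNge leq_addr.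
  rewrite /horner_eval hornerM hornerC; congr ((pw _ _ _).[_] * _).
  by rewrite /shape_of /stair /= /w /n; have := ltn_ord i; lia.
have ck := ltn_ord c; have im := ltn_ord i.
rewrite (Jpoly_derivn wn (size_qpoly ck) (@qpoly_low c)); last by rewrite /w /n; lia.
by rewrite odd_derivn_reflect ?qpoly_reflect //= odd_double.
Qed.

Lemma usub_Wmat_amat r i c : (usubmx (Wmat r) *m amat) i c =
  (Kpoly w n (qpoly c) (2 * (k.-1 - i))).[r].
Proof.
rewrite mxE /Kpoly -[RHS]/(horner_eval r _) raddf_sum /=.
have ik := ltn_ord i.
have LE : shape_of (@stair n) (lshift m i) = (2 * (k.-1 - i) + w)%N.
  by rewrite /shape_of /stair /= /w /n; lia.
under eq_bigr => j _.
  rewrite !mxE /psi /= ik LE -{1}[w]add0n -addSn big_addn addnK.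
  rewrite -[X in X * _]/(horner_eval 1 _) raddf_sum /= mulr_suml.
  over.
rewrite exchange_big /=; apply: eq_big_nat => t /andP[_ tl].
rewrite /horner_eval hornerM /Jpoly -[X in _ = _ * X]/(horner_eval r _) raddf_sum /= mulr_sumr.
apply: eq_bigr => j _; rewrite /horner_eval !hornerM !hornerC !horner_pw subr0 mulrA.
rewrite subnDr [(t + w)%N]addnC -!mulrA.
have -> : (pw (1 - 'X) (2 * (k.-1 - i) - t) 0).[r] = pw (1 - r : R^o) (2 * (k.-1 - i) - t) 0.
  by rewrite /pw /= hornerZ horner_exp hornerD hornerN hornerX hornerC.
by rewrite [LHS]mulrA.
Qed.

(** Both sides have the same derivative in [s] and vanish at [s = 1]. *)
Lemma Kpoly_Q l c s : (c < k)%N -> (Kpoly w n (qpoly c) (2 * l)).[1 - s] =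
  (2 * l)`!%:R^-1 * (Q (l + c)).[s].
Proof.
move=> ck; set K := Kpoly _ _ _ _.
have -> : (2 * l)`!%:R^-1 * (Q (l + c)).[s] = ((2 * l)`!%:R^-1 *: Q (l + c)).[s].
  by rewrite hornerZ.
have -> : (2 * l)`!%:R^-1 *: Q (l + c) = K \Po (1 - 'X).
  apply: (@eq_poly_deriv _ _ _ 1).
    rewrite derivZ dQ deriv_comp (deriv_Kpoly _ wn (size_qpoly ck) (@qpoly_low c)).
    rewrite derivB -polyC1 derivC derivX sub0r mulrN1 polyC1 scalerN; congr (- _).
    rewrite comp_polyM /pw /= subn0 comp_polyZ -scalerAl; congr (_ *: _).
    rewrite /qpoly comp_polyM mulrA.
    rewrite !(comp_poly_expr, comp_polyB, comp_poly1, comp_polyX).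
    have -> : 1 - (1 - 'X) = 'X :> {poly R} by ring.
    by rewrite -exprM -exprD mulnDr.
  rewrite hornerZ Q1 mulr0 horner_comp !hornerE subrr /K Kpoly_at0 //.
  by case/andP: wn.
by rewrite horner_comp !hornerE.
Qed.

Definition Qdet s : R := \det (\matrix_(i < k, c < k) (Q (i + c)).[s]).

Lemma det_usub_Wmat s : \det (usubmx (Wmat (1 - s)) *m amat) =
  (\prod_(i < k) (2 * (k.-1 - i))`!%:R^-1) * (-1) ^+ revp k * Qdet s.
Proof.
rewrite /Qdet; set M := \matrix_(i, c) _.
have -> : usubmx (Wmat (1 - s)) *m amat =
    diag_mx (\row_(i < k) (2 * (k.-1 - i))`!%:R^-1) *m row_perm (revp k) M.
  apply/matrixP => i c; rewrite usub_Wmat_amat Kpoly_Q ?ltn_ord // mul_diag_mx !mxE permE /=.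
  by rewrite subnS -subn1 -[in RHS]subn1 subnAC.
rewrite det_mulmx det_diag row_permE det_mulmx det_perm mulrA.
by congr (_ * _ * _); apply: eq_bigr => i _; rewrite mxE.
Qed.

Lemma det_Wmat r : \det (Wmat r) = (detE k w r (@stair n)).[1].
Proof. by rewrite horner_detE. Qed.

(** The identity at [s] is divided by the one at [s = 0], where only the window of length 0
    contributes; all factors independent of [s] cancel. *)
Lemma bernstein_wcount_aux s :
  (\sum_(i < (Nn n).+1) 'C(Nn n, i)%:R * s ^+ i * (1 - s) ^+ (Nn n - i) * (wcount n k i)%:R)
    * Qdet 0 = #|Omega n|%:R * Qdet s.
Proof.
have kn : (k <= n)%N by rewrite /n leq_addr.
have W1 : \det (Wmat 1) != 0.
  by rewrite det_Wmat (horner_detE_start 1 kn erefl (expo_set_stair kn)) expr1n mul1r hookV_stair_neq0.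
have h1 := @bernstein_wcount_det R n k N0 k0 kn (1 - s) s (subrK _ _).
have h0 := @bernstein_wcount_det R n k N0 k0 kn 1 0 (addr0 _).
rewrite big_ord_recl big1 ?addr0 in h0; last by move=> i _; rewrite /= expr0n /= mulr0 !mul0r.
rewrite bin0 expr0 expr1n !mul1r wcount0 -/w -det_Wmat in h0.
rewrite -/w -det_Wmat in h1.
have f0 : (Nn n)`!%:R != 0 :> R by rewrite pnatr_eq0 -lt0n fact_gt0.
set B := \sum_(i < _) _ in h1 *.
have wn0 : wnorm R n != 0.
  apply/eqP => z; move/eqP: h0; rewrite z mulr0 eq_sym mulf_eq0 (negbTE f0) (negbTE W1).
  by [].
have uW : Wmat 1 \in unitmx by rewrite unitmxE unitfE.
have := det_col_ratio uW (dsub_Wmat (1 - s) 1) (dsub_Wmat_amat 1).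
have := det_usub_Wmat 0; rewrite subr0 => ->; rewrite det_usub_Wmat.
set c := _ * _ ^+ _; move=> h.
have c0 : c != 0.
  rewrite mulf_neq0 ?signr_eq0 //; apply/prodf_neq0 => i _.
  by rewrite invr_eq0 pnatr_eq0 -lt0n fact_gt0.
apply: (mulfI (mulf_neq0 wn0 c0)).
transitivity ((B * wnorm R n) * (c * Qdet 0)); first by ring.
transitivity ((Nn n)`!%:R * (\det (Wmat (1 - s)) * (c * Qdet 0))).
  by rewrite h1 mulrA.
rewrite h; transitivity ((Nn n)`!%:R * \det (Wmat 1) * (c * Qdet s)).
  by rewrite mulrA.
by rewrite -h0; ring.
Qed.

End ExactFormula.

Lemma bernstein_wcount (R : realFieldType) (n k : nat) (Q : nat -> {poly R}) :
  (0 < k)%N -> (2 * k <= n)%N -> 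
  (forall l, (Q l)^`() = - ('X^(2 * l) * (1 - 'X^2) ^+ (n - 2 * k))) ->
  (forall l, (Q l).[1] = 0) -> forall s : R,
  (\sum_(i < (Nn n).+1) 'C(Nn n, i)%:R * s ^+ i * (1 - s) ^+ (Nn n - i) * (wcount n k i)%:R)
    * Qdet k Q 0 = #|Omega n|%:R * Qdet k Q s.
Proof.
move=> k0 kn; have [m -> km] : exists2 m, n = (k + m)%N & (k <= m)%N.
  by exists (n - k)%N; lia.
have -> : (k + m - 2 * k = m - k)%N by lia.
move=> dQ Q1 s; apply: bernstein_wcount_aux => //.
by rewrite /Nn bin_gt0; lia.
Qed.

(** No network is exhibited: at [s = 0] the determinantal identity expresses a multiple of
    [#|Omega n|] through the nonzero [hookV] of the staircase. *)
Lemma card_Omega_gt0 n : (1 < n)%N -> (0 < #|Omega n|)%N.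
Proof.
move=> n1; have N0 : (0 < Nn n)%N by rewrite /Nn bin_gt0.
have h0 := @bernstein_wcount_det rat n 1 N0 isT (ltnW n1) 1 0 (addr0 _).
rewrite big_ord_recl big1 ?addr0 in h0; last by move=> i _; rewrite /= expr0n /= mulr0 !mul0r.
rewrite bin0 expr0 expr1n !mul1r wcount0 in h0.
rewrite (horner_detE_start 1 (ltnW n1) erefl (expo_set_stair (ltnW n1))) expr1n mul1r in h0.
rewrite lt0n; apply/eqP => z; move/eqP: h0; rewrite z mul0r eq_sym mulf_eq0 (negbTE (hookV_stair_neq0 _ _)).
by rewrite pnatr_eq0 eqn0Ngt fact_gt0.
Qed.

(** * Gaussian tails and domination *)

Section GaussianTails.
Variable R : realType.
Notation mu := (@lebesgue_measure R).
Local Notation phi := (@normal_pdf R 0 1).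

Lemma phiE (x : R) : phi x = normal_peak 1 * expR (- (2^-1 * x ^+ 2)).
Proof.
rewrite normal_pdfE ?oner_neq0 //; congr (_ * expR _).
by rewrite subr0 expr1n mulNr mulrC.
Qed.

Lemma phi_ge0 (x : R) : 0 <= phi x. Proof. exact: normal_pdf_ge0. Qed.

Lemma phi_gt0 (x : R) : 0 < phi x.
Proof. by rewrite phiE mulr_gt0 ?expR_gt0 // normal_peak_gt0 // oner_neq0. Qed.

Lemma continuous_phi : continuous phi.
Proof. by apply: continuous_normal_pdf; rewrite oner_neq0. Qed.

Lemma measurable_phi : measurable_fun setT phi.
Proof. exact: measurable_normal_pdf. Qed.

Lemma integrable_gauss (c : R) : 0 < c ->
  mu.-integrable setT (fun x => (expR (- (c * x ^+ 2)))%:E).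
Proof.
move=> c0; pose s := Num.sqrt ((2 * c)^-1).
have s0 : 0 < s by rewrite sqrtr_gt0 invr_gt0 mulr_gt0.
have s2 : s ^+ 2 = (2 * c)^-1 by rewrite sqr_sqrtr // invr_ge0 mulr_ge0 // ltW.
have p0 : normal_peak s != 0 by rewrite gt_eqF // normal_peak_gt0 // gt_eqF.
have -> : (fun x : R => (expR (- (c * x ^+ 2)))%:E) =
          (fun x => ((normal_peak s)^-1)%:E * (normal_pdf 0 s x)%:E)%E.
  apply/funext => x; rewrite -EFinM normal_pdfE ?gt_eqF // mulKf //; congr (expR _)%:E.
  rewrite subr0 s2 -mulr_natr; by field; rewrite (gt_eqF c0).
by apply: integrableZl => //; exact: integrable_normal_pdf.
Qed.

Lemma pow_le_expR (t : R) d : 0 <= t -> t ^+ d <= d`!%:R * expR t.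
Proof.
move=> t0; case: d => [|d].
  by rewrite expr0 mul1r -[leLHS]expR0 ler_expR.
have := expR_ge1Dxn d t0; have f0 : 0 < d.+1`!%:R :> R by rewrite ltr0n fact_gt0.
rewrite -ler_pdivrMl // mulrC => h; apply: le_trans h; lra.
Qed.

(** Combines [z <= 1 + z^2] for [z = |x|^d] with [t^d <= d! exp t] for [t = c x^2]. *)
Lemma absX_le_expR (x c : R) d : 0 < c ->
  `|x| ^+ d <= (1 + d`!%:R * c ^- d) * expR (c * x ^+ 2).
Proof.
move=> c0; have t0 : 0 <= c * x ^+ 2 by rewrite mulr_ge0 ?sqr_ge0 // ltW.
have h1 : `|x| ^+ d <= 1 + (x ^+ 2) ^+ d.
  have xd : (x ^+ 2) ^+ d = (`|x| ^+ d) ^+ 2 by rewrite -normrX real_normK ?num_real // -!exprM mulnC.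
  rewrite xd; set z := `|x| ^+ d; have : 0 <= (z - 2^-1) ^+ 2 by exact: sqr_ge0.
  rewrite sqrrB; nra.
apply: (le_trans h1); rewrite mulrDl mul1r lerD //.
  by rewrite -[leLHS]expR0 ler_expR.
have := pow_le_expR d t0; rewrite exprMn => h.
rewrite mulrAC ler_pdivlMr ?exprn_gt0 // mulrC; exact: h.
Qed.

Lemma gauss_dom (f : R -> R) (C eta : R) : measurable_fun setT f -> eta < 2^-1 ->
  (forall x, `|f x| <= C * expR (eta * x ^+ 2)) ->
  mu.-integrable setT (fun x => (f x * phi x)%:E).
Proof.
move=> mf e1 fC; have c0 : 0 < 2^-1 - eta by rewrite subr_gt0.
have C0 : 0 <= C.
  by have := le_trans (normr_ge0 _) (fC 0); rewrite pmulr_lge0 ?expR_gt0.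
apply: (le_integrable measurableT _ _
   (integrableZl measurableT (C * normal_peak 1) (integrable_gauss c0))).
  by apply/measurable_EFinP; apply: measurable_funM => //; exact: measurable_phi.
have key (x : R) : `|f x * phi x| <= `|C * normal_peak 1 * expR (- ((2^-1 - eta) * x ^+ 2))|.
  rewrite normrM [`|phi x|]ger0_norm ?phi_ge0 //.
  rewrite [leRHS]ger0_norm; last by rewrite !mulr_ge0 ?expR_ge0 ?normal_peak_ge0.
  apply: (le_trans (ler_wpM2r (phi_ge0 x) (fC x))); rewrite phiE.
  have -> : - ((2^-1 - eta) * x ^+ 2) = eta * x ^+ 2 + - (2^-1 * x ^+ 2) by ring.
  by rewrite expRD le_eqVlt; apply/orP; left; apply/eqP; ring.
by move=> x _; exact: key.
Qed.

Lemma integrable_pow_phi d : mu.-integrable setT (fun x => (x ^+ d * phi x)%:E).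
Proof.
have q0 : 0 < 4^-1 :> R by rewrite invr_gt0.
apply: (@gauss_dom _ (1 + d`!%:R * (4^-1) ^- d) 4^-1).
- exact: exprn_measurable.
- lra.
- by move=> x; rewrite normrX; exact: absX_le_expR.
Qed.

Definition gtail (l : nat) (v : R) : R := \int[mu]_(u in `]v, +oo[) (u ^+ (2 * l) * phi u).

Lemma is_derive_gtail l (v : R) : is_derive v 1 (gtail l) (- (v ^+ (2 * l) * phi v)).
Proof.
pose f u := u ^+ (2 * l) * phi u.
have intf : mu.-integrable setT (EFin \o f) := integrable_pow_phi _.
have cf : continuous f.
  by move=> x; apply: cvgM; [exact: exprn_continuous|exact: continuous_phi].
have intf1 : mu.-integrable `]-oo, (v + 1)] (EFin \o f).
  by apply: integrableS intf => //; exact: measurable_itv.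
have lt1 : (-oo%O < BRight v)%E by rewrite ltNyr.
have [d1 d2] := @continuous_FTC1 R f -oo%O v (v + 1) (ltr_pwDr ltr01 (lexx v))
   intf1
  lt1 (cf v).
pose F x := \int[mu]_(t in `]-oo, x]) f t.
have e : gtail l = (fun x => \int[mu]_(t in setT) f t - F x).
  apply/funext => x; rewrite -(setUv `]-oo, x]) Rintegral_setU //.
  - by rewrite /F addrAC subrr add0r setCitvl.
  - exact: measurableC.
  - by rewrite setUv.
  - exact/disj_setPCl.
have dF : is_derive v 1 F (f v).
  by split; [exact: d1|rewrite -derive1E; exact: d2].
rewrite e; have := is_deriveB (is_derive_cst (\int[mu]_(t in setT) f t) v 1) dF.
by rewrite sub0r.
Qed.

Lemma gtail_ge0 l v : 0 <= gtail l v.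
Proof.
apply: Rintegral_ge0 => u _; rewrite mulr_ge0 ?phi_ge0 // exprM exprn_ge0 //; exact: sqr_ge0.
Qed.

(** Markov's inequality: one extra factor [x] is at least [v] on the half-line. *)
Lemma gtail_bound l : exists C : R, forall v, 0 < v -> gtail l v * v <= C.
Proof.
have intA : mu.-integrable setT (fun x : R => (`|x| ^+ (2 * l).+1 * phi x)%:E).
  have q0 : 0 < 4^-1 :> R by rewrite invr_gt0.
  apply: (@gauss_dom _ (1 + (2 * l).+1`!%:R * (4^-1) ^- (2 * l).+1) 4^-1).
  - apply: (@measurableT_comp _ _ _ _ _ _ (fun x : R => x ^+ (2 * l).+1) _ (fun x : R => `|x|)) => //.
  - lra.
  - by move=> x; rewrite normrX normr_id; exact: absX_le_expR.
exists (\int[mu]_(x in setT) (`|x| ^+ (2 * l).+1 * phi x)) => v v0.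
have sI : forall f, mu.-integrable setT (EFin \o f) -> mu.-integrable `]v, +oo[ (EFin \o f).
  by move=> f; apply: integrableS => //; exact: measurable_itv.
rewrite /gtail mulrC -RintegralZl //; last exact: sI (integrable_pow_phi _).
apply: (@le_trans _ _ (\int[mu]_(x in `]v, +oo[) (`|x| ^+ (2 * l).+1 * phi x))).
  apply: le_Rintegral => //.
  - apply: sI; exact: (integrableZl measurableT v (integrable_pow_phi _)).
  - exact: sI.
  - move=> x /=; rewrite in_itv /= andbT => vx.
    rewrite mulrA ler_wpM2r ?phi_ge0 // exprS.
    have x0 : 0 < x by exact: lt_trans vx.
    by rewrite gtr0_norm // ler_wpM2r ?exprn_ge0 // ltW.
rewrite -[leLHS]/(fine _) -[leRHS]/(fine _); apply: fine_le.
- by apply: integrable_fin_num => //; exact: sI.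
- by apply: integrable_fin_num.
apply: ge0_subset_integral => //.
  by case/integrableP: intA.
by move=> x _; rewrite lee_fin mulr_ge0 ?phi_ge0 // exprn_ge0.
Qed.

Lemma gtail_cvg0 l : gtail l v @[v --> +oo] --> (0 : R).
Proof.
have [C hC] := gtail_bound l.
have C1 : C / v @[v --> +oo] --> (0 : R).
  rewrite -[X in _ --> X](mulr0 C); apply: cvgM; first exact: cvg_cst.
  apply/gtr0_cvgV0; last exact: cvg_id.
  exact: nbhs_pinfty_gt.
apply: (squeeze_cvgr _ (cvg_cst 0) C1); near=> v.
have v0 : 0 < v by near: v; exact: nbhs_pinfty_gt.
by rewrite gtail_ge0 ler_pdivlMr // hC.
Unshelve. all: by end_near. Qed.

End GaussianTails.

(** * Limits and derivatives of determinants *)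

Lemma cvg_bigsum (R : realType) (T : Type) (F : set_system T) (FF : Filter F) (I : Type) (s : seq I)
   (P : pred I) (f : I -> T -> R) (l : I -> R) :
  (forall i, P i -> f i x @[x --> F] --> l i) ->
  (\sum_(i <- s | P i) f i x) @[x --> F] --> \sum_(i <- s | P i) l i.
Proof.
move=> h; elim: s => [|i s IH].
  rewrite big_nil; under eq_fun do rewrite big_nil; exact: cvg_cst.
rewrite big_cons; under eq_fun do rewrite big_cons.
by case: ifP => Pi //; apply: cvgD => //; exact: h.
Qed.

Lemma cvg_bigprod (R : realType) (T : Type) (F : set_system T) (FF : Filter F) (I : Type) (s : seq I)
   (f : I -> T -> R) (l : I -> R) :
  (forall i, f i x @[x --> F] --> l i) ->
  (\prod_(i <- s) f i x) @[x --> F] --> \prod_(i <- s) l i.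
Proof.
move=> h; elim: s => [|i s IH].
  rewrite big_nil; under eq_fun do rewrite big_nil; exact: cvg_cst.
rewrite big_cons; under eq_fun do rewrite big_cons.
by apply: cvgM => //; exact: h.
Qed.

Lemma cvg_det (R : realType) (T : Type) (F : set_system T) (FF : Filter F) k
   (A : T -> 'M[R]_k) (B : 'M[R]_k) :
  (forall i j, A x i j @[x --> F] --> B i j) -> \det (A x) @[x --> F] --> \det B.
Proof.
move=> h; apply: cvg_bigsum => s _; apply: cvgM; first exact: cvg_cst.
by apply: cvg_bigprod => i; exact: h.
Qed.

Lemma is_derive_bigsum (R : realType) (I : Type) (s : seq I) (f : I -> R -> R) (df : I -> R) (x : R) :
  (forall i, is_derive x 1 (f i) (df i)) ->
  is_derive x 1 (fun y => \sum_(i <- s) f i y) (\sum_(i <- s) df i).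
Proof.
move=> h; elim: s => [|i s IH].
  rewrite big_nil; under eq_fun do rewrite big_nil; exact: is_derive_cst.
rewrite big_cons; under eq_fun do rewrite big_cons.
exact: (is_deriveD (h i) IH).
Qed.

Lemma is_derive_bigprod (R : realType) (I : eqType) (s : seq I) (f : I -> R -> R) (df : I -> R) (x : R) :
  uniq s -> (forall i, is_derive x 1 (f i) (df i)) ->
  is_derive x 1 (fun y => \prod_(i <- s) f i y)
    (\sum_(p <- s) \prod_(i <- s) (if i == p then df i else f i x)).
Proof.
move=> + h; elim: s => [_|i0 s IH /= /andP[ni us]].
  rewrite big_nil; under eq_fun do rewrite big_nil; exact: is_derive_cst.
rewrite !big_cons; under eq_fun do rewrite big_cons.
apply: (is_derive_eq (is_deriveM (h i0) (IH us))); rewrite addrC eqxx; congr (_ + _).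
  rewrite [LHS]mulrC; congr (_ * _); apply: eq_big_seq => i si; case: eqP => // e.
  by move: ni; rewrite -e si.
rewrite [LHS]mulr_sumr; apply: eq_big_seq => p sp; rewrite big_cons.
by case: eqP => // e; move: ni; rewrite e sp.
Qed.

Lemma is_derive_det (R : realType) k (A : R -> 'M[R]_k) (dA : 'M[R]_k) (x : R) :
  (forall i j, is_derive x 1 (fun y => A y i j) (dA i j)) ->
  is_derive x 1 (fun y => \det (A y))
    (\sum_p \det (\matrix_(i, j) if i == p then dA i j else A x i j)).
Proof.
move=> h.
have -> : \sum_p \det (\matrix_(i, j) if i == p then dA i j else A x i j) =
   \sum_(s : 'S_k) (-1) ^+ s * \sum_p \prod_i (if i == p then dA i (s i) else A x i (s i)).
  rewrite exchange_big /=; under [RHS]eq_bigr do rewrite mulr_sumr.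
  rewrite [RHS]exchange_big /= exchange_big /=; apply: eq_bigr => p _.
  by rewrite /determinant; apply: eq_bigr => s _; congr (_ * _); apply: eq_bigr => i _; rewrite mxE.
apply: is_derive_bigsum => s.
have := is_derive_bigprod (index_enum_uniq _) (fun i => h i (s i)).
move=> /(is_deriveZ ((-1) ^+ s)); exact.
Qed.

(** * Polynomial primitives and the exponential limit *)

Section PolynomialPrimitive.
Variable R : realFieldType.

Definition primpoly (q : {poly R}) (x : R) : {poly R} :=
  let p := \poly_(i < (size q).+1) (q`_i.-1 / i%:R) in p - (p.[x])%:P.

Lemma deriv_primpoly q x : (primpoly q x)^`() = q.
Proof.
rewrite /primpoly derivB derivC subr0; apply/polyP => i.
rewrite coef_deriv coef_poly ltnS; case: ltnP => qi.
  by rewrite -[LHS]mulr_natr divfK // pnatr_eq0.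
by rewrite mul0rn nth_default.
Qed.

Lemma primpoly_at q x : (primpoly q x).[x] = 0.
Proof. by rewrite /primpoly hornerD hornerN hornerC subrr. Qed.

End PolynomialPrimitive.

Lemma continuous_horner (R : realType) (p : {poly R}) : continuous (horner p).
Proof. by move=> x; apply/differentiable_continuous/derivable1_diffP/derivable_horner. Qed.

Lemma cvg_divn (R : realType) (a : R) : a / n%:R @[n --> \oo] --> (0 : R).
Proof.
rewrite -[X in _ --> X](mulr0 a); apply: cvgM; first exact: cvg_cst.
rewrite -cvg_shiftS /=; exact: cvg_harmonic.
Qed.

Section ExponentialLimit.
Variable R : realType.

Lemma pow_le_exp (t : R) m : t <= 1 -> (1 - t) ^+ m <= expR (- (m%:R * t)).
Proof.
move=> t1; rewrite -mulrN expRM_natl; apply: lerXn2r; rewrite ?nnegrE ?expR_ge0 ?subr_ge0 //.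
exact: expR_ge1Dx.
Qed.

Lemma pow_ge_exp (t : R) m : t < 1 -> expR (- (m%:R * (t / (1 - t)))) <= (1 - t) ^+ m.
Proof.
move=> t1; have s0 : 0 < 1 - t by rewrite subr_gt0.
rewrite -mulrN expRM_natl; apply: lerXn2r; rewrite ?nnegrE ?expR_ge0 ?(ltW s0) //.
rewrite expRN -[leRHS]invrK lef_pV2 ?posrE ?invr_gt0 ?expR_gt0 //.
apply: le_trans (expR_ge1Dx _).
have -> : 1 + t / (1 - t) = (1 - t)^-1 by field; rewrite gt_eqF.
by [].
Qed.

(** With [t = a / n] and [m = n - d], the power is squeezed between [exp (- m t / (1 - t))] and
    [exp (- m t)]. *)
Lemma pow_exp_cvg (a : R) (d : nat) : 0 <= a ->
  (1 - a / n%:R) ^+ (n - d) @[n --> \oo] --> expR (- a).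
Proof.
move=> a0.
have h1 : (n - d)%:R * (a / n%:R) @[n --> \oo] --> a.
  have : a - d%:R * (a / n%:R) @[n --> \oo] --> a - d%:R * 0.
    by apply: cvgB; [exact: cvg_cst|apply: cvgM; [exact: cvg_cst|exact: cvg_divn]].
  rewrite mulr0 subr0; apply: cvg_trans; apply: near_eq_cvg.
  near=> n; have dn : (d <= n)%N by near: n; exact: nbhs_infty_ge.
  have n0 : n%:R != 0 :> R by rewrite pnatr_eq0 -lt0n; near: n; exact: nbhs_infty_gt.
  by rewrite natrB //; field.
have h2 : 1 - a / n%:R @[n --> \oo] --> (1 : R).
  by rewrite -[X in _ --> X]subr0; apply: cvgB; [exact: cvg_cst|exact: cvg_divn].
have h3 : (n - d)%:R * (a / n%:R / (1 - a / n%:R)) @[n --> \oo] --> a.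
  have : (n - d)%:R * (a / n%:R) * (1 - a / n%:R)^-1 @[n --> \oo] --> a * 1^-1.
    by apply: cvgM => //; apply: cvgV => //; exact: oner_neq0.
  rewrite invr1 mulr1; apply: cvg_trans; apply: near_eq_cvg.
  by apply: nearW => n /=; rewrite -[LHS]mulrA.
have ec (u : nat -> R) : u n @[n --> \oo] --> a -> expR (- u n) @[n --> \oo] --> expR (- a).
  move=> ua; apply: (cvg_comp (fun n => - u n) expR); last exact: continuous_expR.
  exact: cvgN.
apply: (squeeze_cvgr _ (ec _ h3) (ec _ h1)).
near=> n.
have t1 : a / n%:R < 1.
  by near: n; apply: (cvgr_lt _ (@cvg_divn R a)); exact: ltr01.
by rewrite pow_ge_exp // pow_le_exp // ltW.
Unshelve. all: by end_near. Qed.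

End ExponentialLimit.

(** * The rescaled kernel *)

Section ScaledKernel.
Variables (R : realType) (k : nat).
Hypothesis k0 : (0 < k)%N.
Notation mu := (@lebesgue_measure R).
Local Notation phi := (@normal_pdf R 0 1).
Local Notation pk := (@normal_peak R 1).

(** The kernel [(1 - x^2)^(n - 2 k)] at [x = u / sqrt (2 n)], extended by 0 beyond [|x| = 1]. The
    value 0 for [n < 4 k] leaves only the case [n - 2 k >= n / 2], hence one Gaussian bound for all
    [n]. *)
Definition fker (n : nat) (u : R) : R :=
  if (4 * k <= n)%N then (Num.max 0 (1 - u ^+ 2 / 2 / n%:R)) ^+ (n - 2 * k) else 0.

Lemma fker_ge0 n u : 0 <= fker n u.
Proof. by rewrite /fker; case: ifP => // _; rewrite exprn_ge0 // le_max lexx. Qed.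

Lemma fker_le n u : fker n u <= expR (- (4^-1 * u ^+ 2)).
Proof.
rewrite /fker; case: ifP => [kn|_]; last exact: expR_ge0.
have n0 : 0 < n%:R :> R by rewrite ltr0n; lia.
set t := _ / n%:R; have t0 : 0 <= t by rewrite !divr_ge0 ?sqr_ge0 // ltW.
apply: (@le_trans _ _ (expR (- t) ^+ (n - 2 * k))).
  apply: lerXn2r; rewrite ?nnegrE ?expR_ge0 ?le_max ?lexx //.
  by rewrite ge_max expR_ge0 /=; exact: expR_ge1Dx.
rewrite -expRM_natl ler_expR mulrN lerN2 /t.
have h : n%:R <= 2 * (n - 2 * k)%:R :> R by rewrite -natrM ler_nat; lia.
have -> : 4^-1 * u ^+ 2 = 2^-1 * n%:R * (u ^+ 2 / 2 / n%:R).
  by field; rewrite gt_eqF.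
by rewrite ler_wpM2r //; lra.
Qed.

Lemma measurable_fker n : measurable_fun setT (fker n).
Proof.
rewrite /fker; case: (4 * k <= n)%N; last exact: measurable_cst.
apply: measurable_funX; apply: measurable_maxr; first exact: measurable_cst.
apply: measurable_funB; first exact: measurable_cst.
apply: measurable_funM; last exact: measurable_cst.
by apply: measurable_funM; [exact: exprn_measurable|exact: measurable_cst].
Qed.

Lemma fker_cvg (u : R) : fker n u @[n --> \oo] --> expR (- (2^-1 * u ^+ 2)).
Proof.
have a0 : 0 <= u ^+ 2 / 2 by rewrite divr_ge0 // sqr_ge0.
have -> : 2^-1 * u ^+ 2 = u ^+ 2 / 2 by rewrite mulrC.
have := pow_exp_cvg (2 * k) a0.
apply: cvg_trans; apply: near_eq_cvg; near=> n.
have kn : (4 * k <= n)%N by near: n; exact: nbhs_infty_ge.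
rewrite /fker kn max_r // subr_ge0 ltW //.
by near: n; apply: (cvgr_lt _ (@cvg_divn R (u ^+ 2 / 2))); exact: ltr01.
Unshelve. all: by end_near. Qed.

Lemma int_fker_cvg l v :
  (\int[mu]_(u in `]v, +oo[) (u ^+ (2 * l) * (pk * fker n u))%:E)%E @[n --> \oo] -->
  (gtail l v)%:E.
Proof.
have q0 : 0 < 4^-1 :> R by rewrite invr_gt0.
have -> : (gtail l v)%:E = (\int[mu]_(u in `]v, +oo[) (u ^+ (2 * l) * phi u)%:E)%E.
  rewrite /gtail /Rintegral fineK //; apply: integrable_fin_num => //.
  by apply: integrableS (integrable_pow_phi R (2 * l)) => //; exact: measurable_itv.
pose C : R := 1 + (2 * l)`!%:R * 8^-1 ^- (2 * l).
have hC (u : R) : u ^+ (2 * l) <= C * expR (8^-1 * u ^+ 2).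
  have -> : u ^+ (2 * l) = `|u| ^+ (2 * l).
    by rewrite -normrX ger0_norm // exprM exprn_ge0 ?sqr_ge0.
  by apply: absX_le_expR; rewrite invr_gt0.
(* The power costs [exp (u^2 / 8)], half of the decay [exp (- u^2 / 4)] of the kernel. *)
pose G (u : R) := pk * C * expR (- (8^-1 * u ^+ 2)).
apply: (@dominated_cvg _ _ _ mu _ _ _ _ (fun u => (G u)%:E)) => //.
- move=> n; apply/measurable_EFinP; apply: measurable_funTS; apply: measurable_funM.
    exact: exprn_measurable.
  by apply: measurable_funM; [exact: measurable_cst|exact: measurable_fker].
- move=> u _; apply: cvg_EFin; first exact: nearW.
  apply: cvgM; first exact: cvg_cst.
  by rewrite phiE; apply: cvgM; [exact: cvg_cst|exact: fker_cvg].
- apply: (@integrableS _ _ _ _ setT) => //.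
  have e0 : 0 < 8^-1 :> R by rewrite invr_gt0.
  exact: (integrableZl measurableT (pk * C) (integrable_gauss e0)).
- move=> n u _; rewrite abse_EFin lee_fin normrM ger0_norm ?exprn_even_ge0 //; last by rewrite mul2n odd_double.
  rewrite (@ger0_norm _ (pk * _)) ?mulr_ge0 ?fker_ge0 ?normal_peak_ge0 //.
  have h : u ^+ (2 * l) <= C * expR (8^-1 * u ^+ 2) by exact: hC.
  have -> : G u = C * expR (8^-1 * u ^+ 2) * (pk * expR (- (4^-1 * u ^+ 2))).
    have -> : - (4^-1 * u ^+ 2) = - (8^-1 * u ^+ 2) - 8^-1 * u ^+ 2 by field.
    rewrite expRD /G; have := expRxMexpNx_1 (8^-1 * u ^+ 2) => e.
    transitivity (pk * C * expR (- (8^-1 * u ^+ 2)) * (expR (8^-1 * u ^+ 2) * expR (- (8^-1 * u ^+ 2)))).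
      by rewrite e mulr1.
    by ring.
  apply: ler_pM => //.
  + by rewrite exprM exprn_ge0 // sqr_ge0.
  + by rewrite mulr_ge0 ?fker_ge0 ?normal_peak_ge0.
  + by rewrite ler_wpM2l ?fker_le ?normal_peak_ge0.
Qed.

Definition Qn (n l : nat) : {poly R} :=
  primpoly (- ('X^(2 * l) * (1 - 'X^2) ^+ (n - 2 * k))) 1.

(** The kernel vanishes beyond [c = sqrt (2 n)]; before that, [Qn] at [u / c] is a primitive up to a
    constant factor. *)
Lemma int_fkerE n l v : (4 * k <= n)%N -> 0 <= v -> v < Num.sqrt (2 * n%:R) ->
  (\int[mu]_(u in `]v, +oo[) (u ^+ (2 * l) * (pk * fker n u))%:E)%E =
  (pk * Num.sqrt (2 * n%:R) ^+ (2 * l).+1 * (Qn n l).[v / Num.sqrt (2 * n%:R)])%:E.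
Proof.
move=> kn v0; set c := Num.sqrt _ => vc.
have n0 : 0 < n%:R :> R by rewrite ltr0n; lia.
have c0 : 0 < c by rewrite sqrtr_gt0 mulr_gt0.
have c2 : c ^+ 2 = 2 * n%:R by rewrite sqr_sqrtr // mulr_ge0 // ltW.
pose Fp : {poly R} := - (pk * c ^+ (2 * l).+1) *: (Qn n l \Po (c^-1 *: 'X)).
have FpE x : Fp.[x] = - (pk * c ^+ (2 * l).+1 * (Qn n l).[x / c]).
  by rewrite /Fp hornerZ horner_comp hornerZ hornerX mulNr [x / c]mulrC.
have dFp x : (Fp^`()).[x] = x ^+ (2 * l) * (pk * (1 - x ^+ 2 / 2 / n%:R) ^+ (n - 2 * k)).
  rewrite /Fp derivZ deriv_comp deriv_primpoly derivZ derivX hornerZ hornerM horner_comp.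
  rewrite !hornerZ hornerX hornerC hornerN hornerM hornerXn horner_exp hornerD hornerN hornerC hornerXn.
  have -> : (c^-1 * x) ^+ 2 = x ^+ 2 / 2 / n%:R.
    by rewrite exprMn exprVn c2; field; rewrite gt_eqF.
  rewrite exprMn exprVn exprS; field; rewrite expf_neq0 ?gt_eqF //.
have eD : `]v, +oo[ `&` `]-oo, c] = `]v, c]%classic.
  apply/seteqP; split => x /=; rewrite !in_itv /= ?andbT; first by case=> -> ->.
  by case/andP=> -> ->.
transitivity (\int[mu]_(u in `]v, c]) ((Fp^`()).[u])%:E)%E.
  rewrite -eD integral_mkcondr; apply: eq_integral => u; rewrite inE /= in_itv /= andbT => vu.
  rewrite patchE; have [uc|cu] := leP (u : R) c.
    rewrite mem_set /= ?in_itv //= dFp /fker kn; congr (_ * (_ * _ ^+ _))%:E; apply: max_r.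
    rewrite subr_ge0 ler_pdivrMr // ler_pdivrMr // mul1r mulrC -c2.
    by rewrite ler_sqr ?nnegrE ?(ltW c0) // ltW // (le_lt_trans v0).
  rewrite memNset /= ?in_itv /=; last by apply/negP; rewrite -ltNge.
  rewrite /fker kn max_l ?expr0n.
    by have -> : (n - 2 * k == 0)%N = false by [lia]; rewrite !mulr0.
  rewrite subr_le0 ler_pdivlMr // ler_pdivlMr // mul1r mulrC -c2.
  by rewrite ler_sqr ?nnegrE ?(ltW c0) ?(ltW cu) // ltW // (le_lt_trans v0).
rewrite integral_itv_obnd_cbnd; last first.
  apply/measurable_EFinP; apply: measurable_funTS; apply: continuous_measurable_fun.
  exact: continuous_horner.
rewrite (@continuous_FTC2 _ _ (horner Fp)) //.
- by rewrite !FpE divff ?gt_eqF // primpoly_at mulr0 oppr0 -EFinB sub0r opprK.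
- exact/continuous_subspaceT/continuous_horner.
- split; first by move=> x _; exact: derivable_horner.
    exact/cvg_at_right_filter/continuous_horner.
  exact/cvg_at_left_filter/continuous_horner.
- by move=> x _; rewrite derive1E; have := is_derive_poly Fp x => ?; rewrite derive_val.
Qed.

End ScaledKernel.

(** * Limit of the Bernstein sums *)

Section LimitDistribution.
Variables (R : realType) (k : nat).
Hypothesis k0 : (0 < k)%N.
Local Notation phi := (@normal_pdf R 0 1).
Local Notation pk := (@normal_peak R 1).

Definition gmat (v : R) : 'M[R]_k := \matrix_(i, j) gtail (i + j) v.

(** The factor [sqrt 2] comes from [y / sqrt n = sqrt 2 y / sqrt (2 n)], the kernel being scaled by
    [sqrt (2 n)]. *)
Definition Sdet (y : R) : R := \det (gmat (Num.sqrt 2 * y)) / \det (gmat 0).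

(* [h v = x (gmat v) x^T] is a nonnegative function with derivative [- P(v)^2 phi v];
   if it vanishes at [0], it vanishes on the half-line, and so does [P]. *)
Lemma gmat0_neq0 : \det (gmat 0) != 0.
Proof.
apply/negP => /det0P[x x0 /matrixP xM]; case/negP: x0; apply/eqP.
pose h v := \sum_i \sum_j x 0 i * x 0 j * gtail (i + j) v.
pose P : {poly R} := \sum_(i < k) x 0 i *: 'X^(2 * i).
have PE (u : R) : P.[u] = \sum_(i < k) x 0 i * u ^+ (2 * i).
  rewrite /P -[LHS]/(horner_eval u _) raddf_sum /=; apply: eq_bigr => i _.
  by rewrite /horner_eval hornerZ hornerXn.
have P2 (u : R) : P.[u] ^+ 2 = \sum_(i < k) \sum_(j < k) x 0 i * x 0 j * u ^+ (2 * (i + j)).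
  rewrite expr2 PE mulr_suml; apply: eq_bigr => i _; rewrite mulr_sumr.
  by apply: eq_bigr => j _; rewrite mulnDr exprD; ring.
have h0 : h 0 = 0.
  rewrite /h exchange_big big1 // => j _.
  have := xM 0 j; rewrite !mxE => e.
  rewrite -[RHS](mulr0 (x 0 j)) -[X in _ = _ * X]e mulr_sumr; apply: eq_bigr => i _.
  by rewrite mxE; ring.
have dh (v : R) : is_derive v 1 h (- (P.[v] ^+ 2 * phi v)).
  rewrite P2 mulr_suml -sumrN; apply: is_derive_bigsum => i.
  rewrite mulr_suml -sumrN; apply: is_derive_bigsum => j.
  by apply: (is_derive_eq (is_deriveZ _ (is_derive_gtail (i + j) v))); rewrite -[LHS]/(_ * _); ring.
have hmono (v w : R) : 0 <= v -> v <= w -> h w <= h v.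
  apply: (@ler0_derive1_nincry _ h 0) => //.
  - by move=> z _; rewrite derive1E; have := dh z => ?; rewrite derive_val oppr_le0 mulr_ge0 ?sqr_ge0 ?phi_ge0.
  - apply: continuous_subspaceT => z; have := dh z => -[dz _].
    exact/differentiable_continuous/derivable1_diffP.
have hlim : h v @[v --> +oo] --> (0 : R).
  rewrite -[X in _ --> X](_ : \sum_(i < k) \sum_(j < k) x 0 i * x 0 j * 0 = 0); last first.
    by rewrite big1 // => i _; rewrite big1 // => j _; rewrite mulr0.
  apply: cvg_bigsum => i _; apply: cvg_bigsum => j _.
  by apply: cvgM; [exact: cvg_cst|exact: gtail_cvg0].
have hge0 v : 0 <= v -> 0 <= h v.
  move=> v0; rewrite leNgt; apply/negP => hv.
  have [w [vw hw]] : exists w, v <= w /\ h v < h w.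
    apply: (@filter_ex _ (+oo)); near=> w; split; near: w.
      by apply: nbhs_pinfty_ge; exact: num_real.
    by apply: (cvgr_gt _ hlim).
  by have := hmono _ _ v0 vw; rewrite leNgt hw.
have hz v : 0 < v -> h v = 0.
  move=> v0; apply/eqP; rewrite eq_le (hge0 _ (ltW v0)) andbT -[leRHS]h0.
  by apply: hmono => //; exact: ltW.
have Pz (v : R) : 0 < v -> P.[v] = 0.
  move=> v0; have : is_derive v 1 h 0.
    have nz : \forall z \near v, (fun=> 0 : R) z = h z.
      by near=> z; rewrite /= hz //; near: z; exact: lt_nbhsr.
    exact: (near_eq_is_derive nz (is_derive_cst (0 : R) v 1)).
  move=> d0; have := dh v => d1.
  have := @derive_val _ _ _ _ _ _ _ d1; have := @derive_val _ _ _ _ _ _ _ d0 => -> /esym/eqP.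
  by rewrite oppr_eq0 mulf_eq0 (gt_eqF (phi_gt0 _)) orbF expf_eq0 /= => /eqP.
have P0 : P = 0.
  apply/eqP/negP => /negP Pn0.
  pose rs := [seq i.+1%:R : R | i <- iota 0 (size P)].
  have : (size rs < size P)%N.
    apply: max_poly_roots => //.
      by apply/allP => z /mapP[i _ ->]; apply/eqP; apply: Pz; rewrite ltr0n.
    by rewrite map_inj_uniq ?iota_uniq // => i1 i2 /eqP; rewrite eqr_nat => /eqP[].
  by rewrite size_map size_iota ltnn.
apply/rowP => j; rewrite mxE.
have := congr1 (fun p : {poly R} => p`_(2 * j)) P0; rewrite /P coef_sum coef0 (bigD1 j) //= big1.
  by rewrite coefZ coefXn eqxx mulr1 addr0.
move=> i ij; rewrite coefZ coefXn; case: eqP => [e|_]; last by rewrite mulr0.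
by case/eqP: ij; apply/val_inj => /=; lia.
Unshelve. all: by end_near. Qed.

Lemma Sdet0 : Sdet 0 = 1.
Proof. by rewrite /Sdet mulr0 divff // gmat0_neq0. Qed.

Definition Bmat (n : nat) (v : R) : 'M[R]_k :=
  \matrix_(i, j) (pk * Num.sqrt (2 * n%:R) ^+ (2 * (i + j)).+1 *
     (Qn R k n (i + j)).[v / Num.sqrt (2 * n%:R)]).

Lemma sqrt_cvgy : Num.sqrt (2 * n%:R) @[n --> \oo] --> (+oo : set_system R).
Proof.
apply/cvgryPge => A; near=> n.
have [A0|A0] := leP A 0; first exact: le_trans (sqrtr_ge0 _).
rewrite -[leLHS](ger0_norm (ltW A0)) -sqrtr_sqr ler_sqrt; last by rewrite mulr_ge0.
  apply: (@le_trans _ _ n%:R); last by rewrite ler_peMl // ler1n.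
  by near: n; apply: nbhs_infty_ger.
Unshelve. all: by end_near. Qed.

Lemma Bmat_cvg (v : R) : 0 <= v -> \det (Bmat n v) @[n --> \oo] --> \det (gmat v).
Proof.
move=> v0; apply: cvg_det => i j; rewrite mxE.
apply: (cvg_trans _ (fine_cvg (@int_fker_cvg R k k0 (i + j)%N v))); apply: near_eq_cvg; near=> n => /=.
rewrite int_fkerE ?mxE //; near: n; first exact: nbhs_infty_ge.
by apply: (cvgry_gt sqrt_cvgy).
Unshelve. all: by end_near. Qed.

Lemma det_Bmat n (v : R) : (0 < n)%N -> exists2 c : R, c != 0 &
  forall v, \det (Bmat n v) = c * Qdet k (Qn R k n) (v / Num.sqrt (2 * n%:R)).
Proof.
move=> n0; set c := Num.sqrt _.
have c0 : c != 0 by rewrite gt_eqF // sqrtr_gt0 mulr_gt0 ?ltr0n.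
have p0 : pk != 0 by rewrite gt_eqF // normal_peak_gt0 // oner_neq0.
exists ((\prod_(i < k) (pk * c ^+ (2 * i).+1)) * (\prod_(j < k) c ^+ (2 * j))).
  rewrite mulf_neq0 //; apply/prodf_neq0 => i _; rewrite ?mulf_neq0 ?expf_neq0 //.
move=> {}v; rewrite /Qdet; set M := \matrix_(i, j) _.
have -> : Bmat n v = diag_mx (\row_(i < k) (pk * c ^+ (2 * i).+1)) *m M *m diag_mx (\row_(j < k) c ^+ (2 * j)).
  apply/matrixP => i j; rewrite mul_mx_diag mul_diag_mx !mxE -/c mulnDr -addSn exprD; ring.
rewrite !det_mulmx !det_diag mulrAC; congr (_ * _ * _); apply: eq_bigr => i _; by rewrite mxE.
Qed.

Definition Bern (n : nat) (s : R) : R :=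
  (\sum_(i < (Nn n).+1) 'C(Nn n, i)%:R * s ^+ i * (1 - s) ^+ (Nn n - i) * (wcount n k i)%:R)
    / #|Omega n|%:R.

Lemma Bern_cvg (y : R) : 0 <= y -> Bern n (y / Num.sqrt n%:R) @[n --> \oo] --> Sdet y.
Proof.
move=> y0; have s0 : 0 <= Num.sqrt 2 * y :> R by rewrite mulr_ge0 ?sqrtr_ge0.
have h := Bmat_cvg s0; have h0 := Bmat_cvg (lexx 0).
have : \det (Bmat n (Num.sqrt 2 * y)) * (\det (Bmat n 0))^-1 @[n --> \oo] --> Sdet y.
  by apply: cvgM; [exact: h|apply: cvgV; [exact: gmat0_neq0|exact: h0]].
apply: cvg_trans; apply: near_eq_cvg; near=> n => /=.
have kn : (2 * k <= n)%N by near: n; exact: nbhs_infty_ge.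
have n1 : (1 < n)%N by near: n; exact: nbhs_infty_gt.
have B0 : \det (Bmat n 0) != 0.
  near: n; have := cvgr_neq0 _ h0 gmat0_neq0; exact.
have [c c0 cE] := det_Bmat 0 (ltnW n1).
have sE : Num.sqrt 2 * y / Num.sqrt (2 * n%:R) = y / Num.sqrt n%:R.
  rewrite sqrtrM // invfM mulrACA mulfV ?mul1r // gt_eqF // sqrtr_gt0 //.
rewrite !cE sE mul0r; rewrite cE mul0r mulf_eq0 negb_or c0 /= in B0.
have := @bernstein_wcount R n k (Qn R k n) k0 kn 
  (fun l => deriv_primpoly _ _) (fun l => primpoly_at _ _) (y / Num.sqrt n%:R).
move=> e; rewrite /Bern.
have O0 : #|Omega n|%:R != 0 :> R by rewrite pnatr_eq0 -lt0n card_Omega_gt0.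
apply/eqP; rewrite eqr_div ?mulf_neq0 //; apply/eqP.
by rewrite [RHS]mulrCA e; ring.
Unshelve. all: by end_near. Qed.

End LimitDistribution.

(** * Concentration of binomial weights *)

Section BinomialConcentration.
Variable R : realFieldType.

Lemma binom_sum_rec (f : nat -> R) N s r :
  \sum_(i < N.+2) 'C(N.+1, i)%:R * s ^+ i * r ^+ (N.+1 - i) * f i =
  s * (\sum_(i < N.+1) 'C(N, i)%:R * s ^+ i * r ^+ (N - i) * f i.+1) +
  r * (\sum_(i < N.+1) 'C(N, i)%:R * s ^+ i * r ^+ (N - i) * f i).
Proof.
have e1 : \sum_(i < N.+1) 'C(N, i)%:R * s ^+ i * r ^+ (N - i) * f i =
   \sum_(i < N.+2) 'C(N, i)%:R * s ^+ i * r ^+ (N - i) * f i.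
  by rewrite [RHS]big_ord_recr /= bin_small // !mul0r addr0.
rewrite e1 [LHS]big_ord_recl [X in r * X]big_ord_recl mulrDr addrCA; congr (_ + _).
  by rewrite !bin0 !subn0 !expr0 exprS; ring.
rewrite !mulr_sumr -big_split /=; apply: eq_bigr => i _; rewrite /bump /= !add1n.
have iN := ltn_ord i; rewrite binS natrD exprS subSS.
have [iN'|iN'] := leqP i.+1 N.
  by have -> : (N - i = (N - i.+1).+1)%N by [lia]; rewrite exprS; ring.
by rewrite (@bin_small N i.+1) //; ring.
Qed.

Lemma binom_sum1 N (s r : R) : r + s = 1 ->
  \sum_(i < N.+1) 'C(N, i)%:R * s ^+ i * r ^+ (N - i) = 1.
Proof.
move=> rs; transitivity ((r + s) ^+ N); last by rewrite rs expr1n.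
by rewrite exprDn; apply: eq_bigr => i _; rewrite -[RHS]mulr_natr; ring.
Qed.

Lemma binom_variance N (s r c : R) : r + s = 1 ->
  \sum_(i < N.+1) 'C(N, i)%:R * s ^+ i * r ^+ (N - i) * (i%:R - c) ^+ 2 =
  N%:R * s * r + (N%:R * s - c) ^+ 2.
Proof.
move=> rs; elim: N c => [|N IH] c.
  by rewrite big_ord1 /= bin0 subnn !expr0; ring.
rewrite (binom_sum_rec (fun i => (i%:R - c) ^+ 2)) IH.
have -> : \sum_(i < N.+1) 'C(N, i)%:R * s ^+ i * r ^+ (N - i) * (i.+1%:R - c) ^+ 2 =
   \sum_(i < N.+1) 'C(N, i)%:R * s ^+ i * r ^+ (N - i) * (i%:R - (c - 1)) ^+ 2.
  by apply: eq_bigr => i _; congr (_ * _ ^+ 2); rewrite -natr1; ring.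
have rE : r = 1 - s by rewrite -rs addrK.
by rewrite IH -natr1 rE; ring.
Qed.

Lemma binom_weight_ge0 N (s r : R) i : 0 <= s -> 0 <= r ->
  0 <= 'C(N, i)%:R * s ^+ i * r ^+ (N - i).
Proof. by move=> s0 r0; rewrite !mulr_ge0 ?exprn_ge0. Qed.

(* A quadratic barrier replaces the splitting of the sum in Chebyshev's argument. *)
Lemma bernstein_ub N (s : R) (q : nat -> R) (D : nat) : 0 <= s <= 1 ->
  (forall m, q m.+1 <= q m) -> (forall m, 0 <= q m <= 1) -> D%:R < N%:R * s ->
  \sum_(i < N.+1) 'C(N, i)%:R * s ^+ i * (1 - s) ^+ (N - i) * q i <=
  q D + N%:R * s / (N%:R * s - D%:R) ^+ 2.
Proof.
case/andP=> s0 s1 qd q01 Ds; set c := N%:R * s in Ds *.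
have r0 : 0 <= 1 - s by rewrite subr_ge0.
have cD : 0 < (c - D%:R) ^+ 2 by rewrite exprn_gt0 // subr_gt0.
have qmono i j : (i <= j)%N -> q j <= q i.
  elim: j => [|j IH]; first by rewrite leqn0 => /eqP ->.
  by rewrite leq_eqVlt => /orP[/eqP -> //|/IH]; exact: le_trans.
have ub i : q i <= q D + (i%:R - c) ^+ 2 / (c - D%:R) ^+ 2.
  have [Di|iD] := leqP D i.
    by rewrite -[leLHS]addr0 lerD ?qmono // divr_ge0 ?sqr_ge0 // ltW.
  apply: (@le_trans _ _ 1); first by case/andP: (q01 i).
  rewrite -[leLHS]add0r lerD //; first by case/andP: (q01 D).
  rewrite ler_pdivlMr // mul1r -[leRHS]sqrrN opprB.
  have : i%:R <= D%:R :> R by rewrite ler_nat ltnW.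
  move=> h; apply: lerXn2r; rewrite ?nnegrE; lra.
apply: (@le_trans _ _ (\sum_(i < N.+1) ('C(N, i)%:R * s ^+ i * (1 - s) ^+ (N - i) * q D +
   'C(N, i)%:R * s ^+ i * (1 - s) ^+ (N - i) * (i%:R - c) ^+ 2 / (c - D%:R) ^+ 2))).
  apply: ler_sum => i _; move: (binom_weight_ge0 N i s0 r0); set wt := _ * _ * _ => w0.
  by rewrite -[X in _ + X]mulrA -mulrDr; apply: ler_wpM2l (ub i).
rewrite big_split /= -mulr_suml binom_sum1 ?subrK // mul1r -mulr_suml binom_variance ?subrK //.
rewrite subrr expr0n addr0 lerD2l ler_pM2r ?invr_gt0 // -[leRHS]mulr1.
by apply: ler_wpM2l; [rewrite mulr_ge0|lra].
Qed.

Lemma bernstein_lb N (s : R) (q : nat -> R) (D : nat) : 0 <= s <= 1 ->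
  (forall m, q m.+1 <= q m) -> (forall m, 0 <= q m <= 1) -> N%:R * s < D%:R ->
  q D - N%:R * s / (N%:R * s - D%:R) ^+ 2 <=
  \sum_(i < N.+1) 'C(N, i)%:R * s ^+ i * (1 - s) ^+ (N - i) * q i.
Proof.
case/andP=> s0 s1 qd q01 Ds; set c := N%:R * s in Ds *.
have r0 : 0 <= 1 - s by rewrite subr_ge0.
have cD : 0 < (c - D%:R) ^+ 2 by rewrite -sqrrN opprB exprn_gt0 // subr_gt0.
have qmono i j : (i <= j)%N -> q j <= q i.
  elim: j => [|j IH]; first by rewrite leqn0 => /eqP ->.
  by rewrite leq_eqVlt => /orP[/eqP -> //|/IH]; exact: le_trans.
have lb i : q D - (i%:R - c) ^+ 2 / (c - D%:R) ^+ 2 <= q i.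
  have [iD|Di] := leqP i D.
    rewrite lerBlDr; apply: (le_trans (qmono _ _ iD)).
    by rewrite -[leLHS]addr0 lerD // divr_ge0 ?sqr_ge0 // ltW.
  apply: (@le_trans _ _ 0); last by case/andP: (q01 i).
  rewrite subr_le0; apply: (@le_trans _ _ 1); first by case/andP: (q01 D).
  rewrite ler_pdivlMr // mul1r -sqrrN opprB.
  have : D%:R <= i%:R :> R by rewrite ler_nat ltnW.
  move=> h; apply: lerXn2r; rewrite ?nnegrE; lra.
apply: (@le_trans _ _ (\sum_(i < N.+1) ('C(N, i)%:R * s ^+ i * (1 - s) ^+ (N - i) * q D -
   'C(N, i)%:R * s ^+ i * (1 - s) ^+ (N - i) * (i%:R - c) ^+ 2 / (c - D%:R) ^+ 2))); last first.
  apply: ler_sum => i _; move: (binom_weight_ge0 N i s0 r0); set wt := _ * _ * _ => w0.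
  by rewrite -[X in _ - X]mulrA -mulrBr; apply: ler_wpM2l (lb i).
rewrite sumrB -mulr_suml binom_sum1 ?subrK // mul1r -mulr_suml binom_variance ?subrK //.
rewrite subrr expr0n addr0 lerD2l lerN2 ler_pM2r ?invr_gt0 // -[leRHS]mulr1.
by apply: ler_wpM2l; [rewrite mulr_ge0|lra].
Qed.

End BinomialConcentration.

(** * Slopes of convex sequences *)

Lemma is_derive_quot (R : realType) (F : R -> R) (x dF : R) : is_derive x 1 F dF ->
  forall e : R, 0 < e -> exists2 r, 0 < r &
    forall h, h != 0 -> `|h| < r -> `|dF - h^-1 * (F (h + x) - F x)| < e.
Proof.
move=> [dx dv] e e0.
have c : h^-1 *: ((F \o shift x) (h *: 1) - F x) @[h --> 0^'] --> dF by rewrite -dv.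
have : \forall h \near 0^', `|dF - h^-1 *: ((F \o shift x) (h *: 1) - F x)| < e.
  by move/cvgrPdist_lt: c; apply.
move=> /nbhs_ballP[r /= r0 H]; exists r => // h h0 hr.
have := H h; rewrite /ball /= sub0r normrN => /(_ hr h0).
by rewrite /GRing.scale /= mulr1.
Qed.

Lemma dist_half (R : realFieldType) (A B e : R) :
  0 < e -> - B - e / 2 < A -> A < - B + e / 2 -> `|- B - A| < e.
Proof. by move=> e0 h1 h2; rewrite ltr_norml; apply/andP; split; lra. Qed.

Section ConvexSlope.
Variables (R : realType) (q : nat -> nat -> R) (T : nat -> R) (F : R -> R).
Hypothesis qconv : forall n m, q n m.+1 - q n m.+2 <= q n m - q n m.+1.
Hypothesis Ty : T n @[n --> \oo] --> +oo.
Local Notation D z n := (Num.trunc (z * T n)).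
Hypothesis qF : forall z, 0 < z -> q n (D z n) @[n --> \oo] --> F z.

Lemma trunc_ratio_cvg z : 0 <= z -> (D z n)%:R / T n @[n --> \oo] --> z.
Proof.
move=> z0.
have h : z - (T n)^-1 @[n --> \oo] --> z.
  rewrite -[X in _ --> X]subr0; apply: cvgB; first exact: cvg_cst.
  by apply/gtr0_cvgV0 => //; exact: (cvgry_gt Ty).
apply: (squeeze_cvgr _ h (cvg_cst z)); near=> n.
have T0 : 0 < T n by near: n; exact: (cvgry_gt Ty).
have := trunc_itv (mulr_ge0 z0 (ltW T0)); rewrite -natr1 => /andP[h1 h2].
apply/andP; split; last by rewrite ler_pdivrMr.
rewrite ler_pdivlMr // mulrBl mulVf ?gt_eqF //; lra.
Unshelve. all: by end_near. Qed.

Lemma slope_decr n i j : (i <= j)%N -> q n j - q n j.+1 <= q n i - q n i.+1.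
Proof.
elim: j => [|j IH]; first by rewrite leqn0 => /eqP ->.
by rewrite leq_eqVlt => /orP[/eqP -> //|/IH]; apply: le_trans.
Qed.

Lemma slope_ub n i j : (i <= j)%N -> (j - i)%:R * (q n j - q n j.+1) <= q n i - q n j.
Proof.
move=> ij; have -> : q n i - q n j = \sum_(i <= m < j) (q n m - q n m.+1).
  have := telescope_sumr (q n) ij; rewrite -[q n i - q n j]opprB => <-.
  by rewrite -sumrN; apply: eq_bigr => m _; rewrite opprB.
rewrite mulr_natl -sumr_const_nat.
by apply: ler_sum_nat => m /andP[im mj]; apply: slope_decr; lia.
Qed.

Lemma slope_lb n i j : (i <= j)%N -> q n i - q n j <= (j - i)%:R * (q n i - q n i.+1).
Proof.
move=> ij; have -> : q n i - q n j = \sum_(i <= m < j) (q n m - q n m.+1).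
  have := telescope_sumr (q n) ij; rewrite -[q n i - q n j]opprB => <-.
  by rewrite -sumrN; apply: eq_bigr => m _; rewrite opprB.
rewrite mulr_natl -sumr_const_nat.
by apply: ler_sum_nat => m /andP[im mj]; apply: slope_decr; lia.
Qed.

(** By convexity the slope at [D x n] lies between the secant slopes towards [x + h] and [x - h]. In
    the limit these are difference quotients of [F], and [h] is chosen so that both are within
    [e / 2 / x] of [dF]. *)
Lemma convex_slope_cvg (x dF : R) : 0 < x -> is_derive x 1 F dF ->
  (D x n)%:R * (q n (D x n) - q n (D x n).+1) @[n --> \oo] --> - (x * dF).
Proof.
move=> x0 dx; apply/cvgrPdist_lt => e e0.
have e1 : 0 < e / 2 / x by rewrite !divr_gt0.
have [r r0 hr] := is_derive_quot dx e1.
(* The bound [x / 2] keeps [x - h] positive, where the convergence of [q] is known. *)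
pose h := Num.min (r / 2) (x / 2).
have h0 : 0 < h by rewrite lt_min !divr_gt0.
have hn : h != 0 by rewrite gt_eqF.
have hx : h <= x / 2 by rewrite ge_min lexx orbT.
have hrr : `|h| < r by rewrite gtr0_norm // gt_min; apply/orP; left; lra.
have d1 := hr h hn hrr; have := hr (- h); rewrite oppr_eq0 normrN => /(_ hn hrr) d2.
have xh0 : 0 < x - h by lra.
pose u1 n := (D x n)%:R / T n / ((D (x + h) n)%:R / T n - (D x n)%:R / T n) *
   (q n (D x n) - q n (D (x + h) n)).
pose u2 n := (D x n)%:R / T n / ((D x n)%:R / T n - (D (x - h) n)%:R / T n) *
   (q n (D (x - h) n) - q n (D x n)).
have c1 : u1 n @[n --> \oo] --> x / (x + h - x) * (F x - F (x + h)).
  apply: cvgM; last by apply: cvgB; apply: qF => //; lra.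
  apply: cvgM; first by apply: trunc_ratio_cvg; exact: ltW.
  apply: cvgV; first by rewrite addrAC subrr add0r.
  by apply: cvgB; apply: trunc_ratio_cvg; lra.
have c2 : u2 n @[n --> \oo] --> x / (x - (x - h)) * (F (x - h) - F x).
  apply: cvgM; last by apply: cvgB; apply: qF => //; lra.
  apply: cvgM; first by apply: trunc_ratio_cvg; exact: ltW.
  apply: cvgV; first by rewrite opprB addrC subrK.
  by apply: cvgB; apply: trunc_ratio_cvg; lra.
have b1 : - (x * dF) - e / 2 < x / (x + h - x) * (F x - F (x + h)).
  have -> : x / (x + h - x) * (F x - F (x + h)) = x * (- (h^-1 * (F (h + x) - F x))).
    by rewrite [h + x]addrC (_ : x + h - x = h); [field|ring].
  move: d1; rewrite ltr_norml => /andP[d1 _].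
  have : x * - (e / 2 / x) < x * (dF - h^-1 * (F (h + x) - F x)) by rewrite ltr_pM2l.
  rewrite mulrN [x * (e / 2 / x)]mulrC divfK ?gt_eqF //; lra.
have b2 : x / (x - (x - h)) * (F (x - h) - F x) < - (x * dF) + e / 2.
  have -> : x / (x - (x - h)) * (F (x - h) - F x) = x * (- ((- h)^-1 * (F (- h + x) - F x))).
    by rewrite [- h + x]addrC invrN (_ : x - (x - h) = h); [field|ring].
  move: d2; rewrite ltr_norml => /andP[_ d2].
  have : x * (dF - (- h)^-1 * (F (- h + x) - F x)) < x * (e / 2 / x) by rewrite ltr_pM2l.
  rewrite [x * (e / 2 / x)]mulrC divfK ?gt_eqF //; lra.
near=> n.
have T0 : 0 < T n by near: n; exact: (cvgry_gt Ty).
have D12 : (D x n < D (x + h) n)%N.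
  have : 0 < (D (x + h) n)%:R / T n - (D x n)%:R / T n :> R.
    near: n; have : (D (x + h) n)%:R / T n - (D x n)%:R / T n @[n --> \oo] --> x + h - x.
      by apply: cvgB; apply: trunc_ratio_cvg; lra.
    by move=> /cvgr_gt; apply; lra.
  by rewrite -mulrBl pmulr_lgt0 ?invr_gt0 // subr_gt0 ltr_nat.
have D02 : (D (x - h) n < D x n)%N.
  have : 0 < (D x n)%:R / T n - (D (x - h) n)%:R / T n :> R.
    near: n; have : (D x n)%:R / T n - (D (x - h) n)%:R / T n @[n --> \oo] --> x - (x - h).
      by apply: cvgB; apply: trunc_ratio_cvg; lra.
    by move=> /cvgr_gt; apply; lra.
  by rewrite -mulrBl pmulr_lgt0 ?invr_gt0 // subr_gt0 ltr_nat.
have ratioE (c d : R) : 0 < d -> c / T n / (d / T n) = c / d.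
  by move=> d0; field; rewrite !gt_eqF.
have l1 : u1 n <= (D x n)%:R * (q n (D x n) - q n (D x n).+1).
  rewrite /u1 -mulrBl ratioE ?subr_gt0 ?ltr_nat // -mulrA ler_wpM2l //.
  rewrite [leLHS]mulrC ler_pdivrMr ?subr_gt0 ?ltr_nat // [leRHS]mulrC -natrB ?(ltnW D12) //.
  exact: slope_lb (ltnW D12).
have l2 : (D x n)%:R * (q n (D x n) - q n (D x n).+1) <= u2 n.
  rewrite /u2 -mulrBl ratioE ?subr_gt0 ?ltr_nat // -mulrA ler_wpM2l //.
  rewrite [leRHS]mulrC ler_pdivlMr ?subr_gt0 ?ltr_nat // [leLHS]mulrC -natrB ?(ltnW D02) //.
  exact: slope_ub (ltnW D02).
have n1 : - (x * dF) - e / 2 < u1 n by near: n; apply: (cvgr_gt _ c1).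
have n2 : u2 n < - (x * dF) + e / 2 by near: n; apply: (cvgr_lt _ c2).
exact: (dist_half e0 (lt_le_trans n1 l1) (le_lt_trans l2 n2)).
Unshelve. all: by end_near. Qed.

End ConvexSlope.

(** * Smoothness and decay of the limit function *)

Section SmoothTail.
Variables (R : realType) (k : nat).
Hypothesis k0 : (0 < k)%N.
Local Notation phi := (@normal_pdf R 0 1).
Local Notation sq2 := (Num.sqrt 2 : R).

(** Polynomials times [phi (sqrt 2 y)]: a class closed under differentiation that contains the
    derivatives of the tails. *)
Definition pg (P : {poly R}) (y : R) : R := P.[y] * phi (sq2 * y).

Lemma phi_sq2 (y : R) : phi (sq2 * y) = normal_peak 1 * expR (- y ^+ 2).
Proof.
rewrite phiE exprMn sqr_sqrtr //; congr (_ * expR _); by field.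
Qed.

Lemma is_derive_pg P (y : R) : is_derive y 1 (pg P) (pg (P^`() - 2 *: ('X * P)) y).
Proof.
have -> : pg P = (fun z => P.[z] * (normal_peak 1 * expR (- z ^+ 2))).
  by apply/funext => z; rewrite /pg phi_sq2.
have dsq : is_derive y 1 (fun z : R => - z ^+ 2) (- (2 * y)).
  by apply: (is_derive_eq (is_deriveN (is_deriveX 2 (is_derive_id y 1)))); rewrite /= expr1 /GRing.scale /= mulr1.
have dE : is_derive y 1 (fun z : R => expR (- z ^+ 2)) (expR (- y ^+ 2) * - (2 * y)).
  exact: (is_derive1_comp (is_derive_expR _) dsq).
have dE2 := is_deriveZ (normal_peak 1 : R) dE.
apply: (is_derive_eq (is_deriveM (is_derive_poly P y) dE2)).
change (P.[y] * (normal_peak 1 * (expR (- y ^+ 2) * - (2 * y))) +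
  (normal_peak 1 * expR (- y ^+ 2)) * P^`().[y] = pg (P^`() - 2 *: ('X * P)) y).
by rewrite /pg phi_sq2 hornerD hornerN hornerZ hornerM hornerX; ring.
Qed.

Definition dgp (l : nat) : {poly R} := - (sq2 ^+ (2 * l).+1 *: 'X^(2 * l)).

Lemma is_derive_gtail2 l (y : R) : is_derive y 1 (fun z => gtail l (sq2 * z)) (pg (dgp l) y).
Proof.
have d1 : is_derive y 1 (fun z => sq2 * z) sq2.
  by apply: (is_derive_eq (is_deriveZ sq2 (is_derive_id y 1))); rewrite /GRing.scale /= mulr1.
apply: (is_derive_eq (is_derive1_comp (is_derive_gtail l (sq2 * y)) d1)).
by rewrite /pg /dgp hornerN hornerZ hornerXn exprMn exprS; ring.
Qed.

(** The derivative of order [c] of a tail, for [c] equal to 0, 1 or 2; [dgmat] lets each row be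
    differentiated its own number of times. *)
Definition dg (c l : nat) (y : R) : R :=
  match c with
  | 0 => gtail l (sq2 * y)
  | 1 => pg (dgp l) y
  | _ => pg ((dgp l)^`() - 2 *: ('X * dgp l)) y
  end.

Lemma is_derive_dg c l (y : R) : (c < 2)%N -> is_derive y 1 (dg c l) (dg c.+1 l y).
Proof.
case: c => [|[|]] // _; [exact: is_derive_gtail2|exact: is_derive_pg].
Qed.

Lemma continuous_dg c l : continuous (dg c l).
Proof.
move=> y; have [d [dd _]] : exists d, is_derive (y : R) 1 (dg c l) d.
  case: c => [|[|c]]; [exists (dg 1 l y); exact: is_derive_gtail2| |].
    by exists (dg 2 l y); exact: is_derive_pg.
  by eexists; exact: is_derive_pg.
exact/differentiable_continuous/derivable1_diffP.
Qed.

Definition dgmat (c : 'I_k -> nat) (y : R) : 'M[R]_k := \matrix_(i, j) dg (c i) (i + j) y.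

Lemma continuous_det_dgmat c : continuous (fun y => \det (dgmat c y)).
Proof.
move=> y; apply: cvg_det => i j; rewrite mxE.
under eq_fun do rewrite mxE.
exact: continuous_dg.
Qed.

Definition bump_at (c : 'I_k -> nat) (p : 'I_k) : 'I_k -> nat :=
  fun i => if i == p then (c i).+1 else c i.

Lemma is_derive_det_dgmat c (y : R) : (forall i, c i < 2)%N ->
  is_derive y 1 (fun z => \det (dgmat c z)) (\sum_p \det (dgmat (bump_at c p) y)).
Proof.
move=> c2; pose dA := \matrix_(i < k, j < k) dg (c i).+1 (i + j) y.
have h i j : is_derive y 1 (fun z => dgmat c z i j) (dA i j).
  by rewrite mxE; under eq_fun do rewrite mxE; exact: is_derive_dg.
apply: (is_derive_eq (is_derive_det h)); apply: eq_bigr => p _.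
congr (\det _); apply/matrixP => i j; rewrite !mxE /bump_at.
by case: eqP.
Qed.

Definition S0 (y : R) : R := \det (dgmat (fun=> 0%N) y) / \det (@gmat R k 0).
Definition S1 (y : R) : R :=
  (\sum_p \det (dgmat (bump_at (fun=> 0%N) p) y)) / \det (@gmat R k 0).
Definition S2 (y : R) : R :=
  (\sum_p \sum_q \det (dgmat (bump_at (bump_at (fun=> 0%N) p) q) y)) / \det (@gmat R k 0).

Lemma S0E y : S0 y = Sdet k y.
Proof. by congr (\det _ / _); apply/matrixP => i j; rewrite !mxE. Qed.

Lemma is_derive_S0 (y : R) : is_derive y 1 (Sdet k) (S1 y).
Proof.
have -> : Sdet k = S0 by apply/funext => z; rewrite S0E.
have := is_deriveZ (\det (@gmat R k 0))^-1 (@is_derive_det_dgmat (fun=> 0%N) y (fun=> isT)).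
rewrite /S0 /S1 /GRing.scale /= [(_)^-1 * _]mulrC.
by have -> : (fun y0 : R => \det (dgmat (fun=> 0%N) y0) / \det (@gmat R k 0)) =
   ((\det (@gmat R k 0))^-1 \*: fun z : R => \det (dgmat (fun=> 0%N) z)) by apply/funext => z /=; rewrite /GRing.scale /= mulrC.
Qed.

Lemma is_derive_S1 (y : R) : is_derive y 1 S1 (S2 y).
Proof.
have h p : is_derive y 1 (fun z => \det (dgmat (bump_at (fun=> 0%N) p) z))
    (\sum_q \det (dgmat (bump_at (bump_at (fun=> 0%N) p) q) y)).
  by apply: is_derive_det_dgmat => i; rewrite /bump_at; case: ifP.
have := is_deriveZ (\det (@gmat R k 0))^-1 (is_derive_bigsum (index_enum 'I_k) h).
rewrite /S1 /S2 /GRing.scale /= [(_)^-1 * _]mulrC.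
by have -> : (fun y0 : R => (\sum_p \det (dgmat (bump_at (fun=> 0%N) p) y0)) / \det (@gmat R k 0)) =
   ((\det (@gmat R k 0))^-1 \*: fun z : R => \sum_p \det (dgmat (bump_at (fun=> 0%N) p) z)) by apply/funext => z /=; rewrite /GRing.scale /= mulrC.
Qed.

Lemma continuous_S2 : continuous S2.
Proof.
move=> y; apply: cvgM; last exact: cvg_cst.
by apply: cvg_bigsum => p _; apply: cvg_bigsum => q _; exact: continuous_det_dgmat.
Qed.

Lemma cvg_y_pow_phi d : y ^+ d * phi (sq2 * y) @[y --> +oo] --> (0 : R).
Proof.
have C1 : (d.+1)`!%:R * normal_peak 1 / y @[y --> +oo] --> (0 : R).
  rewrite -[X in _ --> X](mulr0 (d.+1`!%:R * normal_peak 1)); apply: cvgM; first exact: cvg_cst.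
  apply/gtr0_cvgV0; last exact: cvg_id.
  exact: nbhs_pinfty_gt.
have key (y : R) : 1 < y -> y ^+ d * phi (sq2 * y) <= (d.+1)`!%:R * normal_peak 1 / y.
  move=> y1; have y0 : 0 < y by lra.
  rewrite ler_pdivlMr // phi_sq2.
  have h : y ^+ d.+1 <= d.+1`!%:R * expR (y ^+ 2).
    apply: (le_trans (pow_le_expR _ (ltW y0))); rewrite ler_wpM2l // ler_expR expr2.
    by rewrite ler_peMl ?(ltW y0) ?(ltW y1).
  have -> : y ^+ d * (normal_peak 1 * expR (- y ^+ 2)) * y = normal_peak 1 * (y ^+ d.+1 * expR (- y ^+ 2)).
    by rewrite [y ^+ d.+1]exprSr; ring.
  rewrite [leRHS]mulrC ler_wpM2l ?normal_peak_ge0 //.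
  apply: (le_trans (ler_wpM2r (expR_ge0 _) h)).
  by rewrite -mulrA expRxMexpNx_1 mulr1.
apply: (squeeze_cvgr _ (cvg_cst 0) C1); near=> y.
have y1 : 1 < y by near: y; exact: nbhs_pinfty_gt.
by rewrite key // andbT mulr_ge0 ?phi_ge0 // exprn_ge0 // ltW // (lt_trans ltr01).
Unshelve. all: by end_near. Qed.

Lemma dg0_cvg l : dg 0 l y @[y --> +oo] --> (0 : R).
Proof.
apply: (cvg_comp (fun y => sq2 * y) (gtail l)); last exact: gtail_cvg0.
apply/cvgryPge => A; near=> y; rewrite mulrC -ler_pdivrMr ?sqrtr_gt0 //.
Unshelve. all: by end_near. Qed.

Lemma ydg1_cvg l : y * dg 1 l y @[y --> +oo] --> (0 : R).
Proof.
rewrite -[X in _ --> X](mulr0 (- sq2 ^+ (2 * l).+1)).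
have : - sq2 ^+ (2 * l).+1 * (y ^+ (2 * l).+1 * phi (sq2 * y)) @[y --> +oo] --> - sq2 ^+ (2 * l).+1 * 0.
  by apply: cvgM; [exact: cvg_cst|exact: cvg_y_pow_phi].
apply: cvg_trans; apply: near_eq_cvg; apply: nearW => y /=.
by rewrite /pg /dgp hornerN hornerZ hornerXn [y ^+ _.+1]exprS; ring.
Qed.

Lemma Sdet_cvg0 : Sdet k y @[y --> +oo] --> (0 : R).
Proof.
rewrite -[X in _ --> X](mul0r ((\det (@gmat R k 0))^-1)).
have -> : Sdet k = S0 by apply/funext => z; rewrite S0E.
apply: cvgM; last exact: cvg_cst.
have <- : \det (0 : 'M[R]_k) = 0 by case: k k0 => // k' _; rewrite det0.
apply: cvg_det => i j; rewrite mxE; under eq_fun do rewrite mxE.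
exact: dg0_cvg.
Qed.

(** The factor [y] is absorbed into the differentiated row, whose entries still decay. *)
Lemma yS1_cvg0 : y * S1 y @[y --> +oo] --> (0 : R).
Proof.
have : (\sum_(p < k) \det (\matrix_(i < k, j < k) (if i == p then y * dg 1 (i + j) y else dg 0 (i + j) y)))
    / \det (@gmat R k 0) @[y --> +oo] --> (\sum_(p < k) \det (0 : 'M[R]_k)) / \det (@gmat R k 0).
  apply: cvgM; last exact: cvg_cst.
  apply: cvg_bigsum => p _; apply: cvg_det => i j; rewrite mxE; under eq_fun do rewrite mxE.
  by case: (i == p); [exact: ydg1_cvg|exact: dg0_cvg].
have -> : \det (0 : 'M[R]_k) = 0 by case: k k0 => // k' _; rewrite det0.
rewrite big1 // mul0r; apply: cvg_trans; apply: near_eq_cvg; apply: nearW => y /=.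
rewrite /S1 mulrA; congr (_ / _); rewrite mulr_sumr; apply: eq_bigr => p _.
rewrite -[RHS](_ : \det (diag_mx (\row_i (if i == p then y else 1)) *m dgmat (bump_at (fun=> 0%N) p) y) = _).
  congr (\det _); apply/matrixP => i j; rewrite mul_diag_mx !mxE /bump_at.
  by case: ifP => _; rewrite ?mul1r.
rewrite det_mulmx det_diag; congr (_ * _); rewrite (bigD1 p) //= mxE eqxx big1 ?mulr1 // => i ip.
by rewrite mxE (negbTE ip).
Qed.

End SmoothTail.

Lemma dist_sandwich (R : realFieldType) (S S1 S2 q e : R) :
  `|S - S1| < e / 2 -> `|S - S2| < e / 2 -> q < S1 + e / 2 -> S2 - e / 2 < q -> `|S - q| < e.
Proof.
rewrite !ltr_norml => /andP[h1 h2] /andP[h3 h4] h5 h6; apply/andP; split; lra.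
Qed.

(** * Limit law of the spacing *)

Section SpacingLimit.
Variables (R : realType) (k : nat).
Hypothesis k0 : (0 < k)%N.

(** The value 0 for [n <= 1] keeps monotonicity and convexity true for every [n], as
    [convex_slope_cvg] asks. *)
Definition qw (n m : nat) : R :=
  if (1 < n)%N then (wcount n k m)%:R / #|Omega n|%:R else 0.

Definition T32 (n : nat) : R := n%:R * Num.sqrt n%:R.

Lemma T32E n : n%:R `^ (3 / 2) = T32 n.
Proof.
have -> : 3 / 2 = 1 + 2^-1 :> R by field.
case: n => [|n]; last first.
  by rewrite powRD ?powRr1 ?powR12_sqrt // pnatr_eq0 implybT.
rewrite /T32 mul0r powR0 //; apply: lt0r_neq0; lra.
Qed.

Lemma T32_cvgy : T32 n @[n --> \oo] --> (+oo : set_system R).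
Proof.
apply/cvgryPge => A; near=> n.
have n1 : 1 <= n%:R :> R by rewrite ler1n; near: n; exact: nbhs_infty_gt.
apply: (@le_trans _ _ n%:R); first by near: n; exact: nbhs_infty_ger.
rewrite /T32 ler_peMr // -[leLHS]sqrtr1 ler_sqrt //; lra.
Unshelve. all: by end_near. Qed.

Lemma Nn2 n : (Nn n * 2 = n * n.-1)%N.
Proof.
have : ('C(n, 2) * 2)%N = n ^_ 2 := bin_ffact n 2.
by rewrite ffactnS ffactn1.
Qed.

Lemma Nn_gt0 n : (1 < n)%N -> (0 < Nn n)%N.
Proof. by move=> n1; rewrite /Nn bin_gt0. Qed.

Lemma qw_mono n m : qw n m.+1 <= qw n m.
Proof.
rewrite /qw; case: ifP => // n1; rewrite ler_wpM2r ?invr_ge0 // ler_nat.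
exact/wcount_mono/Nn_gt0.
Qed.

Lemma wcount_le n m : (1 < n)%N -> (wcount n k m <= #|Omega n|)%N.
Proof.
move=> n1; rewrite -(wcount0 n k); elim: m => // m; apply: leq_trans.
exact/wcount_mono/Nn_gt0.
Qed.

Lemma qw01 n m : 0 <= qw n m <= 1.
Proof.
rewrite /qw; case: ifP => [n1|_]; last by rewrite lexx ler01.
rewrite divr_ge0 //= ler_pdivrMr ?ltr0n ?card_Omega_gt0 // mul1r ler_nat.
exact: wcount_le.
Qed.

Lemma qw_convex n m : qw n m.+1 - qw n m.+2 <= qw n m - qw n m.+1.
Proof.
rewrite /qw; case: ifP => // n1; rewrite -!mulrBl ler_wpM2r ?invr_ge0 //.
have N0 := Nn_gt0 n1; rewrite -!natrB ?wcount_mono // ler_nat; exact: wcount_convex.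
Qed.

Lemma BernE n s : (1 < n)%N -> Bern k n s =
  \sum_(i < (Nn n).+1) 'C(Nn n, i)%:R * s ^+ i * (1 - s) ^+ (Nn n - i) * qw n i.
Proof.
move=> n1; rewrite /Bern mulr_suml; apply: eq_bigr => i _.
by rewrite /qw n1 mulrA.
Qed.

(** As [N] is about [n^2 / 2], the binomial mean at [s = y / sqrt n] is about [y / 2] times
    [n^(3/2)]. This is the origin of [y = 2 x], hence of the factor 1/2 in the theorem. *)
Lemma mean_ratio (y : R) :
  (Nn n)%:R * (y / Num.sqrt n%:R) / T32 n @[n --> \oo] --> y / 2.
Proof.
have : y / 2 - y / 2 / n%:R @[n --> \oo] --> y / 2 - 0.
  by apply: cvgB; [exact: cvg_cst|exact: cvg_divn].
rewrite subr0; apply: cvg_trans; apply: near_eq_cvg; near=> n.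
have n0 : (0 < n)%N by near: n; exact: nbhs_infty_gt.
have nR : 0 < n%:R :> R by rewrite ltr0n.
have s0 : 0 < Num.sqrt n%:R :> R by rewrite sqrtr_gt0.
have s2 : Num.sqrt n%:R ^+ 2 = n%:R :> R by rewrite sqr_sqrtr // ltW.
have NE : (Nn n)%:R = n%:R * (n%:R - 1) / 2 :> R.
  apply: (mulIf (_ : 2 != 0 :> R)) => //; rewrite divfK // /Nn -natrM.
  by rewrite -/(Nn n) Nn2 natrM -subn1 natrB.
rewrite NE /T32.
set c := Num.sqrt _ in s0 s2 *; have c0 : c != 0 by rewrite gt_eqF.
have nn : n%:R != 0 :> R by rewrite gt_eqF.
have -> : n%:R * (n%:R - 1) / 2 * (y / c) / (n%:R * c) = n%:R * (n%:R - 1) / 2 * y / (n%:R * c ^+ 2).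
  by field; rewrite nn c0.
by rewrite s2; field.
Unshelve. all: by end_near. Qed.

Lemma sqrtn_cvgy : Num.sqrt n%:R @[n --> \oo] --> (+oo : set_system R).
Proof.
apply/cvgryPge => A; near=> n.
have [A0|A0] := leP A 0; first exact: le_trans (sqrtr_ge0 _).
rewrite -[leLHS](ger0_norm (ltW A0)) -sqrtr_sqr ler_sqrt //.
by near: n; apply: nbhs_infty_ger.
Unshelve. all: by end_near. Qed.

(** The variance is at most of the order of the mean, [n^(3/2)], while the squared distance has the
    order of its square. *)
Lemma error_cvg0 (x y : R) : 0 <= x -> x != y / 2 ->
  let c n := (Nn n)%:R * (y / Num.sqrt n%:R) in
  c n / (c n - (Num.trunc (x * T32 n))%:R) ^+ 2 @[n --> \oo] --> (0 : R).
Proof.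
move=> x0 xy c.
pose D n := (Num.trunc (x * T32 n))%:R : R.
have d0 : (y / 2 - x) ^+ 2 != 0 by rewrite expf_neq0 // subr_eq0 eq_sym.
have h1 := @mean_ratio y; have h2 := trunc_ratio_cvg T32_cvgy x0.
have : c n / T32 n / (c n / T32 n - D n / T32 n) ^+ 2 * (T32 n)^-1 @[n --> \oo] -->
   y / 2 / (y / 2 - x) ^+ 2 * 0.
  apply: cvgM; last by apply/gtr0_cvgV0; [exact: (cvgry_gt T32_cvgy)|exact: T32_cvgy].
  apply: cvgM => //; apply: cvgV => //.
  rewrite expr2; under eq_fun do rewrite expr2.
  by apply: cvgM; apply: cvgB.
have hD : c n / T32 n - D n / T32 n @[n --> \oo] --> y / 2 - x by exact: cvgB.
rewrite mulr0; apply: cvg_trans; apply: near_eq_cvg; near=> n.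
have T0 : 0 < T32 n by near: n; exact: (cvgry_gt T32_cvgy).
have cD : c n / T32 n - D n / T32 n != 0.
  near: n; have := cvgr_neq0 _ hD; apply; by rewrite subr_eq0 eq_sym.
rewrite -/(D n) -mulrBl in cD *.
have cD' : c n - D n != 0 by apply: contra cD => /eqP ->; rewrite mul0r.
by field; rewrite cD' gt_eqF.
Unshelve. all: by end_near. Qed.

(** The binomial means for [2 x - h] and [2 x + h] eventually lie on either side of the truncated
    [x n^(3/2)], so the two Bernstein sums enclose [qw] up to a vanishing error; continuity of
    [Sdet] makes the enclosure narrow. *)
Lemma qw_cvg (x : R) : 0 < x ->
  qw n (Num.trunc (x * T32 n)) @[n --> \oo] --> Sdet k (2 * x).
Proof.
move=> x0; apply/cvgrPdist_lt => e e0.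
have [dS _] := @is_derive_S0 R k (2 * x).
have /cvgrPdist_lt /(_ (e / 2)) := differentiable_continuous ((derivable1_diffP _ _).1 dS).
rewrite divr_gt0 // => /(_ isT) /nbhs_ballP[r /= r0 hr].
pose h := Num.min (r / 2) x.
have h0 : 0 < h by rewrite lt_min divr_gt0.
have hr2 : h < r by rewrite gt_min; apply/orP; left; lra.
have hx : h <= x by rewrite ge_min lexx orbT.
have a1 : `|Sdet k (2 * x) - Sdet k (2 * x - h)| < e / 2.
  by apply: hr; rewrite /ball /= opprB addrC subrK gtr0_norm.
have a2 : `|Sdet k (2 * x) - Sdet k (2 * x + h)| < e / 2.
  by apply: hr; rewrite /ball /= opprD addrA subrr sub0r normrN gtr0_norm.
have y1 : 0 <= 2 * x - h by lra.
have y2 : 0 <= 2 * x + h by lra.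
have ne1 : x != (2 * x - h) / 2 by rewrite gt_eqF //; lra.
have ne2 : x != (2 * x + h) / 2 by rewrite lt_eqF //; lra.
have e1 := error_cvg0 (ltW x0) ne1; have e2 := error_cvg0 (ltW x0) ne2.
have b1 := Bern_cvg k0 y1; have b2 := Bern_cvg k0 y2.
pose E1 n := Bern k n ((2 * x - h) / Num.sqrt n%:R) + (Nn n)%:R * ((2 * x - h) / Num.sqrt n%:R) /
    ((Nn n)%:R * ((2 * x - h) / Num.sqrt n%:R) - (Num.trunc (x * T32 n))%:R) ^+ 2.
pose E2 n := Bern k n ((2 * x + h) / Num.sqrt n%:R) - (Nn n)%:R * ((2 * x + h) / Num.sqrt n%:R) /
    ((Nn n)%:R * ((2 * x + h) / Num.sqrt n%:R) - (Num.trunc (x * T32 n))%:R) ^+ 2.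
have g1 : E1 n @[n --> \oo] --> Sdet k (2 * x - h) + 0 by exact: cvgD.
have g2 : E2 n @[n --> \oo] --> Sdet k (2 * x + h) - 0 by exact: cvgB.
rewrite addr0 in g1; rewrite subr0 in g2.
near=> n.
have n1 : (1 < n)%N by near: n; exact: nbhs_infty_gt.
have T0 : 0 < T32 n by near: n; exact: (cvgry_gt T32_cvgy).
have sr (y : R) : 0 <= y -> y <= Num.sqrt n%:R -> 0 <= y / Num.sqrt n%:R <= 1.
  move=> yy ys; rewrite divr_ge0 ?sqrtr_ge0 //= ler_pdivrMr ?mul1r //.
  by rewrite sqrtr_gt0 ltr0n ltnW.
have s1 : 0 <= (2 * x - h) / Num.sqrt n%:R <= 1.
  by apply: sr => //; near: n; exact: (cvgry_ge sqrtn_cvgy).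
have s2 : 0 <= (2 * x + h) / Num.sqrt n%:R <= 1.
  by apply: sr => //; near: n; exact: (cvgry_ge sqrtn_cvgy).
have lt1 : (Nn n)%:R * ((2 * x - h) / Num.sqrt n%:R) < (Num.trunc (x * T32 n))%:R.
  suff : 0 < (Num.trunc (x * T32 n))%:R / T32 n - (Nn n)%:R * ((2 * x - h) / Num.sqrt n%:R) / T32 n.
    by rewrite -mulrBl pmulr_lgt0 ?invr_gt0 // subr_gt0.
  near: n; apply: (cvgr_gt (x - (2 * x - h) / 2)); last by lra.
  by apply: cvgB; [exact: (trunc_ratio_cvg T32_cvgy (ltW x0))|exact: mean_ratio].
have lt2 : (Num.trunc (x * T32 n))%:R < (Nn n)%:R * ((2 * x + h) / Num.sqrt n%:R).
  suff : 0 < (Nn n)%:R * ((2 * x + h) / Num.sqrt n%:R) / T32 n - (Num.trunc (x * T32 n))%:R / T32 n.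
    by rewrite -mulrBl pmulr_lgt0 ?invr_gt0 // subr_gt0.
  near: n; apply: (cvgr_gt ((2 * x + h) / 2 - x)); last by lra.
  by apply: cvgB; [exact: mean_ratio|exact: (trunc_ratio_cvg T32_cvgy (ltW x0))].
have u1 := bernstein_lb s1 (qw_mono n) (qw01 n) lt1.
have u2 := bernstein_ub s2 (qw_mono n) (qw01 n) lt2.
rewrite -BernE // in u1; rewrite -BernE // in u2.
have v1 : E1 n < Sdet k (2 * x - h) + e / 2.
  by near: n; apply: (cvgr_lt _ g1); rewrite ltrDl divr_gt0.
have v2 : Sdet k (2 * x + h) - e / 2 < E2 n.
  by near: n; apply: (cvgr_gt _ g2); rewrite gtrBl divr_gt0.
rewrite lerBlDr in u1; rewrite -lerBlDr in u2.
have w1 := le_lt_trans u1 v1; have w2 := lt_le_trans v2 u2.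
exact: (dist_sandwich a1 a2 w1 w2).
Unshelve. all: by end_near. Qed.

(** The spacing is an integer, so comparing it with [x n^(3/2)] is comparing it with the
    truncation. *)
Lemma Sp_cdf_trunc a (x : R) n : (1 < n)%N -> 0 <= x ->
  (Num.trunc (x * T32 n) < 2 * Nn n)%N ->
  Sp_cdf k a x n = 1 - (qw n (Num.trunc (x * T32 n)) + (Num.trunc (x * T32 n))%:R *
    (qw n (Num.trunc (x * T32 n)) - qw n (Num.trunc (x * T32 n)).+1)).
Proof.
move=> n1 x0; set D := Num.trunc _ => DN; have N0 := Nn_gt0 n1.
have nR : 0 < n%:R :> R by rewrite ltr0n ltnW.
have T0 : 0 < T32 n by rewrite mulr_gt0 // sqrtr_gt0.
have O0 : 0 < #|Omega n|%:R :> R by rewrite ltr0n card_Omega_gt0.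
have inD s : (s \in [set s | (Sp k a s <= D%:Z)%R]%SET) = (Sp k a s <= D%:Z)%R.
  by rewrite finset.in_set.
have cE : #|[set s in Omega n | ((Sp k a s)%:~R / (n%:R `^ (3 / 2 : R)) <= x)%R]%SET| =
   (#|Omega n| - #|[set s in Omega n | ~~ (Sp k a s <= D%:Z)%R]%SET|)%N.
  rewrite -[in RHS](cardsID [set s | (Sp k a s <= D%:Z)%R]%SET (Omega n)).
  rewrite [X in (_ + X - _)%N](_ : _ = #|[set s in Omega n | ~~ (Sp k a s <= D%:Z)%R]%SET|).
    rewrite addnK; apply: eq_card => s; rewrite in_sep finset.in_setI inD.
    congr (_ && _); rewrite T32E ler_pdivrMr // -floor_ge_int.
    by rewrite /D truncn_floor mulr_ge0 ?(ltW T0) //= gez0_abs // floor_ge0 mulr_ge0 // ltW.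
  by apply: eq_card => s; rewrite in_sep finset.in_setD inD andbC.
rewrite /Sp_cdf cE card_Sp_gt //.
have le : (wcount n k D + D * (wcount n k D - wcount n k D.+1) <= #|Omega n|)%N.
  rewrite -(@card_Sp_gt n k N0 a D DN); apply: subset_leq_card.
  by apply/fintype.subsetP => s; rewrite in_sep => /andP[].
rewrite natrB // mulrBl divff ?gt_eqF //; congr (1 - _).
rewrite natrD natrM natrB ?wcount_mono // /qw n1; field; exact: lt0r_neq0.
Qed.

(** The search range [2 N = n (n - 1)] outgrows every multiple of [n^(3/2)]. *)
Lemma trunc_lt_2Nn (x : R) : 0 <= x -> \forall n \near \oo, (Num.trunc (x * T32 n) < 2 * Nn n)%N.
Proof.
move=> x0; near=> n.
have n1 : (1 < n)%N by near: n; exact: nbhs_infty_gt.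
have nR : 0 < n%:R :> R by rewrite ltr0n ltnW.
have s0 : 0 < Num.sqrt n%:R :> R by rewrite sqrtr_gt0.
have s2 : Num.sqrt n%:R ^+ 2 = n%:R :> R by rewrite sqr_sqrtr // ltW.
have xs : 2 * x + 2 < Num.sqrt n%:R by near: n; exact: (cvgry_gt sqrtn_cvgy).
have -> : (2 * Nn n = n * n.-1)%N.
  by rewrite mulnC Nn2.
rewrite ltnNge truncn_ge_nat; last by rewrite mulr_ge0 // mulr_ge0 // ltW.
rewrite -ltNge natrM /T32 mulrCA ltr_pM2l // -subn1 natrB ?(ltnW n1) //.
by nra.
Unshelve. all: by end_near. Qed.

Theorem Sp_cdf_cvg a (x : R) : 0 < x ->
  Sp_cdf k a x n @[n --> \oo] --> 1 - Sdet k (2 * x) + 2 * x * S1 k (2 * x).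
Proof.
move=> x0.
have dF : is_derive x 1 (fun z => Sdet k (2 * z)) (S1 k (2 * x) * 2).
  apply: (@is_derive1_comp _ (Sdet k)); first exact: is_derive_S0.
  by apply: (is_derive_eq (is_deriveZ (2 : R) (is_derive_id x 1))); rewrite /GRing.scale /= mulr1.
have h1 := qw_cvg x0.
have h2 := convex_slope_cvg qw_convex T32_cvgy qw_cvg x0 dF.
have : 1 - (qw n (Num.trunc (x * T32 n)) + (Num.trunc (x * T32 n))%:R *
    (qw n (Num.trunc (x * T32 n)) - qw n (Num.trunc (x * T32 n)).+1)) @[n --> \oo] -->
   1 - (Sdet k (2 * x) + - (x * (S1 k (2 * x) * 2))).
  by apply: cvgB; [exact: cvg_cst|exact: cvgD].
have -> : 1 - (Sdet k (2 * x) + - (x * (S1 k (2 * x) * 2))) =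
   1 - Sdet k (2 * x) + 2 * x * S1 k (2 * x) by ring.
apply: cvg_trans; apply: near_eq_cvg; near=> n.
rewrite Sp_cdf_trunc ?(ltW x0) //.
  by near: n; exact: nbhs_infty_gt.
by near: n; apply: trunc_lt_2Nn; exact: ltW.
Unshelve. all: by end_near. Qed.

(** At [x = 0] the formula gives [1 - qw n 0], which is 0; monotonicity in [x] does the rest. *)
Lemma Sp_cdf_le0 a (x : R) n : x <= 0 -> (1 < n)%N -> Sp_cdf k a x n = 0.
Proof.
move=> x0 n1; have N0 := Nn_gt0 n1.
have := @Sp_cdf_trunc a 0 n n1 (lexx 0); rewrite mul0r truncn0 mul0r addr0 => h.
have nR : 0 < n%:R :> R by rewrite ltr0n ltnW.
have T0 : 0 < T32 n by rewrite mulr_gt0 // sqrtr_gt0.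
have O0 : 0 < #|Omega n|%:R :> R by rewrite ltr0n card_Omega_gt0.
have z : Sp_cdf k a (0 : R) n = 0.
  by rewrite h ?muln_gt0 // /qw n1 wcount0 divff ?gt_eqF // subrr.
apply/eqP; rewrite eq_le; apply/andP; split; last by rewrite divr_ge0.
rewrite -[leRHS]z /Sp_cdf ler_pM2r ?invr_gt0 // ler_nat; apply: subset_leq_card.
by apply/fintype.subsetP => s; rewrite !in_sep => /andP[-> /le_trans]; apply.
Qed.

Lemma Sp_cdf_mono a (x y : R) n : x <= y -> Sp_cdf k a x n <= Sp_cdf k a y n.
Proof.
move=> xy; rewrite /Sp_cdf ler_wpM2r ?invr_ge0 // ler_nat; apply: subset_leq_card.
by apply/fintype.subsetP => s; rewrite !in_sep => /andP[-> /le_trans]; apply.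
Qed.

End SpacingLimit.

(* [p j] plays the role of the [j]-th power sum, [D j] of the derivation
   [2 \sum_i x_i^(j + 1) d/dx_i]; the last clause determines [E] on products of
   the [p j] by recursion on the total degree. *)
Definition loop_system (R : realFieldType) (c : R) (A : comAlgType R)
    (E : A -> R) (p : nat -> A) (D : nat -> A -> A) : Prop :=
  [/\ forall a x y, E (a *: x + y) = a * E x + E y,
      E 1 = 1,
      p 0%N = c%:A,
      forall j, (forall x y, D j (x * y) = D j x * y + x * D j y) /\
                (forall i, D j (p i) = (2 * i)%:R *: p (i + j)%N) &
      forall j F, E (p j.+1 * F) =
        2^-1 * E ((\sum_(a < j.+1) p a * p (j - a)%N - p j) * F) + E (D j F)].

(** * Uniqueness for the loop equations *)

Section LoopUnique.
Variables (R : realFieldType) (c : R).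

Lemma loop_derivation_prod (A : comAlgType R) (E : A -> R) p D j (s : seq nat) :
  loop_system c E p D ->
  D j (\prod_(i <- s) p i) =
  \sum_(i < size s) (2 * nth 0%N s i)%:R *:
     \prod_(r <- set_nth 0%N s i (nth 0%N s i + j)%N) p r.
Proof.
case=> _ _ _ /(_ j)[DM Dp] _.
elim: s => [|x s IH].
  rewrite big_ord0 big_nil.
  have := DM 1 1; rewrite mul1r mulr1 mul1r => /eqP.
  by rewrite -subr_eq0 opprD addrA subrr add0r oppr_eq0 => /eqP.
rewrite big_cons DM Dp IH /= big_ord_recl /= big_cons -scalerAl; congr (_ + _).
rewrite mulr_sumr; apply: eq_bigr => i _.
by rewrite /= big_cons -scalerAr.
Qed.

Lemma sumn_set_nth_add (s : seq nat) i j : (i < size s)%N ->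
  sumn (set_nth 0%N s i (nth 0%N s i + j)%N) = (sumn s + j)%N.
Proof.
elim: s i => // x s IH [|i] /=; first by move=> _; lia.
by rewrite ltnS => /IH ->; lia.
Qed.

Lemma loop_systemZ (A : comAlgType R) (E : A -> R) p D a x :
  loop_system c E p D -> E (a *: x) = a * E x.
Proof.
case=> lin _ _ _ _; have E0 : E 0 = 0.
  have := lin 1 0 0; rewrite scale1r addr0 mul1r => /eqP.
  by rewrite -subr_eq0 opprD addrA subrr add0r oppr_eq0 => /eqP.
by rewrite -[_ *: _]addr0 lin E0 addr0.
Qed.

Lemma loop_systemD (A : comAlgType R) (E : A -> R) p D x y :
  loop_system c E p D -> E (x + y) = E x + E y.
Proof. by case=> lin _ _ _ _; rewrite -[x]scale1r lin mul1r scale1r. Qed.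

Lemma loop_system_sum (A : comAlgType R) (E : A -> R) p D I (r : seq I) F :
  loop_system c E p D -> E (\sum_(i <- r) F i) = \sum_(i <- r) E (F i).
Proof.
move=> L; elim: r => [|x r IH].
  by rewrite !big_nil -[0](scale0r (1 : A)) (loop_systemZ _ _ L) mul0r.
by rewrite !big_cons (loop_systemD _ _ L) IH.
Qed.

(** The loop equation lowers the total degree by one. Factors [p 0] are scalars and leave the degree
    unchanged, so an inner induction on the length removes them. *)
Lemma loop_unique (A1 A2 : comAlgType R) (E1 : A1 -> R) (E2 : A2 -> R)
    p1 p2 D1 D2 (s : seq nat) :
  loop_system c E1 p1 D1 -> loop_system c E2 p2 D2 ->
  E1 (\prod_(i <- s) p1 i) = E2 (\prod_(i <- s) p2 i).
Proof.
move=> L1 L2.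
have [n] := ubnP (sumn s); elim: n s => // n IHn s.
elim: s => [|x s IHs] /=; first by case: L1 => _ e1 _ _ _; case: L2 => _ e2 _ _ _; rewrite !big_nil e1 e2.
case: x => [|j] lt.
  rewrite !big_cons; case: (L1) => _ _ -> _ _; case: (L2) => _ _ -> _ _.
  by rewrite !mulr_algl (loop_systemZ _ _ L1) (loop_systemZ _ _ L2) IHs.
have step (A : comAlgType R) (E : A -> R) p D : loop_system c E p D ->
   E (\prod_(i <- j.+1 :: s) p i) =
   2^-1 * (\sum_(a < j.+1) E (\prod_(i <- [:: val a, (j - a)%N & s]) p i)
            - E (\prod_(i <- j :: s) p i))
   + \sum_(i < size s) (2 * nth 0%N s i)%:R *
       E (\prod_(r <- set_nth 0%N s i (nth 0%N s i + j)%N) p r).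
  move=> L; case: (L) => _ _ _ _ loop.
  rewrite big_cons loop (loop_derivation_prod j s L) (loop_system_sum _ _ L).
  congr (_ * _ + _); last by apply: eq_bigr => i _; rewrite (loop_systemZ _ _ L).
  rewrite mulrBl -[X in _ + X]scaleN1r addrC.
  case: (L) => lin _ _ _ _; rewrite lin mulN1r addrC; congr (_ - _).
    rewrite mulr_suml (loop_system_sum _ _ L); apply: eq_bigr => a _.
    by rewrite !big_cons mulrA.
  by rewrite big_cons.
rewrite (step _ _ _ _ L1) (step _ _ _ _ L2); congr (_ * (_ - _) + _).
- by apply: eq_bigr => a _; apply: IHn => /=; have := ltn_ord a; lia.
- by apply: IHn => /=; lia.
- apply: eq_bigr => i _; congr (_ * _); apply: IHn.
  by rewrite sumn_set_nth_add //; lia.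
Qed.

End LoopUnique.

(** * Loop equations for antisymmetric Gaussian matrices *)

Section MatrixLoop.
Variables (R : realFieldType) (A : comAlgType R) (l : nat).
Variables (X : 'I_l -> 'I_l -> A) (D : 'I_l -> 'I_l -> A -> A) (E : A -> R).
Hypothesis D_lin : forall a b t x y, D a b (t *: x + y) = t *: D a b x + D a b y.
Hypothesis D_mul : forall a b x y, D a b (x * y) = D a b x * y + x * D a b y.
Hypothesis D_X : forall a b c e, D a b (X c e) = ((a == c) && (b == e))%:R.
Hypothesis E_lin : forall t x y, E (t *: x + y) = t * E x + E y.
Hypothesis E_1 : E 1 = 1.
Hypothesis E_ibp : forall a b F, E (X a b * F) = E (D a b F).

Lemma E_add x y : E (x + y) = E x + E y.
Proof. by rewrite -[x]scale1r E_lin mul1r scale1r. Qed.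
Lemma E_0 : E 0 = 0.
Proof. by apply: (addIr (E 0)); rewrite -E_add !add0r. Qed.
Lemma E_scale t x : E (t *: x) = t * E x.
Proof. by rewrite -[_ *: _]addr0 E_lin E_0 addr0. Qed.
Lemma E_sum I (r : seq I) P (F : I -> A) :
  E (\sum_(i <- r | P i) F i) = \sum_(i <- r | P i) E (F i).
Proof. exact: (big_morph E E_add E_0). Qed.

Lemma D_add a b x y : D a b (x + y) = D a b x + D a b y.
Proof. by rewrite -[x]scale1r D_lin !scale1r. Qed.
Lemma D_0 a b : D a b 0 = 0.
Proof. by apply: (addIr (D a b 0)); rewrite -D_add !add0r. Qed.
Lemma D_scale a b t x : D a b (t *: x) = t *: D a b x.
Proof. by rewrite -[_ *: _]addr0 D_lin D_0 addr0. Qed.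
Lemma D_opp a b x : D a b (- x) = - D a b x.
Proof. by rewrite -scaleN1r D_scale scaleN1r. Qed.
Lemma D_sgn a b (r : nat) (x : A) : D a b ((-1) ^+ r * x) = (-1) ^+ r * D a b x.
Proof. by rewrite -signr_odd; case: (odd r); rewrite ?expr0 ?mul1r // !expr1 !mulN1r D_opp. Qed.
Lemma E_sgn (r : nat) (x : A) : E ((-1) ^+ r * x) = (-1) ^+ r * E x.
Proof.
rewrite -(signr_odd _ r) -(signr_odd R r); case: (odd r); rewrite ?expr0 ?mul1r //.
by rewrite !expr1 !mulN1r -scaleN1r E_scale mulN1r.
Qed.
Lemma D_sum a b I (r : seq I) P (F : I -> A) :
  D a b (\sum_(i <- r | P i) F i) = \sum_(i <- r | P i) D a b (F i).
Proof. exact: (big_morph _ (D_add a b) (D_0 a b)). Qed.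
Lemma D_1 a b : D a b 1 = 0.
Proof.
have := D_mul a b 1 1; rewrite mul1r mulr1 mul1r => /eqP.
by rewrite -subr_eq0 opprD addrA subrr add0r oppr_eq0 => /eqP.
Qed.

(** The aGUE matrix is ['i] times this one. The algebra stays real, and the powers of ['i] reappear
    as the signs in [trace_p] and [trace_D]. *)
Definition antisym_part : 'M[A]_l := \matrix_(a, b) (2^-1 *: (X a b - X b a)).
Local Notation M := antisym_part.

Lemma trM : M^T = - M.
Proof. by apply/matrixP => a b; rewrite !mxE -scalerN opprB. Qed.

Lemma trMX r : (M ^+ r)^T = (-1) ^+ r *: M ^+ r.
Proof.
elim: r => [|r IH]; first by rewrite !expr0 scale1r trmx1.
rewrite {1}exprS trmx_mul IH trM -scalemxAl mulmxN scalerN -scaleNr -mulN1r -exprS.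
by rewrite [in RHS](exprSr M).
Qed.

Lemma MX_swap r a b : (M ^+ r) a b = (-1) ^+ r * (M ^+ r) b a.
Proof. by have /matrixP/(_ b a) := trMX r; rewrite !mxE. Qed.

Definition trace_pow r : A := \tr (M ^+ r).
Local Notation t_ := trace_pow.

Lemma t_odd r : odd r -> t_ r = 0.
Proof.
move=> ro; have : t_ r = - t_ r.
  rewrite /t_ -[in LHS]mxtrace_tr trMX mxtraceZ.
  by rewrite -signr_odd ro expr1 mulN1r.
move/eqP; rewrite -subr_eq0 opprK -mulr2n -scaler_nat scaler_eq0 pnatr_eq0 /=.
by move/eqP.
Qed.

Lemma D_M a b : map_mx (D a b) M = 2^-1%:A *: (delta_mx a b - delta_mx b a).
Proof.
apply/matrixP => c e; rewrite !mxE D_scale mulr_algl; congr (_ *: _).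
rewrite D_add D_opp !D_X.
by rewrite ![_ == a]eq_sym ![_ == b]eq_sym [in X in _ - X]andbC.
Qed.

Lemma D_mulmx a b (B C : 'M[A]_l) :
  map_mx (D a b) (B *m C) = map_mx (D a b) B *m C + B *m map_mx (D a b) C.
Proof.
apply/matrixP => c e; rewrite !mxE D_sum -big_split /=.
by apply: eq_bigr => i _; rewrite !mxE D_mul.
Qed.

Lemma D_MX a b r : map_mx (D a b) (M ^+ r) =
  \sum_(s < r) M ^+ s *m map_mx (D a b) M *m M ^+ (r.-1 - s).
Proof.
elim: r => [|r IH].
  rewrite big_ord0 expr0; apply/matrixP => c e; rewrite !mxE.
  by case: (c == e); rewrite ?D_1 ?D_0.
rewrite exprS D_mulmx IH big_ord_recl /= expr0 mul1mx subn0; congr (_ + _).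
rewrite mulmx_sumr; apply: eq_bigr => s _.
rewrite !mulmxA; congr (_ *m _ *m _); last by congr (_ ^+ _); rewrite /bump /=; lia.
by rewrite /bump /= add1n exprS.
Qed.

Lemma delta_entry (B C : 'M[A]_l) a b c e :
  (B *m delta_mx a b *m C) c e = B c a * C b e.
Proof.
rewrite -mulmxA mxE (bigD1 a) //= big1 ?addr0; last first.
  move=> i ia; rewrite mxE big1 ?mulr0 // => j _.
  by rewrite mxE (negbTE ia) mul0r.
rewrite mxE (bigD1 b) //= big1 ?addr0 ?mxE ?eqxx ?mul1r //.
by move=> i ib; rewrite mxE (negbTE ib) andbF mul0r.
Qed.

Lemma D_MX_entry a b r c e : D a b ((M ^+ r) c e) =
  \sum_(s < r) 2^-1 *: ((M ^+ s) c a * (M ^+ (r.-1 - s)) b e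
                       - (M ^+ s) c b * (M ^+ (r.-1 - s)) a e).
Proof.
have /matrixP/(_ c e) := D_MX a b r; rewrite mxE => ->.
rewrite summxE; apply: eq_bigr => s _.
rewrite D_M -scalemxAr -scalemxAl mxE mulr_algl; congr (_ *: _).
rewrite mulmxBr mulmxBl; rewrite !mxE.
by congr (_ - _); rewrite -[RHS]delta_entry mxE.
Qed.

(* the divergence of the vector field [M ^+ (2 * j + 1)] *)
Lemma divergence j : \sum_a \sum_b D a b ((M ^+ (2 * j).+1) b a) =
  2^-1 *: (t_ (2 * j) - \sum_(s < (2 * j).+1) t_ s * t_ (2 * j - s)).
Proof.
under eq_bigr do under eq_bigr do rewrite D_MX_entry /=.
under eq_bigr do rewrite exchange_big /=.
rewrite exchange_big /=.
have -> : t_ (2 * j) = \sum_(s < (2 * j).+1) (-1) ^+ s * t_ (2 * j).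
  rewrite -mulr_suml (_ : \sum_(s < _) _ = 1) ?mul1r //.
  elim: j => [|j IH]; first by rewrite muln0 big_ord1 expr0.
  rewrite (_ : (2 * j.+1).+1 = (2 * j).+3); last by lia.
  rewrite 2!big_ord_recr /= IH mul2n exprS -signr_odd odd_double expr0 mulr1.
  by rewrite subrr add0r -signr_odd /= negbK odd_double expr0.
rewrite -sumrB scaler_sumr; apply: eq_bigr => s _.
under eq_bigr do under eq_bigr do rewrite scalerBr.
under eq_bigr do rewrite sumrB.
rewrite sumrB scalerBr; congr (_ - _).
  have -> : (-1) ^+ s * t_ (2 * j) = \sum_a \sum_b (M ^+ s) b a * (M ^+ (2 * j - s)) b a.
    have e : (2 * j = s + (2 * j - s))%N by have := ltn_ord s; lia.
    rewrite /t_ [X in M ^+ X]e exprD /mxtrace mulr_sumr; apply: eq_bigr => a _.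
    rewrite mxE mulr_sumr; apply: eq_bigr => b _.
    by rewrite (MX_swap s a b) mulrA mulrA -expr2 sqrr_sign mul1r.
  by rewrite scaler_sumr; apply: eq_bigr => a _; rewrite scaler_sumr.
rewrite /t_ /mxtrace mulr_suml exchange_big /= scaler_sumr; apply: eq_bigr => b _.
by rewrite mulr_sumr scaler_sumr.
Qed.

(** Under the trace all [2 i] terms of the Leibniz sum become equal, and antisymmetry of the odd
    power merges the two halves of the derivative of [M], absorbing the factor 1/2. *)
Lemma D_trace a b i : D a b (t_ (2 * i)) = (2 * i)%:R *: (M ^+ (2 * i).-1) b a.
Proof.
rewrite /t_ /mxtrace D_sum.
under eq_bigr do rewrite D_MX_entry.
rewrite exchange_big /=.
have step (s : 'I_(2 * i)) : \sum_c 2^-1 *: ((M ^+ s) c a * (M ^+ ((2 * i).-1 - s)) b c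
      - (M ^+ s) c b * (M ^+ ((2 * i).-1 - s)) a c) = (M ^+ (2 * i).-1) b a.
  rewrite -scaler_sumr sumrB.
  have mm x y : \sum_c (M ^+ s) c x * (M ^+ ((2 * i).-1 - s)) y c = (M ^+ (2 * i).-1) y x.
    rewrite -[in RHS](@subnK s (2 * i).-1); last by have := ltn_ord s; lia.
    by rewrite exprD mxE; apply: eq_bigr => c _; rewrite mulrC.
  rewrite !mm (MX_swap _ a b) -signr_odd.
  have -> : odd (2 * i).-1 by have := ltn_ord s; lia.
  rewrite expr1 mulN1r opprK -mulr2n -[X in _ *: X]scaler_nat scalerA mulVf ?scale1r // pnatr_eq0.
rewrite (eq_bigr _ (fun s _ => step s)) sumr_const card_ord.
by rewrite scaler_nat.
Qed.

Definition trace_p j : A := (-1) ^+ j * t_ (2 * j).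
Definition trace_D j (F : A) : A :=
  (-1) ^+ j.+1 * \sum_a \sum_b (M ^+ (2 * j).+1) b a * D a b F.

(** One factor [M] is written out so that integration by parts can act on it; its two halves
    contribute equally because the odd power is antisymmetric. *)
Lemma trace_pM j : t_ (2 * j).+2 = \sum_a \sum_b X a b * (M ^+ (2 * j).+1) b a.
Proof.
have e : \sum_a \sum_b X b a * (M ^+ (2 * j).+1) b a
       = - \sum_a \sum_b X a b * (M ^+ (2 * j).+1) b a.
  rewrite exchange_big /= -sumrN; apply: eq_bigr => b _.
  rewrite -sumrN; apply: eq_bigr => a _; rewrite MX_swap.
  by rewrite -signr_odd /= mul2n odd_double expr1 mulN1r mulrN.
rewrite /t_ exprS /mxtrace.
transitivity (\sum_a \sum_b 2^-1 *: (X a b * (M ^+ (2 * j).+1) b a)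
     - \sum_a \sum_b 2^-1 *: (X b a * (M ^+ (2 * j).+1) b a)).
  rewrite -sumrB; apply: eq_bigr => a _; rewrite -sumrB mxE; apply: eq_bigr => b _.
  by rewrite mxE -scalerBr -mulrBl -scalerAl.
under eq_bigr do rewrite -scaler_sumr.
under [X in _ - X]eq_bigr do rewrite -scaler_sumr.
rewrite -!scaler_sumr e -scalerBr opprK.
by rewrite -mulr2n -[X in _ *: X]scaler_nat scalerA mulVf ?scale1r // pnatr_eq0.
Qed.

Lemma trace_D_mul j x y : trace_D j (x * y) = trace_D j x * y + x * trace_D j y.
Proof.
    rewrite /trace_D (mulrC x (_ * _)) -2!(mulrA ((-1) ^+ j.+1)) -mulrDr; congr (_ * _).
    rewrite !mulr_suml -big_split /=; apply: eq_bigr => a _.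
    rewrite !mulr_suml -big_split /=; apply: eq_bigr => b _.
    by rewrite D_mul mulrDr mulrA -[in RHS](mulrA _ _ x) (mulrC (D a b y)).
Qed.

Lemma trace_D_p j i : trace_D j (trace_p i) = (2 * i)%:R *: trace_p (i + j)%N.
Proof.
  rewrite /trace_D /trace_p.
  under eq_bigr do under eq_bigr do rewrite D_sgn D_trace mulrCA -scalerAr.
  under eq_bigr do rewrite -mulr_sumr -scaler_sumr.
  rewrite -mulr_sumr -scaler_sumr mulrA -exprD addSn [(j + i)%N]addnC -scalerAr.
  case: i => [|i]; first by rewrite muln0 !scale0r.
  congr (_ *: _); rewrite [in RHS]/t_ (_ : (2 * (i.+1 + j) = (2 * i.+1).-1 + (2 * j).+1)%N); last by lia.
  rewrite (exprS (-1)) mulN1r mulNr -mulrN; congr (_ * _); rewrite exprD /mxtrace.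
  rewrite -sumrN; apply: eq_bigr => a _; rewrite mxE -sumrN; apply: eq_bigr => b _.
  rewrite (MX_swap (2 * i.+1).-1 b a) -signr_odd.
  have -> : odd (2 * i.+1).-1 by rewrite mulnS /= mul2n odd_double.
  by rewrite expr1 mulN1r mulrN opprK mulrC.
Qed.

(** Integration by parts against the field given by the odd power of [M]: its divergence yields the
    quadratic term, in which odd traces drop out, and the derivative of [F] along it is
    [trace_D]. *)
Lemma trace_loop j F : E (trace_p j.+1 * F) =
  2^-1 * E ((\sum_(a < j.+1) trace_p a * trace_p (j - a)%N - trace_p j) * F)
  + E (trace_D j F).
Proof.
  have -> : trace_p j.+1 * F = (-1) ^+ j.+1 *
     \sum_a \sum_b X a b * ((M ^+ (2 * j).+1) b a * F).
    rewrite /trace_p mulnS trace_pM -mulrA; congr (_ * _).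
    rewrite mulr_suml; apply: eq_bigr => a _; rewrite mulr_suml.
    by apply: eq_bigr => b _; rewrite mulrA.
  rewrite E_sgn /trace_D E_sgn.
  have -> : E (\sum_a \sum_b X a b * ((M ^+ (2 * j).+1) b a * F)) =
     E (2^-1 *: (t_ (2 * j) - \sum_(s < (2 * j).+1) t_ s * t_ (2 * j - s)) * F)
     + E (\sum_a \sum_b (M ^+ (2 * j).+1) b a * D a b F).
    rewrite -E_add -divergence mulr_suml -big_split /= !E_sum.
    apply: eq_bigr => a _; rewrite mulr_suml -big_split /= !E_sum.
    by apply: eq_bigr => b _; rewrite E_ibp D_mul.
  rewrite mulrDr; congr (_ + _).
  rewrite -scalerAl E_scale mulrCA; congr (_ * _).
  rewrite -E_sgn mulrA; congr (E (_ * _)).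
  rewrite mulrBr /trace_p exprS !mulN1r !mulNr opprK addrC; congr (_ - _).
  have -> : \sum_(s < (2 * j).+1) t_ s * t_ (2 * j - s) =
            \sum_(a < j.+1) t_ (2 * a) * t_ (2 * (j - a)).
    rewrite -(big_mkord xpredT (fun s => t_ s * t_ (2 * j - s)%N)).
    rewrite -(big_mkord xpredT (fun a => t_ (2 * a)%N * t_ (2 * (j - a))%N)).
    have gen m (G : nat -> A) : (forall s, odd s -> G s = 0) ->
        \sum_(0 <= s < (2 * m).+1) G s = \sum_(0 <= a < m.+1) G (2 * a)%N.
      move=> G0; elim: m => [|m IH]; first by rewrite muln0 !big_nat1.
      rewrite [RHS]big_nat_recr //= -IH (_ : (2 * m.+1).+1 = (2 * m).+3); last by lia.
      rewrite big_nat_recr //= big_nat_recr //= G0 ?addr0; last by rewrite mul2n /= odd_double.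
      by congr (_ + G _); lia.
    rewrite gen => [|s so]; last by rewrite t_odd // mul0r.
    by apply: eq_bigr => a _; rewrite mulnBr.
  rewrite mulr_sumr; apply: eq_bigr => a _.
  rewrite mulrACA -exprD subnKC //; have := ltn_ord a; lia.
Qed.

Lemma matrix_loop_system : loop_system l%:R E trace_p trace_D.
Proof.
split=> //; last exact: trace_loop.
  by rewrite /trace_p /trace_pow muln0 !expr0 mul1r mxtrace1 -scaler_nat.
by move=> j; split; [exact: trace_D_mul|exact: trace_D_p].
Qed.

End MatrixLoop.

(** * Loop equations for the Vandermonde weight *)

Section DiagonalLoop.
Variables (R : realFieldType) (A : comAlgType R) (k : nat).
Variables (u : 'I_k -> A) (D : 'I_k -> A -> A) (E : A -> R).
Hypothesis D_lin : forall a t x y, D a (t *: x + y) = t *: D a x + D a y.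
Hypothesis D_mul : forall a x y, D a (x * y) = D a x * y + x * D a y.
Hypothesis D_u : forall a b, D a (u b) = (a == b)%:R.
Hypothesis E_lin : forall t x y, E (t *: x + y) = t * E x + E y.
Hypothesis E_ibp : forall a F, E (u a * F) = E (D a F).

Definition vdm2 : A := \prod_(i < k) \prod_(l < k | (i < l)%N) (u i ^+ 2 - u l ^+ 2).
Local Notation V := vdm2.
Hypothesis EV_neq0 : E (V ^+ 2) != 0.

(* Each [u i ^+ 2 / 2] stands for a pair of opposite eigenvalues, whence the
   factor [2] in [diag_p]. *)
Definition diag_E (F : A) : R := E (V ^+ 2 * F) / E (V ^+ 2).
Definition diag_p j : A := (2 / 2 ^+ j) *: \sum_i u i ^+ (2 * j).
Definition diag_D j (F : A) : A := (2 ^- j) *: \sum_i u i ^+ (2 * j).+1 * D i F.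

Lemma diag_E_add x y : E (x + y) = E x + E y.
Proof. by rewrite -[x]scale1r E_lin mul1r scale1r. Qed.
Lemma diag_E_0 : E 0 = 0.
Proof. by apply: (addIr (E 0)); rewrite -diag_E_add !add0r. Qed.
Lemma diag_E_scale t x : E (t *: x) = t * E x.
Proof. by rewrite -[_ *: _]addr0 E_lin diag_E_0 addr0. Qed.
Lemma diag_E_sum I (r : seq I) P (F : I -> A) :
  E (\sum_(i <- r | P i) F i) = \sum_(i <- r | P i) E (F i).
Proof. exact: (big_morph E diag_E_add diag_E_0). Qed.

Lemma diag_D_mul j x y : diag_D j (x * y) = diag_D j x * y + x * diag_D j y.
Proof.
rewrite /diag_D -scalerAl -scalerAr -scalerDr; congr (_ *: _).
rewrite mulr_suml mulr_sumr -big_split /=; apply: eq_bigr => i _.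
by rewrite D_mul mulrDr mulrA [x * (_ * _)]mulrCA.
Qed.

Lemma diag_D_add j x y : diag_D j (x + y) = diag_D j x + diag_D j y.
Proof.
rewrite /diag_D -scalerDr -big_split /=; congr (_ *: _); apply: eq_bigr => i _.
by rewrite -[x]scale1r D_lin !scale1r mulrDr.
Qed.

Lemma diag_D_0 j : diag_D j 0 = 0.
Proof. by apply: (addIr (diag_D j 0)); rewrite -diag_D_add !add0r. Qed.

Lemma diag_D_scale j t x : diag_D j (t *: x) = t *: diag_D j x.
Proof.
rewrite /diag_D [RHS]scalerA mulrC -scalerA; congr (_ *: _); rewrite scaler_sumr; apply: eq_bigr => i _.
have D0 : D i 0 = 0.
  by apply: (addIr (D i 0)); have := D_lin i 1 0 0; rewrite !scale1r addr0 add0r.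
by rewrite -[t *: x]addr0 D_lin D0 addr0 scalerAr.
Qed.

Lemma diag_D_opp j x : diag_D j (- x) = - diag_D j x.
Proof. by rewrite -scaleN1r diag_D_scale scaleN1r. Qed.

Lemma diag_D_1 j : diag_D j 1 = 0.
Proof.
have := diag_D_mul j 1 1; rewrite mul1r mulr1 mul1r => /eqP.
by rewrite -subr_eq0 opprD addrA subrr add0r oppr_eq0 => /eqP.
Qed.

Lemma diag_D_u j i : diag_D j (u i) = 2 ^- j *: u i ^+ (2 * j).+1.
Proof.
congr (_ *: _); rewrite (bigD1 i) //= D_u eqxx mulr1 big1 ?addr0 // => l li.
by rewrite D_u (negbTE li) mulr0.
Qed.

Lemma diag_D_exp j x n : diag_D j (x ^+ n.+1) = n.+1%:R *: (x ^+ n * diag_D j x).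
Proof.
elim: n => [|n IH]; first by rewrite expr1 expr0 mul1r scale1r.
rewrite exprS diag_D_mul IH -scalerAr [x * _]mulrA -exprS mulrC.
by rewrite -[in RHS]natr1 addrC scalerDl scale1r.
Qed.

Lemma diag_D_uX j i n : diag_D j (u i ^+ n) = (n%:R / 2 ^+ j) *: u i ^+ (n + 2 * j).
Proof.
case: n => [|n]; first by rewrite expr0 diag_D_1 mul0r scale0r.
by rewrite diag_D_exp diag_D_u -scalerAr -exprD scalerA addnS addSn.
Qed.

Lemma diag_D_p j i : diag_D j (diag_p i) = (2 * i)%:R *: diag_p (i + j)%N.
Proof.
rewrite /diag_p diag_D_scale (big_morph _ (diag_D_add j) (diag_D_0 j)) scalerA.
rewrite !scaler_sumr; apply: eq_bigr => l _.
rewrite diag_D_uX scalerA -mulnDr; congr (_ *: _).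
have h2 n : (2 : R) ^+ n != 0 by rewrite expf_neq0 // pnatr_eq0.
by rewrite exprD; field; rewrite !h2.
Qed.

(** Logarithmic differentiation without division: each factor divides its own derivative. *)
Lemma derivation_prod_log (d : A -> A) I (r : seq I) (P : pred I) (f w : I -> A) :
  (forall x y, d (x * y) = d x * y + x * d y) ->
  (forall i, P i -> d (f i) = f i * w i) ->
  d (\prod_(i <- r | P i) f i) =
  (\prod_(i <- r | P i) f i) * \sum_(i <- r | P i) w i.
Proof.
move=> dM df; elim: r => [|i r IH].
  rewrite !big_nil mulr0; have := dM 1 1; rewrite mul1r mulr1 mul1r => /eqP.
  by rewrite -subr_eq0 opprD addrA subrr add0r oppr_eq0 => /eqP.
rewrite !big_cons; case: ifP => // Pi.
by rewrite dM IH df //; ring.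
Qed.

(** The logarithmic derivative of the factor [x - y], with [x] and [y] the two squares, is the
    quotient of [x^(j + 1) - y^(j + 1)] by [x - y], a complete homogeneous sum. *)
Lemma diag_D_vdm2 j : diag_D j V = V * ((2 / 2 ^+ j) *: \sum_(i < k) \sum_(l < k | (i < l)%N)
  \sum_(a < j.+1) u i ^+ (2 * a) * u l ^+ (2 * (j - a))).
Proof.
rewrite scaler_sumr; apply: derivation_prod_log; first exact: diag_D_mul.
move=> i _; rewrite scaler_sumr; apply: derivation_prod_log; first exact: diag_D_mul.
move=> l _.
rewrite diag_D_add diag_D_opp !diag_D_uX -scalerBr -scalerAr.
congr (_ *: _); rewrite -[in LHS]mulnS !exprM.
rewrite subrXX -[X in _ = _ * X](big_mkord xpredT (fun a => u i ^+ (2 * a) * u l ^+ (2 * (j - a)))).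
rewrite big_nat_rev big_mkord /=; congr (_ * _); apply: eq_bigr => a _.
by rewrite -!exprM add0n subSS; congr (_ ^+ _ * _ ^+ _); have := ltn_ord a; lia.
Qed.

Lemma sum_pairs (f : 'I_k -> 'I_k -> A) : (forall i l, f i l = f l i) ->
  2 *: (\sum_(i < k) \sum_(l < k | (i < l)%N) f i l) =
  \sum_i \sum_l f i l - \sum_i f i i.
Proof.
move=> fC.
have e : \sum_(i < k) \sum_(l < k | (l < i)%N) f i l = \sum_(i < k) \sum_(l < k | (i < l)%N) f i l.
  rewrite (exchange_big_dep xpredT) //=; apply: eq_bigr => l _.
  by apply: eq_bigr => i _.
rewrite -sumrB scaler_nat mulr2n -{2}e -big_split /=; apply: eq_bigr => i _.
rewrite [X in _ = X - _](bigD1 i) //= [f i i + _]addrC addrK.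
rewrite [RHS](bigID (fun l : 'I_k => (i < l)%N)) /=; congr (_ + _); apply: eq_bigl => l.
  by rewrite -val_eqE /=; lia.
by rewrite -val_eqE /=; lia.
Qed.

(** Summing over ordered pairs completes the expression to products of power sums; the diagonal
    added in this way gives the correction with coefficient [j + 1]. *)
Lemma diag_D_vdm2_p j : 2 *: diag_D j V =
  V * (2^-1 *: (\sum_(a < j.+1) diag_p a * diag_p (j - a)%N) - j.+1%:R *: diag_p j).
Proof.
have h2 n : (2 : R) ^+ n != 0 by rewrite expf_neq0 // pnatr_eq0.
rewrite diag_D_vdm2 scalerAr; congr (_ * _); rewrite scalerA [2 * _]mulrC -scalerA sum_pairs; last first.
  move=> i l; rewrite -[LHS](big_mkord xpredT (fun a => u i ^+ (2 * a) * u l ^+ (2 * (j - a)))).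
  rewrite big_nat_rev big_mkord /=; apply: eq_bigr => a _.
  by rewrite add0n subSS mulrC; congr (_ ^+ _ * _ ^+ _); have := ltn_ord a; lia.
rewrite scalerBr; congr (_ - _).
  under eq_bigr do rewrite exchange_big /=.
  rewrite exchange_big /= !scaler_sumr; apply: eq_bigr => a _.
  rewrite /diag_p -scalerAl -scalerAr !scalerA mulr_suml.
  have -> : 2^-1 * (2 / 2 ^+ a) * (2 / 2 ^+ (j - a)) = 2 / 2 ^+ j :> R.
    have -> : (2 : R) ^+ j = 2 ^+ a * 2 ^+ (j - a) by rewrite -exprD subnKC //; have := ltn_ord a; lia.
    by field; rewrite !h2.
  by congr (_ *: _); apply: eq_bigr => i _; rewrite mulr_sumr.
rewrite /diag_p [RHS]scalerA [j.+1%:R * _]mulrC -[RHS]scalerA; congr (_ *: _); rewrite scaler_sumr; apply: eq_bigr => i _.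
under eq_bigr => a _.
  rewrite -exprD -mulnDr subnKC; last by have := ltn_ord a; lia.
  over.
by rewrite sumr_const card_ord scaler_nat.
Qed.

Lemma diag_loop j F : E (V ^+ 2 * (diag_p j.+1 * F)) =
  2^-1 * E (V ^+ 2 * ((\sum_(a < j.+1) diag_p a * diag_p (j - a)%N - diag_p j) * F))
  + E (V ^+ 2 * diag_D j F).
Proof.
have h2 n : (2 : R) ^+ n != 0 by rewrite expf_neq0 // pnatr_eq0.
have -> : V ^+ 2 * (diag_p j.+1 * F) =
   2 ^- j *: \sum_i u i * (u i ^+ (2 * j).+1 * (V ^+ 2 * F)).
  rewrite /diag_p (exprS (2 : R)) (_ : 2 / (2 * 2 ^+ j) = 2 ^- j); last by field; rewrite h2.
  rewrite -scalerAl -scalerAr.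
  congr (_ *: _); rewrite mulr_suml mulr_sumr; apply: eq_bigr => i _.
  by rewrite mulnS (exprS _ (2 * j).+1); ring.
rewrite diag_E_scale diag_E_sum.
under eq_bigr do rewrite E_ibp D_mul diag_E_add.
rewrite big_split /= mulrDr.
have -> : 2 ^- j * (\sum_i E (D i (u i ^+ (2 * j).+1) * (V ^+ 2 * F))) =
   E (V ^+ 2 * (((2 * j).+1%:R / 2) *: diag_p j * F)).
  rewrite -diag_E_sum -diag_E_scale; congr E.
  rewrite /diag_p scalerA -scalerAl -scalerAr.
  have -> : (2 * j).+1%:R / 2 * (2 / 2 ^+ j) = 2 ^- j * (2 * j).+1%:R :> R.
    by field; rewrite h2.
  rewrite -scalerA; congr (_ *: _); rewrite mulr_suml mulr_sumr scaler_sumr.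
  apply: eq_bigr => i _.
  have -> : D i (u i ^+ (2 * j).+1) = (2 * j).+1%:R *: u i ^+ (2 * j).
    elim: (2 * j)%N => [|n IH]; first by rewrite expr1 D_u eqxx expr0 scale1r.
    rewrite exprS D_mul D_u eqxx mul1r IH -scalerAr -exprS.
    by rewrite -[in RHS]natr1 addrC scalerDl scale1r addrC.
  by rewrite -scalerAl mulrCA.
have -> : 2 ^- j * (\sum_i E (u i ^+ (2 * j).+1 * D i (V ^+ 2 * F))) =
   E (diag_D j (V ^+ 2 * F)).
  by rewrite /diag_D diag_E_scale diag_E_sum.
rewrite diag_D_mul diag_E_add addrA; congr (_ + _).
rewrite -diag_E_scale -diag_E_add; congr E.
rewrite diag_D_exp expr1 scalerAr diag_D_vdm2_p.
rewrite scalerAr scalerAl scalerBr.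
(* The power rule gives [(2 j + 1) / 2] and the diagonal of the Vandermonde term [- (j + 1)];
   together they leave the [- 1 / 2] of the loop equation. *)
have -> : (2 * j).+1%:R / 2 = j.+1%:R - 2^-1 :> R.
  by rewrite -!natr1 natrM; field.
by set W := _ *: (\sum_(_ < _) _); rewrite scalerBl; ring.
Qed.

Lemma diag_loop_system : loop_system (2 * k)%:R diag_E diag_p diag_D.
Proof.
split.
- by move=> t x y; rewrite /diag_E mulrDr -scalerAr E_lin mulrDl mulrA.
- by rewrite /diag_E mulr1 mulfV.
- rewrite /diag_p expr0 divr1 muln0 (eq_bigr (fun=> 1)) => [|i _]; last by rewrite expr0.
  by rewrite sumr_const card_ord -[X in 2 *: X]scaler_nat scalerA -natrM.
- by move=> j; split; [exact: diag_D_mul|exact: diag_D_p].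
- by move=> j F; rewrite /diag_E diag_loop mulrDl -mulrA.
Qed.

End DiagonalLoop.

(** * Expectations of products of independent Gaussians *)

Section GaussianFamily.
Variables (R : realType) (d : measure_display) (T : measurableType d) (P : probability T R).
Variables (J : finType) (Z : J -> T -> R).
Notation mu := (@lebesgue_measure R).
Local Notation phi := (@normal_pdf R 0 1).
Hypothesis mZ : forall e, measurable_fun setT (Z e).
Hypothesis lawZ : forall e (B : set R), measurable B -> P (Z e @^-1` B) = normal_prob 0 1 B.
Hypothesis indZ : forall B : J -> set R, (forall e, measurable (B e)) ->
  fine (P [set w | forall e, B e (Z e w)]) = \prod_e fine (P (Z e @^-1` B e)).

Definition gexp (f : R -> R) : R := \int[mu]_x (f x * phi x).
Definition gint (f : R -> R) : Prop :=
  measurable_fun setT f /\ mu.-integrable setT (fun x => (f x * phi x)%:E).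

Lemma integral_indic_comp e (B : set R) : measurable B ->
  (\int[P]_w (\1_B (Z e w))%:E = \int[mu]_x (\1_B x * phi x)%:E)%E.
Proof.
move=> mB; have -> : (fun w => (\1_B (Z e w))%:E) = (fun w => (\1_(Z e @^-1` B) w)%:E : \bar R).
  by apply/funext => w; rewrite !indicE.
rewrite integral_indic ?setIT //; last by rewrite -[X in measurable X]setTI; exact: mZ.
transitivity (normal_prob 0 1 B); first exact: lawZ.
rewrite /normal_prob integral_mkcond; apply: eq_integral => x _.
by rewrite patchE indicE; case: (x \in B); rewrite ?mul1r ?mul0r.
Qed.

Lemma gexp_indic e (B : set R) : measurable B -> gexp (\1_B) = fine (P (Z e @^-1` B)).
Proof.
move=> mB; rewrite /gexp /Rintegral -(integral_indic_comp e) //.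
have -> : (fun w => (\1_B (Z e w))%:E) = (fun w => (\1_(Z e @^-1` B) w)%:E : \bar R).
  by apply/funext => w; rewrite !indicE.
by rewrite integral_indic ?setIT // -[X in measurable X]setTI; exact: mZ.
Qed.

Lemma gint_indic (B : set R) : measurable B -> gint (\1_B).
Proof.
move=> mB; split; first exact: measurable_indic.
apply: (le_integrable measurableT _ _ (@integrable_normal_pdf R 0 1)).
  by apply/measurable_EFinP; apply: measurable_funM; [exact: measurable_indic|exact: measurable_phi].
move=> x _; rewrite !abse_EFin lee_fin normrM ler_piMl // indicE.
by case: (x \in B); rewrite ?normr1 ?normr0.
Qed.

Lemma gint_fin f : gint f -> (\int[mu]_x (f x * phi x)%:E = (gexp f)%:E)%E.
Proof. by case=> _ fi; rewrite /gexp /Rintegral fineK //; exact: integrable_fin_num. Qed.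

Lemma gexp_ge0 f : (forall x, 0 <= f x) -> 0 <= gexp f.
Proof. by move=> f0; apply: Rintegral_ge0 => x _; rewrite mulr_ge0 ?phi_ge0. Qed.

Lemma measurable_prod_comp (r : seq J) (Q : pred J) (f : J -> R -> R) :
  (forall e, measurable_fun setT (f e)) ->
  measurable_fun setT (fun w => \prod_(e <- r | Q e) f e (Z e w)).
Proof.
move=> mf; elim: r => [|e r IH].
  by under eq_fun do rewrite big_nil; exact: measurable_cst.
under eq_fun do rewrite big_cons; case: (Q e) => //.
apply: measurable_funM => //.
exact: (measurableT_comp (mf e) (mZ e)).
Qed.

(** Induction on the list [s] of variables whose factor need not be an indicator. With the product
    of the other factors as weight, the induction hypothesis identifies the weighted law of one
    variable on indicators, hence on all nonnegative functions. *)
Lemma indep_ge0_aux (s : seq J) : uniq s -> forall f : J -> R -> R,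
  (forall e, gint (f e)) -> (forall e x, 0 <= f e x) ->
  (forall e, e \notin s -> exists2 B, measurable B & f e = \1_B) ->
  (\int[P]_w (\prod_e f e (Z e w))%:E = (\prod_e gexp (f e))%:E)%E.
Proof.
elim: s => [_|e0 s IH /= /andP[ne us]] f fi f0 fB.
  pose B e := projT1 (cid2 (fB e isT)).
  have mB e : measurable (B e) by rewrite /B; case: cid2.
  have fE e : f e = \1_(B e) by rewrite /B; case: cid2.
  pose S := [set w | forall e, B e (Z e w)].
  have mS : measurable S.
    have -> : S = \bigcap_(e in [set: J]) (Z e @^-1` B e).
      by apply/seteqP; split => w /= h e; [move=> _; exact: h|exact: (h e I)].
    apply: fin_bigcap_measurable => // e _.
    by rewrite -[X in measurable X]setTI; exact: mZ.
  transitivity (\int[P]_w (\1_S w)%:E)%E.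
    apply: eq_integral => w _; congr (_%:E); rewrite indicE.
    have [wS|wS] := boolP (w \in S).
      rewrite big1 // => e _; rewrite fE indicE mem_set //.
      by move: wS; rewrite inE => /(_ e).
    have [e we] : exists e, ~ B e (Z e w).
      by apply/not_existsP => h; case/negP: wS; rewrite inE => e; apply: contrapT; exact: h.
    by rewrite (bigD1 e) //= fE indicE memNset // mul0r.
  rewrite integral_indic ?setIT // -[LHS]fineK ?fin_num_measure //; congr (_%:E).
  by rewrite indZ //; apply: eq_bigr => e _; rewrite fE (gexp_indic e).
pose Z1 w := \prod_(e | e != e0) f e (Z e w).
pose C := \prod_(e | e != e0) gexp (f e).
have C0 : 0 <= C by apply: prodr_ge0 => e _; exact: gexp_ge0.
have mZ1 : measurable_fun setT Z1 by apply: measurable_prod_comp => e; case: (fi e).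
have Z10 w : 0 <= Z1 w by apply: prodr_ge0.
have key (B : set R) : measurable B ->
   (\int[P]_w (\1_B (Z e0 w) * Z1 w)%:E = \int[mu]_x (\1_B x * (C * phi x))%:E)%E.
  move=> mB; pose f' e := if e == e0 then \1_B else f e.
  have h : (\int[P]_w (\prod_e f' e (Z e w))%:E = (\prod_e gexp (f' e))%:E)%E.
    apply: IH => //.
    - by move=> e; rewrite /f'; case: ifP => // _; exact: gint_indic.
    - by move=> e x; rewrite /f'; case: ifP => // _; rewrite indicE.
    - move=> e es; rewrite /f'; case: eqP => [_|/eqP ee]; first by exists B.
      by apply: fB; rewrite inE negb_or ee.
  transitivity (\int[P]_w (\prod_e f' e (Z e w))%:E)%E.
    apply: eq_integral => w _; congr (_%:E); rewrite (bigD1 e0) //= /f' eqxx; congr (_ * _).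
    by apply: eq_bigr => e /negbTE ->.
  rewrite h (bigD1 e0) //=.
  have -> : \prod_(e | e != e0) gexp (f' e) = C.
    by apply: eq_bigr => e /negbTE ee; rewrite /f' ee.
  have -> : f' e0 = \1_B by rewrite /f' eqxx.
  transitivity (C%:E * (gexp \1_B)%:E)%E; first by rewrite -EFinM mulrC.
  rewrite -(gint_fin (gint_indic mB)) -ge0_integralZl_EFin //.
  - by apply: eq_integral => x _; rewrite -EFinM mulrCA.
  - by move=> x _; rewrite lee_fin mulr_ge0 ?phi_ge0.
  - by case: (gint_indic mB) => mi _; apply/measurable_EFinP; apply: measurable_funM => //; exact: measurable_phi.
have mC : measurable_fun setT (fun x => C * phi x).
  by apply: measurable_funM; [exact: measurable_cst|exact: measurable_phi].
have C1 x : 0 <= C * phi x by rewrite mulr_ge0 ?phi_ge0.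
have [mf0 _] := fi e0.
have := @ge0_integral_comp_eq R _ _ _ _ P mu (Z e0) Z1 id (fun x => C * phi x) (mZ e0) mZ1
  (@measurable_id _ _ _) mC Z10 C1 key (f e0) mf0 (f0 e0) => h.
transitivity (\int[P]_w (f e0 (Z e0 w) * Z1 w)%:E)%E.
  by apply: eq_integral => w _; rewrite (bigD1 e0).
rewrite h (bigD1 e0) //= -/C.
transitivity (C%:E * (gexp (f e0))%:E)%E; last by rewrite -EFinM mulrC.
rewrite -(gint_fin (fi e0)) -ge0_integralZl_EFin //.
- by apply: eq_integral => x _; rewrite -EFinM mulrCA.
- by move=> x _; rewrite lee_fin mulr_ge0 ?phi_ge0.
- by apply/measurable_EFinP; apply: measurable_funM => //; exact: measurable_phi.
Qed.

Lemma indep_ge0 (f : J -> R -> R) :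
  (forall e, gint (f e)) -> (forall e x, 0 <= f e x) ->
  (\int[P]_w (\prod_e f e (Z e w))%:E = (\prod_e gexp (f e))%:E)%E.
Proof.
move=> fi f0; apply: (indep_ge0_aux (enum_uniq J)) => // e.
by rewrite mem_enum.
Qed.

Lemma gint_abs f : gint f -> gint (fun x => `|f x|).
Proof.
case=> mf fi; split; first exact: measurableT_comp.
apply: (le_integrable measurableT _ _ fi).
  by apply/measurable_EFinP; apply: measurable_funM; [exact: measurableT_comp|exact: measurable_phi].
by move=> x _; rewrite !abse_EFin lee_fin !normrM normr_id.
Qed.

Lemma prod_integrable (f : J -> R -> R) : (forall e, gint (f e)) ->
  P.-integrable setT (fun w => (\prod_e f e (Z e w))%:E).
Proof.
move=> fi; apply/integrableP; split.
  by apply/measurable_EFinP; apply: measurable_prod_comp => e; case: (fi e).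
under eq_integral => w _ do rewrite abse_EFin normr_prod.
by rewrite (indep_ge0 (f := fun e x => `|f e x|)) ?ltry // => e; exact: gint_abs.
Qed.

Lemma gint_pos f : gint f -> gint (fun x => (`|f x| + f x) / 2).
Proof.
move=> fi; have [mf i1] := fi; have [mg i2] := gint_abs fi; split.
  by apply: measurable_funM; [apply: measurable_funD|exact: measurable_cst].
have := integrableZl measurableT 2^-1 (integrableD measurableT i2 i1).
by congr (_ .-integrable _ _); apply/funext => x /=; rewrite -EFinD -EFinM; congr (_%:E); ring.
Qed.

Lemma gexpB f g : gint f -> gint g -> gexp (fun x => f x - g x) = gexp f - gexp g.
Proof.
case=> mf fi [mg gi]; rewrite /gexp -RintegralB //.
by apply: eq_Rintegral => x _; rewrite mulrBl.
Qed.

(* one factor at a time, each is split into its positive and negative part *)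
Lemma indep_aux (s : seq J) : uniq s -> forall f : J -> R -> R,
  (forall e, gint (f e)) -> (forall e, e \notin s -> forall x, 0 <= f e x) ->
  (\int[P]_w (\prod_e f e (Z e w))%:E = (\prod_e gexp (f e))%:E)%E.
Proof.
elim: s => [_|e0 s IH /= /andP[ne us]] f fi f0; first by apply: indep_ge0 => // e; exact: f0.
pose fp x := (`|f e0 x| + f e0 x) / 2.
pose fm x := (`|- f e0 x| + - f e0 x) / 2.
have fN : gint (fun x => - f e0 x).
  case: (fi e0) => mf i1; split; first exact: measurableT_comp.
  have := integrableN i1.
  by congr (_ .-integrable _ _); apply/funext => x /=; rewrite mulNr.
have ip : gint fp := gint_pos (fi e0).
have im : gint fm := gint_pos fN.
have p0 x : 0 <= fp x by rewrite divr_ge0 //; have := ler_norm (- f e0 x); rewrite normrN; lra.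
have m0 x : 0 <= fm x by rewrite divr_ge0 // normrN; have := ler_norm (f e0 x); lra.
have fE x : f e0 x = fp x - fm x by rewrite /fp /fm normrN; field.
pose fP e := if e == e0 then fp else f e.
pose fM e := if e == e0 then fm else f e.
have iP e : gint (fP e) by rewrite /fP; case: ifP.
have iM e : gint (fM e) by rewrite /fM; case: ifP.
have hP : (\int[P]_w (\prod_e fP e (Z e w))%:E = (\prod_e gexp (fP e))%:E)%E.
  apply: IH => // e es x; rewrite /fP; case: eqP => // /eqP ee.
  by apply: f0; rewrite inE negb_or ee.
have hM : (\int[P]_w (\prod_e fM e (Z e w))%:E = (\prod_e gexp (fM e))%:E)%E.
  apply: IH => // e es x; rewrite /fM; case: eqP => // /eqP ee.
  by apply: f0; rewrite inE negb_or ee.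
transitivity (\int[P]_w ((\prod_e fP e (Z e w))%:E - (\prod_e fM e (Z e w))%:E))%E.
  apply: eq_integral => w _; rewrite -EFinB; congr (_%:E).
  rewrite (bigD1 e0) //= [X in _ = X - _](bigD1 e0) //= [X in _ = _ - X](bigD1 e0) //=.
  rewrite /fP /fM eqxx fE mulrBl; congr (_ * _ - _ * _); by apply: eq_bigr => e /negbTE ->.
rewrite integralB //; [|exact: prod_integrable|exact: prod_integrable].
rewrite [X in (X - _)%E]hP [X in (_ - X)%E]hM -EFinB; congr (_%:E).
rewrite (bigD1 e0) //= [X in _ - X](bigD1 e0) //= [RHS](bigD1 e0) //=.
rewrite /fP /fM eqxx.
have -> : gexp (f e0) = gexp fp - gexp fm.
  by rewrite -gexpB //; congr gexp; apply/funext => x; exact: fE.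
by rewrite mulrBl; congr (_ * _ - _ * _); apply: eq_bigr => e /negbTE ->.
Qed.

Lemma indep (f : J -> R -> R) : (forall e, gint (f e)) ->
  (\int[P]_w (\prod_e f e (Z e w))%:E = (\prod_e gexp (f e))%:E)%E.
Proof.
move=> fi; apply: (indep_aux (enum_uniq J)) => // e.
by rewrite mem_enum.
Qed.

End GaussianFamily.

(** * Gaussian moments *)

Section GaussianMoments.
Variable R : realType.
Notation mu := (@lebesgue_measure R).
Local Notation phi := (@normal_pdf R 0 1).

Lemma is_derive_phi (x : R) : is_derive x 1 phi (- (x * phi x)).
Proof.
have -> : phi = (fun z => normal_peak 1 * expR (- (2^-1 * z ^+ 2))).
  by apply/funext => z; rewrite phiE.
have dsq : is_derive x 1 (fun z : R => - (2^-1 * z ^+ 2)) (- x).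
  apply: (is_derive_eq (is_deriveN (is_deriveZ (2^-1 : R) (is_deriveX 2 (is_derive_id x 1))))).
  by rewrite /= expr1 /GRing.scale /= mulr1; field.
have dE : is_derive x 1 (fun z : R => expR (- (2^-1 * z ^+ 2))) (expR (- (2^-1 * x ^+ 2)) * - x).
  exact: (is_derive1_comp (is_derive_expR _) dsq).
apply: (is_derive_eq (is_deriveZ (normal_peak 1 : R) dE)); rewrite /GRing.scale /=; ring.
Qed.

Lemma gint_pow d : @gint R (fun x => x ^+ d).
Proof. by split; [exact: exprn_measurable|exact: integrable_pow_phi]. Qed.

Definition gmom d : R := gexp (fun x : R => x ^+ d).

Lemma gmom0 : gmom 0 = 1.
Proof.
rewrite /gmom /gexp /Rintegral; under eq_integral do rewrite expr0 mul1r.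
by rewrite integral_normal_pdf.
Qed.

Lemma powphi_cvg0 (d : nat) (e : R) : `|e| = 1 -> (e * n%:R) ^+ d * phi (e * n%:R) @[n --> \oo] --> (0 : R).
Proof.
move=> e1; have q0 : 0 < 2^-1 :> R by rewrite invr_gt0.
pose C := (1 + d.+1`!%:R * (2^-1) ^- d.+1) * normal_peak 1 : R.
have bd (x : R) : `|x| ^+ d.+1 * phi x <= C.
  rewrite phiE; apply: (le_trans (ler_wpM2r _ (absX_le_expR x d.+1 q0))).
    by rewrite mulr_ge0 ?expR_ge0 ?normal_peak_ge0.
  rewrite /C le_eqVlt; apply/orP; left; apply/eqP.
  have := expRxMexpNx_1 (2^-1 * x ^+ 2); set a := expR _; set b := expR (- _) => ab.
  transitivity ((1 + d.+1`!%:R * (2^-1) ^- d.+1) * normal_peak 1 * (a * b)); first by ring.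
  by rewrite ab mulr1.
apply/cvgr0Pnorm_lt => eps eps0; near=> n.
have n0 : (0 < n)%N by near: n; exact: nbhs_infty_gt.
have nR : 0 < n%:R :> R by rewrite ltr0n.
have := bd (e * n%:R); rewrite normrM e1 mul1r (gtr0_norm nR) => h.
rewrite normrM normrX normrM e1 mul1r (gtr0_norm nR) (ger0_norm (phi_ge0 _)).
apply: (@le_lt_trans _ _ (C / n%:R)).
  by rewrite ler_pdivlMr // mulrAC -exprSr.
by near: n; apply: (cvgr_lt _ (@cvg_divn R C)).
Unshelve. all: by end_near. Qed.

(** The derivative of [x^d phi] integrates over growing intervals to boundary terms that tend to 0.
    For [d = 0] the truncated predecessor is multiplied by 0. *)
Lemma gmomS d : gmom d.+1 = d%:R * gmom d.-1.
Proof.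
pose h x := (d%:R * x ^+ d.-1 - x ^+ d.+1) * phi x.
pose H x := x ^+ d * phi x.
have ih : mu.-integrable setT (fun x => (h x)%:E).
  have i1 := integrable_pow_phi R d.-1; have i2 := integrable_pow_phi R d.+1.
  have := integrableB measurableT (integrableZl measurableT d%:R i1) i2.
  congr (_ .-integrable _ _); apply/funext => x /=; rewrite -EFinM -EFinB; congr (_%:E).
  by rewrite /h; ring.
have mh : measurable_fun setT h by case/integrableP: ih => /measurable_EFinP.
have dH (x : R) : is_derive x 1 H (h x).
  have -> : H = (fun z => ('X^d).[z] * phi z) by apply/funext => z; rewrite hornerXn.
  apply: (is_derive_eq (is_deriveM (is_derive_poly 'X^d x) (is_derive_phi x))).
  change (('X^d).[x] * - (x * phi x) + phi x * ('X^d)^`().[x] = h x).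
  by rewrite derivXn hornerMn !hornerXn /h exprS -mulr_natr; ring.
have ch : continuous h.
  move=> x; apply: cvgM; last exact: continuous_phi.
  apply: cvgB; last exact: exprn_continuous.
  by apply: cvgM; [exact: cvg_cst|exact: exprn_continuous].
have cH : continuous H.
  by move=> x; apply: cvgM; [exact: exprn_continuous|exact: continuous_phi].
pose Iv (n : nat) : set R := [set` `[- (n.+1%:R : R), n.+1%:R]].
have I0 n : (\int[mu]_(x in Iv n) (h x)%:E = (H n.+1%:R)%:E - (H (- n.+1%:R)%R)%:E)%E.
  apply: continuous_FTC2.
  - by rewrite -subr_gt0 opprK addr_gt0.
  - exact: continuous_subspaceT.
  - split; first by move=> x _; case: (dH x).
      exact/cvg_at_right_filter/cH.
    exact/cvg_at_left_filter/cH.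
  - by move=> x _; rewrite derive1E; case: (dH x).
have c1 : (\int[mu]_(x in Iv n) (h x)%:E @[n --> \oo] --> \int[mu]_x (h x)%:E)%E.
  under eq_fun do rewrite integral_mkcond.
  apply: (@dominated_cvg _ _ _ mu _ _ _ _ (fun x => `|(h x)%:E|%E)) => //.
  - move=> n; apply/(measurable_restrict _ _ _) => //; rewrite ?setTI //.
      exact: measurable_itv.
    by apply: measurable_funTS; exact/measurable_EFinP.
  - move=> x _; apply: cvg_near_cst; near=> n; rewrite patchE mem_set //.
    rewrite /Iv /= in_itv /= -ler_norml; apply: (@le_trans _ _ n%:R); last by rewrite ler_nat.
    by near: n; exact: nbhs_infty_ger.
  - exact: integrable_abse.
  - move=> n x _; rewrite patchE; case: ifP => _ //.
    by rewrite abse0 abse_ge0.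
have c2 : ((H n.+1%:R)%:E - (H (- n.+1%:R)%R)%:E)%E @[n --> \oo] --> (0%:E : \bar R).
  under eq_fun do rewrite -EFinB.
  apply: cvg_EFin; first exact: nearW.
  rewrite -[X in _ --> X](subrr 0); apply: (@cvgB _ R^o).
    have := @powphi_cvg0 d 1 (normr1 _); rewrite -cvg_shiftS /=.
    by apply: cvg_trans; apply: near_eq_cvg; apply: nearW => n /=; rewrite mul1r.
  have := @powphi_cvg0 d (-1) (normrN1 _); rewrite -cvg_shiftS /=.
  by apply: cvg_trans; apply: near_eq_cvg; apply: nearW => n /=; rewrite mulN1r.
have : (\int[mu]_x (h x)%:E = 0%:E)%E.
  have c3 : (\int[mu]_(x in Iv n) (h x)%:E @[n --> \oo] --> (0%:E : \bar R))%E.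
    by under eq_fun do rewrite I0.
  by have := cvg_unique _ c1 c3; apply; exact: ereal_hausdorff.
move=> e0; have : \int[mu]_x (h x) = 0 by rewrite /Rintegral e0.
have -> : \int[mu]_x (h x) = d%:R * gmom d.-1 - gmom d.+1.
  rewrite /gmom /gexp -RintegralZl //; last exact: integrable_pow_phi.
  rewrite -RintegralB //; [|exact: (integrableZl measurableT d%:R (integrable_pow_phi R d.-1))|exact: integrable_pow_phi].
  by apply: eq_Rintegral => x _; rewrite /h; ring.
by move/eqP; rewrite subr_eq0 => /eqP ->.
Unshelve. all: by end_near. Qed.

End GaussianMoments.

(** * Gaussian integration by parts for polynomials *)

Section PolynomialExpectation.
Variables (R : realType) (d : measure_display) (T : measurableType d) (P : probability T R).
Variables (n : nat) (Z : 'I_n -> T -> R).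
Hypothesis mZ : forall e, measurable_fun setT (Z e).
Hypothesis lawZ : forall e (B : set R), measurable B -> P (Z e @^-1` B) = normal_prob 0 1 B.
Hypothesis indZ : forall B : 'I_n -> set R, (forall e, measurable (B e)) ->
  fine (P [set w | forall e, B e (Z e w)]) = \prod_e fine (P (Z e @^-1` B e)).
Local Notation A := (mpoly.mpoly n R).

Definition mev (w : T) (p : A) : R := mpoly.meval (Z^~ w) p.
Definition mE (p : A) : R := \int[P]_w mev w p.

Lemma mevX w m : mev w (mpoly.mpolyX R m) = \prod_i Z i w ^+ m i.
Proof. exact: mpoly.mevalX. Qed.

Lemma integrable_mevX m : P.-integrable setT (fun w => (mev w (mpoly.mpolyX R m))%:E).
Proof.
have := prod_integrable mZ lawZ indZ (f := fun i x => x ^+ m i) (fun i => gint_pow R (m i)).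
by congr (_ .-integrable _ _); apply/funext => w; rewrite mevX.
Qed.

Lemma mE_X m : mE (mpoly.mpolyX R m) = \prod_i gmom R (m i).
Proof.
rewrite /mE /Rintegral; under eq_integral do rewrite mevX.
by rewrite (indep mZ lawZ indZ (f := fun i x => x ^+ m i) (fun i => gint_pow R (m i))).
Qed.

Lemma mev_lin w (a : R) p q : mev w (a *: p + q) = a * mev w p + mev w q.
Proof. by rewrite /mev mpoly.mevalD mpoly.mevalZ. Qed.

Lemma integrable_mev p : P.-integrable setT (fun w => (mev w p)%:E).
Proof.
rewrite (mpoly.mpolyE p); elim: (mpoly.msupp p) => [|m s IH].
  have : P.-integrable setT (fun w : T => (0 : R)%:E) by exact: integrable0.
  by congr (_ .-integrable _ _); apply/funext => w; rewrite big_nil /mev mpoly.meval0.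
have := integrableD measurableT (integrableZl measurableT (mpoly.mcoeff m p) (integrable_mevX m)) IH.
by congr (_ .-integrable _ _); apply/funext => w /=; rewrite big_cons mev_lin EFinD EFinM.
Qed.

Lemma mE_lin a p q : mE (a *: p + q) = a * mE p + mE q.
Proof.
rewrite /mE -RintegralZl //; last exact: integrable_mev.
rewrite -RintegralD //; [|exact: (integrableZl measurableT a (integrable_mev p))|exact: integrable_mev].
by apply: eq_Rintegral => w _; rewrite mev_lin.
Qed.

Lemma mE_1 : mE 1 = 1.
Proof. by rewrite -mpoly.mpolyX0 mE_X big1 // => i _; rewrite mpoly.mnm0E gmom0. Qed.

(** By linearity it is enough to treat monomials, where independence reduces it to the moment
    recursion in one variable. *)
Lemma mE_ibp i p : mE (mpoly.mpolyX R (mpoly.mnm1 i) * p) = mE (mpoly.mderiv i p).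
Proof.
have mE0 : mE 0 = 0.
  by have := mE_lin 1 0 0; rewrite scaler0 addr0 mul1r => /eqP; rewrite -subr_eq0 opprD addrA subrr add0r oppr_eq0 => /eqP.
rewrite (mpoly.mpolyE p); elim: (mpoly.msupp p) => [|m s IH].
  by rewrite big_nil mulr0 mpoly.mderiv0.
rewrite big_cons mulrDr -scalerAr mE_lin IH mpoly.mderivD mpoly.mderivZ mE_lin; congr (_ * _ + _).
rewrite -mpoly.mpolyXD mpoly.mderivX -[_ *: _]addr0 mE_lin mE0 addr0 !mE_X.
rewrite (bigD1 i) //= [in RHS](bigD1 i) //= mpoly.mnmDE mpoly.mnmBE mpoly.mnm1E eqxx add1n subn1.
rewrite gmomS mulrA; congr (_ * _); apply: eq_bigr => j ji.
by rewrite mpoly.mnmDE mpoly.mnmBE mpoly.mnm1E eq_sym (negbTE ji) add0n subn0.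
Qed.

End PolynomialExpectation.

(** * Newton identities *)

Section NewtonIdentities.
Variables (R : realFieldType) (N : nat).
Implicit Types (x y : 'I_N -> R).

Definition psum x (j : nat) : R := \sum_i x i ^+ j.

Definition gen_esym y : {poly R} := \prod_i (1 + y i *: 'X).

(** Division of the generating polynomial by one factor, as a geometric series. *)
Lemma gen_esym_del y p m :
  (\prod_(i | i != p) (1 + y i *: 'X))`_m = \sum_(r < m.+1) (- y p) ^+ r * (gen_esym y)`_(m - r).
Proof.
set Ep := \prod_(i | _) _.
have EE : gen_esym y = (1 + y p *: 'X) * Ep by rewrite /gen_esym (bigD1 p).
have e0 : (gen_esym y)`_0 = Ep`_0 by rewrite EE mulrDl mul1r coefD -scalerAl coefZ coefXM mulr0 addr0.
have eS j : (gen_esym y)`_j.+1 = Ep`_j.+1 + y p * Ep`_j.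
  by rewrite EE mulrDl mul1r coefD -scalerAl coefZ coefXM.
elim: m => [|m IH]; first by rewrite big_ord1 expr0 mul1r subnn e0.
rewrite big_ord_recl /= expr0 mul1r subn0 eS.
have -> : \sum_(i < m.+1) (- y p) ^+ bump 0 i * (gen_esym y)`_(m.+1 - bump 0 i) = - y p * Ep`_m.
  by rewrite IH mulr_sumr; apply: eq_bigr => i _; rewrite /bump /= add1n exprS subSS mulrA.
by ring.
Qed.

Lemma newton y m : m.+1%:R * (gen_esym y)`_m.+1 =
  \sum_(r < m.+1) (-1) ^+ r * psum y r.+1 * (gen_esym y)`_(m - r).
Proof.
have -> : m.+1%:R * (gen_esym y)`_m.+1 = ((gen_esym y)^`())`_m.
  by rewrite coef_deriv mulr_natl.
have -> : (gen_esym y)^`() = \sum_p y p *: \prod_(i | i != p) (1 + y i *: 'X).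
  rewrite /gen_esym deriv_prod_seq ?index_enum_uniq //; apply: eq_bigr => p _.
  rewrite (bigD1 p) //= eqxx derivD -polyC1 derivC add0r derivZ derivX alg_polyC mul_polyC; congr (_ *: _).
  by apply: eq_bigr => i /negbTE ->.
rewrite coef_sum; under eq_bigr do rewrite coefZ gen_esym_del mulr_sumr.
rewrite exchange_big /=; apply: eq_bigr => r _; rewrite /psum mulr_sumr mulr_suml.
by apply: eq_bigr => p _; rewrite exprS [(- y p) ^+ _]exprNn; ring.
Qed.

Lemma gen_esym0 y : (gen_esym y)`_0 = 1.
Proof.
rewrite /gen_esym -horner_coef0 horner_prod big1 // => i _.
by rewrite hornerD hornerZ hornerX mulr0 addr0 hornerC.
Qed.

Lemma gen_esym_top y : (gen_esym y)`_N = \prod_i y i.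
Proof.
have key (s : seq 'I_N) : (size (\prod_(i <- s) (1 + y i *: 'X : {poly R}))%R <= (size s).+1)%N /\
    (\prod_(i <- s) (1 + y i *: 'X : {poly R}))`_(size s) = \prod_(i <- s) y i.
  elim: s => [|i s [IH1 IH2]]; first by rewrite !big_nil size_poly1 coefC.
  rewrite !big_cons mulrDl mul1r; split.
    apply: (leq_trans (size_polyD _ _)); rewrite geq_max (leq_trans IH1) //=.
    rewrite -scalerAl; apply: (leq_trans (size_scale_leq _ _)); rewrite mulrC.
    apply: (leq_trans (size_polyMleq _ _)); rewrite size_polyX addn2 /=.
    by rewrite ltnS.
  by rewrite /= coefD -scalerAl coefZ coefXM /= IH2 nth_default ?add0r.
have [_] := key (index_enum 'I_N).
rewrite -[index_enum _]enumT size_enum_ord => h.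
by rewrite /gen_esym -[index_enum _]enumT.
Qed.

(** A polynomial in the power sums is stored as a list of coefficients with index lists, so that one
    and the same list can be evaluated at the power sums of different families. *)
Definition ev (f : nat -> R) (pe : seq (R * seq nat)) : R :=
  \sum_(cs <- pe) cs.1 * \prod_(i <- cs.2) f i.

Definition rep (F : ('I_N -> R) -> R) := exists pe, forall x, F x = ev (psum x) pe.

Lemma rep_ext F G : (forall x, F x = G x) -> rep F -> rep G.
Proof. by move=> e [pe h]; exists pe => x; rewrite -e. Qed.

Lemma rep_const c : rep (fun=> c).
Proof. by exists [:: (c, [::])] => x; rewrite /ev big_seq1 big_nil mulr1. Qed.

Lemma rep_psum j : rep (fun x => psum x j).
Proof. by exists [:: (1, [:: j])] => x; rewrite /ev big_seq1 big_seq1 mul1r. Qed.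

Lemma rep_add F G : rep F -> rep G -> rep (fun x => F x + G x).
Proof. by move=> [p hp] [q hq]; exists (p ++ q) => x; rewrite /ev big_cat hp hq. Qed.

Lemma rep_mul F G : rep F -> rep G -> rep (fun x => F x * G x).
Proof.
move=> [p hp] [q hq]; exists [seq (a.1 * b.1, a.2 ++ b.2) | a <- p, b <- q] => x.
rewrite /ev big_allpairs_dep hp hq /ev mulr_suml; apply: eq_bigr => a _.
rewrite mulr_sumr; apply: eq_bigr => b _; rewrite big_cat /=; ring.
Qed.

Lemma rep_sum I (s : seq I) (F : I -> ('I_N -> R) -> R) :
  (forall i, rep (F i)) -> rep (fun x => \sum_(i <- s) F i x).
Proof.
move=> h; elim: s => [|i s IH].
  by apply: rep_ext (rep_const 0) => x; rewrite big_nil.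
by apply: rep_ext (rep_add (h i) IH) => x; rewrite big_cons.
Qed.

Lemma rep_psum_poly (q : {poly R}) j : rep (fun x => psum (fun i => q.[x i]) j).
Proof.
apply: (@rep_ext (fun x => \sum_(a < size (q ^+ j)) (q ^+ j)`_a * psum x a)) => [x|].
  rewrite /psum; under eq_bigr do rewrite mulr_sumr.
  by rewrite exchange_big /=; apply: eq_bigr => i _; rewrite -horner_exp horner_coef.
by apply: rep_sum => a; apply: rep_mul; [exact: rep_const|exact: rep_psum].
Qed.

Lemma rep_esym_poly (q : {poly R}) m : rep (fun x => (gen_esym (fun i => q.[x i]))`_m).
Proof.
elim/ltn_ind: m => -[|m] IH.
  by apply: rep_ext (rep_const 1) => x; rewrite gen_esym0.
apply: (@rep_ext (fun x => m.+1%:R^-1 * \sum_(r < m.+1)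
   (-1) ^+ r * psum (fun i => q.[x i]) r.+1 * (gen_esym (fun i => q.[x i]))`_(m - r))) => [x|].
  by rewrite -newton mulKf // pnatr_eq0.
apply: rep_mul; first exact: rep_const.
apply: rep_sum => r; apply: rep_mul; last by apply: IH; rewrite ltnS leq_subr.
by apply: rep_mul; [exact: rep_const|exact: rep_psum_poly].
Qed.

(** The product is the top elementary symmetric function of the [q.[x i]]. Newton's identities
    express it by their power sums, which are combinations of those of the [x i]. *)
Lemma rep_prod_poly (q : {poly R}) : rep (fun x => \prod_i q.[x i]).
Proof. by apply: rep_ext (rep_esym_poly q N) => x; rewrite gen_esym_top. Qed.

End NewtonIdentities.

(** * Polynomial approximation with an exponential weight *)

Section WeightedApproximation.
Variable R : realType.
Local Notation wt t := (expR (4^-1 * t) : R).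

(** The weight [exp (t / 4)] fits the Gaussian: the squared eigenvalues sum to at most the sum of
    the squared entries, and [exp (x^2 / 4)] is integrable against [phi]. *)
Definition approx (f : R -> R) := forall e : R, 0 < e ->
  exists q : {poly R}, forall t : R, 0 <= t -> `|f t - q.[t]| <= e * wt t.

Lemma approx_lim f : (forall e : R, 0 < e -> exists2 g, approx g &
  forall t : R, 0 <= t -> `|f t - g t| <= e * wt t) -> approx f.
Proof.
move=> h e e0; have e2 : 0 < e / 2 by rewrite divr_gt0.
have [g ag fg] := h _ e2; have [q gq] := ag _ e2; exists q => t t0.
rewrite -(subrKA (g t)); apply: (le_trans (ler_normD _ _)).
have := lerD (fg t t0) (gq t t0); rewrite -mulrDl -splitr; exact: le_trans.
Qed.

Lemma approx_poly (q : {poly R}) : approx (horner q).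
Proof. by move=> e e0; exists q => t _; rewrite subrr normr0 mulr_ge0 ?expR_ge0 ?ltW. Qed.

Lemma approx_ext f g : (forall t, f t = g t) -> approx f -> approx g.
Proof. by move=> fg; have -> : g = f by apply/funext. Qed.

Lemma approx_add f g : approx f -> approx g -> approx (fun t => f t + g t).
Proof.
move=> af ag e e0; have e2 : 0 < e / 2 by rewrite divr_gt0.
have [p fp] := af _ e2; have [q gq] := ag _ e2; exists (p + q) => t t0.
rewrite hornerD opprD addrACA; apply: (le_trans (ler_normD _ _)).
have := lerD (fp t t0) (gq t t0); rewrite -mulrDl -splitr; exact: le_trans.
Qed.

Lemma approx_scale c f : approx f -> approx (fun t => c * f t).
Proof.
move=> af e e0; have c1 : 0 < `|c| + 1 by rewrite ltr_wpDl.
have [p fp] := af _ (divr_gt0 e0 c1); exists (c *: p) => t t0.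
rewrite hornerZ -mulrBr normrM.
apply: (@le_trans _ _ ((`|c| + 1) * (e / (`|c| + 1) * wt t))).
  by apply: ler_pM => //; [lra|exact: fp].
by rewrite mulrA [_ * (e / _)]mulrC divfK // gt_eqF.
Qed.

Lemma approx_sum I (s : seq I) (f : I -> R -> R) :
  (forall i, approx (f i)) -> approx (fun t => \sum_(i <- s) f i t).
Proof.
move=> h; elim: s => [|i s IH].
  by apply: approx_ext (approx_poly 0) => t; rewrite big_nil horner0.
by apply: approx_ext (approx_add (h i) IH) => t; rewrite big_cons.
Qed.

(* the ratio [2/3] trades a geometric factor for the weight [expR (3/2 * s)] *)
Lemma exp_taylor_tail (s : R) n : 0 <= s ->
  `|expR (- s) - \sum_(0 <= m < n) (- s) ^+ m / m`!%:R| <= 3 * (2 / 3) ^+ n * expR (3 / 2 * s).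
Proof.
move=> s0.
have c : series (exp_coeff (- s)) M @[M --> \oo] --> expR (- s) by exact: is_cvg_series_exp_coeff.
have tb m : `|(- s) ^+ m / m`!%:R| <= (2 / 3) ^+ m * expR (3 / 2 * s).
  have f0 : 0 < m`!%:R :> R by rewrite ltr0n fact_gt0.
  rewrite normrM normrX normrN (ger0_norm s0) (@ger0_norm _ (_^-1)) ?invr_ge0 ?(ltW f0) //.
  rewrite ler_pdivrMr //.
  have t0 : 0 <= 3 / 2 * s by rewrite mulr_ge0.
  have := pow_le_expR m t0; rewrite exprMn => h.
  have r0 : 0 <= (2 / 3) ^+ m :> R by rewrite exprn_ge0.
  have := ler_wpM2l r0 h; rewrite mulrA -exprMn (_ : 2 / 3 * (3 / 2) = 1 :> R); last by field.
  by rewrite expr1n mul1r [_`!%:R * _]mulrC mulrA.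
have geo a b : (a <= b)%N -> \sum_(a <= m < b) (2 / 3) ^+ m <= 3 * (2 / 3) ^+ a :> R.
  move=> ab; have -> : \sum_(a <= m < b) (2 / 3) ^+ m = 3 * (2 / 3) ^+ a - 3 * (2 / 3) ^+ b :> R.
    elim: b ab => [|b IH]; first by rewrite leqn0 => /eqP ->; rewrite big_geq // subrr.
    rewrite leq_eqVlt => /orP[/eqP <-|ab]; first by rewrite big_geq // subrr.
    by rewrite big_nat_recr //= IH // exprS; field.
  by rewrite gerBl mulr_ge0 // exprn_ge0.
have fin M : (n <= M)%N -> `|series (exp_coeff (- s)) M - \sum_(0 <= m < n) (- s) ^+ m / m`!%:R|
    <= 3 * (2 / 3) ^+ n * expR (3 / 2 * s).
  move=> nM; rewrite /series /= (big_cat_nat _ nM) //= addrAC subrr add0r.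
  apply: (le_trans (ler_norm_sum _ _ _)).
  apply: (@le_trans _ _ (\sum_(n <= m < M) ((2 / 3) ^+ m * expR (3 / 2 * s)))).
    by apply: ler_sum_nat => m _; exact: tb.
  by rewrite -mulr_suml ler_wpM2r ?expR_ge0 // geo.
have c' : `|series (exp_coeff (- s)) M - \sum_(0 <= m < n) (- s) ^+ m / m`!%:R| @[M --> \oo] -->
   `|expR (- s) - \sum_(0 <= m < n) (- s) ^+ m / m`!%:R|.
  by apply: cvg_norm; apply: cvgB => //; exact: cvg_cst.
rewrite leNgt; apply/negP => lt.
have [M [h1 h2]] : exists M, (n <= M)%N /\ 3 * (2 / 3) ^+ n * expR (3 / 2 * s) <
   `|series (exp_coeff (- s)) M - \sum_(0 <= m < n) (- s) ^+ m / m`!%:R|.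
  apply: (@filter_ex _ \oo); near=> M; split; near: M; first exact: nbhs_infty_ge.
  exact: (cvgr_gt _ c').
by have := fin M h1; rewrite leNgt h2.
Unshelve. all: by end_near. Qed.

(** One factor [exp (- t / 8)] is expanded at a time. Its Taylor error costs [exp (3 t / 16)]; with
    this bound, expanding several factors at once would exceed the weight. *)
Lemma approx_pow_exp j d : approx (fun t => t ^+ d * expR (- (j%:R * (8^-1 * t)))).
Proof.
elim: j d => [|j IH] d.
  by apply: approx_ext (approx_poly 'X^d) => t; rewrite mul0r oppr0 expR0 mulr1 hornerXn.
apply: approx_lim => e e0.
pose C : R := 3 * (16 ^+ d * d`!%:R).
have C0 : 0 <= C by rewrite !mulr_ge0 // exprn_ge0.
have [n hn] : exists n, C * (2 / 3) ^+ n <= e.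
  have cg : C * (2 / 3) ^+ n @[n --> \oo] --> (0 : R).
    rewrite -[X in _ --> X](mulr0 C); apply: cvgM; first exact: cvg_cst.
    by apply: cvg_expr; rewrite ger0_norm //; lra.
  apply: (@filter_ex _ \oo); have := cvgr_le _ cg; apply; exact: e0.
exists (fun t => \sum_(0 <= m < n) ((- 8^-1) ^+ m / m`!%:R) * (t ^+ (d + m) * expR (- (j%:R * (8^-1 * t))))).
  by apply: approx_sum => m; apply: approx_scale; exact: IH.
move=> t t0; have s0 : 0 <= 8^-1 * t by rewrite mulr_ge0 // invr_ge0.
have -> : t ^+ d * expR (- (j.+1%:R * (8^-1 * t))) -
    \sum_(0 <= m < n) ((- 8^-1) ^+ m / m`!%:R) * (t ^+ (d + m) * expR (- (j%:R * (8^-1 * t)))) =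
   t ^+ d * expR (- (j%:R * (8^-1 * t))) *
    (expR (- (8^-1 * t)) - \sum_(0 <= m < n) (- (8^-1 * t)) ^+ m / m`!%:R).
  rewrite mulrBr; congr (_ - _).
    by rewrite -mulrA -expRD; congr (_ * expR _); rewrite -natr1; ring.
  rewrite mulr_sumr; apply: eq_bigr => m _.
  have -> : (- (8^-1 * t)) ^+ m = (- 8^-1) ^+ m * t ^+ m by rewrite -exprMn mulNr.
  by rewrite exprD; ring.
rewrite normrM [X in X * _]ger0_norm; last by rewrite mulr_ge0 ?expR_ge0 ?exprn_ge0.
have e1 : expR (- (j%:R * (8^-1 * t))) <= 1.
  by rewrite -[leRHS]expR0 ler_expR oppr_le0 mulr_ge0.
(* The constant 16 lets the power cost [exp (t / 16)], and [1 / 16 + 3 / 16 = 1 / 4]. *)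
have td : t ^+ d <= 16 ^+ d * d`!%:R * expR (16^-1 * t).
  have t16 : 0 <= 16^-1 * t by rewrite mulr_ge0 // invr_ge0.
  have := pow_le_expR d t16; rewrite exprMn exprVn ler_pdivrMl ?exprn_gt0 //.
  by rewrite mulrA.
have h1 : t ^+ d * expR (- (j%:R * (8^-1 * t))) <= 16 ^+ d * d`!%:R * expR (16^-1 * t).
  apply: le_trans td; rewrite -[leRHS]mulr1 ler_wpM2l // exprn_ge0 //.
apply: (le_trans (ler_pM _ (normr_ge0 _) h1 (exp_taylor_tail n s0))).
  by rewrite mulr_ge0 ?expR_ge0 ?exprn_ge0.
have -> : 16 ^+ d * d`!%:R * expR (16^-1 * t) * (3 * (2 / 3) ^+ n * expR (3 / 2 * (8^-1 * t))) =
   C * (2 / 3) ^+ n * (expR (16^-1 * t) * expR (3 / 2 * (8^-1 * t))) by rewrite /C; ring.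
rewrite -expRD (_ : 16^-1 * t + 3 / 2 * (8^-1 * t) = 4^-1 * t); last by field.
by rewrite ler_wpM2r ?expR_ge0.
Qed.

Lemma approx_poly_exp (B : {poly R}) : approx (fun t => B.[expR (- (8^-1 * t))]).
Proof.
apply: (@approx_ext (fun t => \sum_(j < size B) B`_j * (t ^+ 0 * expR (- (j%:R * (8^-1 * t)))))) => [t|].
  rewrite horner_coef; apply: eq_bigr => j _; congr (_ * _).
  by rewrite expr0 mul1r -mulrN expRM_natl.
by apply: approx_sum => j; apply: approx_scale; exact: approx_pow_exp.
Qed.

(** The threshold of a step on [m^3] trials. The binomial deviation is of order at most [m^(3/2)],
    so lowering the threshold by [m^2] makes the limit 0 at [v = v0] itself, as the strict
    inequality in the target indicator requires. *)
Definition stepD (v0 : R) (m : nat) : nat := (Num.trunc ((m ^ 3)%:R * v0) - m ^ 2)%N.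

Definition step_poly (v0 : R) (m : nat) : {poly R} :=
  \sum_(i < (m ^ 3).+1) ('C(m ^ 3, i)%:R * (i < stepD v0 m)%N%:R) *: ('X^i * (1 - 'X) ^+ (m ^ 3 - i)).

Lemma step_polyE v0 m v : (step_poly v0 m).[v] =
  \sum_(i < (m ^ 3).+1) 'C(m ^ 3, i)%:R * v ^+ i * (1 - v) ^+ (m ^ 3 - i) * (i < stepD v0 m)%N%:R.
Proof.
rewrite /step_poly -[LHS]/(horner_eval v _) raddf_sum /=; apply: eq_bigr => i _.
rewrite /horner_eval hornerZ hornerM hornerXn horner_exp hornerD hornerN hornerX hornerC; ring.
Qed.

Lemma step_poly01 v0 m v : 0 <= v <= 1 -> 0 <= (step_poly v0 m).[v] <= 1.
Proof.
case/andP=> a b; have r0 : 0 <= 1 - v by rewrite subr_ge0.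
rewrite step_polyE; apply/andP; split.
  by apply: sumr_ge0 => i _; rewrite mulr_ge0 // binom_weight_ge0.
rewrite -[leRHS](@binom_sum1 R (m ^ 3) v (1 - v)) ?subrK //; apply: ler_sum => i _.
by rewrite ler_piMr ?binom_weight_ge0 //; case: (_ < _)%N.
Qed.

Lemma step_mono D m : ((m.+1 < D)%N%:R : R) <= (m < D)%N%:R.
Proof. by rewrite ler_nat; case: (ltnP m.+1 D) => // /ltnW ->. Qed.

Lemma step01 D m : 0 <= ((m < D)%N%:R : R) <= 1.
Proof. by case: (m < D)%N; rewrite ?lexx ler01. Qed.

Lemma step_poly_lo (v0 v : R) : 0 < v0 -> v0 <= v -> v <= 1 ->
  (step_poly v0 m).[v] @[m --> \oo] --> (0 : R).
Proof.
move=> v00 vv v1; apply: (squeeze_cvgr _ (cvg_cst 0) (@cvg_divn R 1)); near=> m.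
have v01 : 0 <= v <= 1 by rewrite v1 andbT (le_trans _ vv) // ltW.
have /andP[-> _] := step_poly01 v0 m v01.
have m0 : (0 < m)%N by near: m; exact: nbhs_infty_gt.
have mR : 0 < m%:R :> R by rewrite ltr0n.
have m2 : m%:R * v0 >= 1.
  by rewrite -ler_pdivrMr //; near: m; exact: nbhs_infty_ger.
have Dle : (stepD v0 m)%:R <= m%:R ^+ 3 * v - m%:R ^+ 2 :> R.
  have X0 : 0 <= (m ^ 3)%:R * v0 by rewrite mulr_ge0 // ltW.
  have := trunc_itv X0 => /andP[t1 t2].
  have t3 : (m ^ 2 <= Num.trunc ((m ^ 3)%:R * v0))%N.
    by rewrite truncn_ge_nat // !natrX exprS mulrAC -[leLHS]mul1r ler_wpM2r // exprn_ge0.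
  rewrite /stepD natrB // !natrX in t1 *.
  have := ler_wpM2l (exprn_ge0 3 (ltW mR)) vv; lra.
have lt : (stepD v0 m)%:R < (m ^ 3)%:R * v.
  by rewrite natrX; have : 0 < m%:R ^+ 2 :> R by [rewrite exprn_gt0]; lra.
have := bernstein_ub v01 (step_mono (stepD v0 m)) (step01 (stepD v0 m)) lt.
rewrite -step_polyE ltnn add0r => h; apply: (le_trans h).
have a0 : 0 < m%:R ^+ 2 :> R by rewrite exprn_gt0.
have gap : m%:R ^+ 2 <= (m ^ 3)%:R * v - (stepD v0 m)%:R by rewrite natrX; lra.
have gap2 : (m%:R ^+ 2) ^+ 2 <= ((m ^ 3)%:R * v - (stepD v0 m)%:R) ^+ 2.
  by apply: lerXn2r; rewrite ?nnegrE ?(ltW a0) // (le_trans _ gap) // ltW.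
have g0 : 0 < ((m ^ 3)%:R * v - (stepD v0 m)%:R) ^+ 2 by exact: lt_le_trans (exprn_gt0 2 a0) gap2.
rewrite ler_pdivrMr //; apply: (@le_trans _ _ (1 / m%:R * (m%:R ^+ 2) ^+ 2)); last first.
  by rewrite ler_wpM2l // divr_ge0.
have -> : 1 / m%:R * (m%:R ^+ 2) ^+ 2 = m%:R ^+ 3 :> R by field; rewrite gt_eqF.
by rewrite natrX -[leRHS]mulr1 ler_wpM2l // exprn_ge0.
Unshelve. all: by end_near. Qed.

Lemma step_poly_hi (v0 v : R) : 0 <= v -> v < v0 -> v0 <= 1 ->
  (step_poly v0 m).[v] @[m --> \oo] --> (1 : R).
Proof.
move=> v0' vv v1; pose dl := v0 - v; have dl0 : 0 < dl by rewrite subr_gt0.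
have c1 : 1 - 4 / dl ^+ 2 / m%:R @[m --> \oo] --> (1 : R).
  by rewrite -[X in _ --> X]subr0; apply: cvgB; [exact: cvg_cst|exact: cvg_divn].
apply: (squeeze_cvgr _ c1 (cvg_cst (1 : R))); near=> m.
have v01 : 0 <= v <= 1 by rewrite v0' (le_trans (ltW vv)).
have /andP[_ ->] := step_poly01 v0 m v01; rewrite andbT.
have m1 : (1 < m)%N by near: m; exact: nbhs_infty_gt.
have mR : 2 <= m%:R :> R by rewrite (ler_nat _ 2).
have m2 : 4 / dl <= m%:R.
  by near: m; exact: nbhs_infty_ger.
have mp : 0 < m%:R :> R by lra.
have h4 : 4 <= m%:R * dl by rewrite -ler_pdivrMr.
have X0 : 0 <= (m ^ 3)%:R * v0 by rewrite mulr_ge0 // (le_trans v0') // ltW.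
have := trunc_itv X0 => /andP[t1 t2].
have big : m%:R ^+ 3 * dl / 2 <= m%:R ^+ 3 * dl - m%:R ^+ 2 - 2 :> R.
  have : 4 * m%:R ^+ 2 <= m%:R ^+ 3 * dl.
    by rewrite exprS mulrAC ler_wpM2r // exprn_ge0.
  have : 2 ^+ 2 <= m%:R ^+ 2 :> R by apply: lerXn2r; rewrite ?nnegrE //; lra.
  lra.
have pos : 0 < m%:R ^+ 3 * dl / 2 :> R by rewrite divr_gt0 // mulr_gt0 // exprn_gt0.
have m3v : m%:R ^+ 3 * v >= 0 by rewrite mulr_ge0 // exprn_ge0.
have dlE : m%:R ^+ 3 * dl = m%:R ^+ 3 * v0 - m%:R ^+ 3 * v by rewrite /dl mulrBr.
have tge : (m ^ 2 < Num.trunc ((m ^ 3)%:R * v0))%N.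
  rewrite -(ltr_nat R); move: t2; rewrite -natr1 !natrX; lra.
have D0 : (0 < stepD v0 m)%N by rewrite /stepD subn_gt0.
have DE : (stepD v0 m).-1%:R = (Num.trunc ((m ^ 3)%:R * v0))%:R - m%:R ^+ 2 - 1 :> R.
  by rewrite -subn1 natrB // /stepD natrB ?(ltnW tge) //; congr (_ - _ - _); rewrite natrX.
have gap : m%:R ^+ 3 * dl / 2 <= (stepD v0 m).-1%:R - (m ^ 3)%:R * v.
  move: t2; rewrite DE -natr1 !natrX; lra.
have lt : (m ^ 3)%:R * v < (stepD v0 m).-1%:R by lra.
have := bernstein_lb v01 (step_mono (stepD v0 m)) (step01 (stepD v0 m)) lt.
rewrite -step_polyE prednK // leqnn => h; apply: le_trans h.
rewrite lerD2l lerN2.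
have gap2 : (m%:R ^+ 3 * dl / 2) ^+ 2 <= ((m ^ 3)%:R * v - (stepD v0 m).-1%:R) ^+ 2.
  by rewrite -[leRHS]sqrrN opprB; apply: lerXn2r; rewrite ?nnegrE ?(ltW pos) // (le_trans _ gap) // ltW.
have g0 : 0 < ((m ^ 3)%:R * v - (stepD v0 m).-1%:R) ^+ 2 by exact: lt_le_trans (exprn_gt0 2 pos) gap2.
rewrite ler_pdivrMr //; apply: (@le_trans _ _ (4 / dl ^+ 2 / m%:R * (m%:R ^+ 3 * dl / 2) ^+ 2)); last first.
  by rewrite ler_wpM2l // !divr_ge0 // exprn_ge0 // ltW.
have -> : 4 / dl ^+ 2 / m%:R * (m%:R ^+ 3 * dl / 2) ^+ 2 = m%:R ^+ 3 * m%:R ^+ 2 :> R.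
  by field; rewrite !gt_eqF.
rewrite natrX; apply: ler_wpM2l; first exact: exprn_ge0.
apply: (@le_trans _ _ 1); first by case/andP: v01.
by rewrite -[leLHS](expr1n _ 2); apply: lerXn2r; rewrite ?nnegrE //; lra.
Unshelve. all: by end_near. Qed.

(** The step is taken in the variable [exp (- t / 8)], which decreases in [t] and maps the half-line
    into the unit interval. *)
Lemma poly_indicator (th : R) : 0 <= th -> exists q : nat -> {poly R},
  (forall n (t : R), 0 <= t -> `|(q n).[t]| <= 2 * wt t) /\
  (forall t : R, 0 <= t -> (q n).[t] @[n --> \oo] --> ((th < t)%R%:R : R)).
Proof.
move=> th0; pose v (t : R) := expR (- (8^-1 * t)).
have v01 (t : R) : 0 <= t -> 0 <= v t <= 1.
  by move=> t0; rewrite expR_ge0 /= -[leRHS]expR0 ler_expR oppr_le0 mulr_ge0 // invr_ge0.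
have e0 n : 0 < n.+1%:R^-1 :> R by rewrite invr_gt0.
have ex n : exists q : {poly R}, forall t : R, 0 <= t ->
    `|(step_poly (v th) n).[v t] - q.[t]| <= n.+1%:R^-1 * wt t.
  exact: (approx_poly_exp (step_poly (v th) n) (e0 n)).
exists (fun n => projT1 (cid (ex n))); split=> [n t t0|t t0].
  case: cid => q /= hq; have /andP[s0 s1] := step_poly01 (v th) n (v01 t t0).
  have w1 : 1 <= wt t by rewrite -[leLHS]expR0 ler_expR mulr_ge0 // invr_ge0.
  have n1 : n.+1%:R^-1 <= 1 :> R by rewrite invf_le1 // ler1n.
  have := le_trans (hq t t0) (ler_wpM2r (expR_ge0 (4^-1 * t)) n1); rewrite mul1r => h.
  rewrite -[q.[t]](subKr (step_poly (v th) n).[v t]); apply: (le_trans (ler_normB _ _)).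
  rewrite (ger0_norm s0) mulr_natl mulr2n; apply: lerD => //; exact: le_trans w1.
have lim : (step_poly (v th) n).[v t] @[n --> \oo] --> ((th < t)%R%:R : R).
  have [tt|tt] := ltP th t.
    apply: step_poly_hi; rewrite ?expR_ge0 //; last by case/andP: (v01 _ th0).
    by rewrite ltr_expR ltrN2 ltr_pM2l // invr_gt0.
  apply: step_poly_lo; rewrite ?expR_gt0 //; last by case/andP: (v01 _ t0).
  by rewrite ler_expR lerN2 ler_pM2l // invr_gt0.
have err : (step_poly (v th) n).[v t] - (projT1 (cid (ex n))).[t] @[n --> \oo] --> (0 : R).
  apply/cvgr0Pnorm_lt => e ep; near=> n.
  case: cid => q /= hq; apply: (le_lt_trans (hq t t0)).
  near: n; have : wt t / n.+1%:R @[n --> \oo] --> (0 : R).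
    by have := @cvg_divn R (wt t); rewrite -cvg_shiftS.
  move=> /cvgr_lt /(_ _ ep); apply: filterS => n; by rewrite mulrC.
have : (step_poly (v th) n).[v t] - ((step_poly (v th) n).[v t] - (projT1 (cid (ex n))).[t]) @[n --> \oo] -->
   ((th < t)%R%:R - 0 : R) by exact: cvgB.
rewrite subr0.
by apply: cvg_trans; apply: near_eq_cvg; apply: nearW => n /=; rewrite subKr.
Unshelve. all: by end_near. Qed.

End WeightedApproximation.

Lemma Rintegral_lin_sum (R : realType) (d : measure_display) (T : measurableType d)
   (P : {measure set T -> \bar R}) (I : Type) (s : seq I) (c : I -> R) (F : I -> T -> R) :
  (forall i, P.-integrable setT (fun w => (F i w)%:E)) ->
  \int[P]_w (\sum_(i <- s) c i * F i w) = \sum_(i <- s) c i * \int[P]_w F i w.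
Proof.
move=> Fi.
suff [] : P.-integrable setT (fun w => (\sum_(i <- s) c i * F i w)%:E) /\
  \int[P]_w (\sum_(i <- s) c i * F i w) = \sum_(i <- s) c i * \int[P]_w F i w by [].
elim: s => [|i s [IH1 IH2]].
  split; first by under eq_fun do rewrite big_nil; exact: integrable0.
  by rewrite /Rintegral; under eq_integral do rewrite big_nil; rewrite integral0 big_nil.
have Zi := integrableZl measurableT (c i) (Fi i); split.
  have := integrableD measurableT Zi IH1.
  by congr (_ .-integrable _ _); apply/funext => w /=; rewrite big_cons EFinD EFinM.
under eq_Rintegral do rewrite big_cons.
rewrite big_cons RintegralD //; congr (_ + _); last exact: IH2.
by rewrite RintegralZl //; exact: Fi.
Qed.

(** * Even moments over two-sided tails *)

Section EvenTails.
Variable R : realType.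
Notation mu := (@lebesgue_measure R).
Local Notation phi := (@normal_pdf R 0 1).

Let f (a : nat) (x : R) : R := x ^+ (2 * a) * phi x.

Let f_ge0 a x : 0 <= f a x.
Proof. by rewrite mulr_ge0 ?phi_ge0 // exprM exprn_ge0 // sqr_ge0. Qed.

Let f_cont a : continuous (f a).
Proof. by move=> x; apply: cvgM; [exact: exprn_continuous|exact: continuous_phi]. Qed.

Let f_meas a : measurable_fun setT (f a).
Proof. exact: continuous_measurable_fun. Qed.

Let f_even a x : f a (- x) = f a x.
Proof.
rewrite /f phiE sqrrN -phiE; congr (_ * _).
by rewrite !exprM sqrrN.
Qed.

Let gtailE a v : (\int[mu]_(u in `]v, +oo[) (f a u)%:E = (gtail a v)%:E)%E.
Proof.
rewrite /gtail /Rintegral fineK //; apply: integrable_fin_num => //.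
by apply: integrableS (integrable_pow_phi R (2 * a)) => //; exact: measurable_itv.
Qed.

Lemma gmom_gtail a : gmom R (2 * a) = 2 * gtail a 0.
Proof.
have := @ge0_symfun_integralT R (f a) (f_ge0 a) (f_cont (a := a)) (fun x => esym (f_even a x)).
have -> : [set x : R | 0 <= x] = `[0, +oo[%classic by rewrite set_itvcy.
rewrite -integral_itv_obnd_cbnd; last by apply/measurable_EFinP; exact: measurable_funTS.
by rewrite gtailE -EFinM /gmom /gexp /Rintegral => ->.
Qed.

Lemma gexp_tail a (c : R) : 0 <= c ->
  gexp (fun x : R => x ^+ (2 * a) * (c < `|x|)%R%:R) = 2 * gtail a c.
Proof.
move=> c0; rewrite /gexp /Rintegral.
have -> : (\int[mu]_x (x ^+ (2 * a) * (c < `|x|)%R%:R * phi x)%:E =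
   \int[mu]_(x in `]-oo, (- c)%R[ `|` `]c, +oo[) (f a x)%:E)%E.
  rewrite [RHS]integral_mkcond; apply: eq_integral => x _; rewrite patchE.
  have -> : (x \in `]-oo, (- c)%R[ `|` `]c, +oo[) = (c < `|x|).
    apply/idP/idP; rewrite ltr_normr.
      by rewrite inE /= => -[]; rewrite in_itv /= ?andbT => h; apply/orP; [right; rewrite ltrNr|left].
    by case/orP=> h; rewrite inE /=; [right|left]; rewrite in_itv /= ?andbT // ltrNr.
  by case: (c < `|x|); rewrite ?mulr1 ?mulr0 ?mul0r.
rewrite ge0_integral_setU //.
- rewrite integral_itv_bndo_bndc; last by apply/measurable_EFinP; exact: measurable_funTS.
  rewrite ge0_integration_by_substitutionNy; last 2 first.
  + exact: continuous_subspaceT.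
  + by move=> x _; exact: f_ge0.
  rewrite -integral_itv_obnd_cbnd; last first.
    apply/measurable_EFinP; apply: measurable_funTS.
    by rewrite (_ : _ \o _ = f a) //; apply/funext => x /=; rewrite f_even.
  have -> : (\int[mu]_(x in `]c, +oo[) ((f a \o -%R) x)%:E = (gtail a c)%:E)%E.
    by rewrite -gtailE; apply: eq_integral => x _ /=; rewrite f_even.
  by rewrite gtailE -EFinD /= mulr_natl mulr2n.
- apply/measurable_EFinP; apply: measurable_funTS; exact: f_meas.
- by move=> x _; rewrite lee_fin.
- apply/disj_setPS => x /= []; rewrite !in_itv /= andbT => h1 h2; lra.
Qed.

End EvenTails.

(** * Andreief's identity *)

Section Andreief.
Variables (R : realType) (d : measure_display) (T : measurableType d) (P : probability T R).
Variables (n : nat) (Z : 'I_n -> T -> R).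
Hypothesis mZ : forall e, measurable_fun setT (Z e).
Hypothesis lawZ : forall e (B : set R), measurable B -> P (Z e @^-1` B) = normal_prob 0 1 B.
Hypothesis indZ : forall B : 'I_n -> set R, (forall e, measurable (B e)) ->
  fine (P [set w | forall e, B e (Z e w)]) = \prod_e fine (P (Z e @^-1` B e)).
Variables (k : nat) (u : 'I_k -> 'I_n).
Hypothesis u_inj : injective u.

Lemma gint1 : @gint R (fun=> 1).
Proof.
by have := gint_pow R 0; congr gint; apply/funext => x; rewrite expr0.
Qed.

Lemma gexp1 : gexp (fun=> 1 : R) = 1.
Proof. by rewrite -[RHS](gmom0 R) /gmom; congr gexp; apply/funext => x; rewrite expr0. Qed.

(** One factor per variable of the whole family, equal to 1 at those that [u] misses, so that
    independence of the family applies. *)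
Let F (g : 'I_k -> R -> R) (e : 'I_n) (x : R) := \prod_(b | u b == e) g b x.

Let FE g e : F g e = if [pick b | u b == e] is Some b then g b else fun=> 1.
Proof.
apply/funext => x; rewrite /F; case: pickP => [b /eqP ube|h]; last by rewrite big_pred0.
by rewrite (big_pred1 b) // => b' /=; rewrite -ube (inj_eq u_inj).
Qed.

Let prodF g w : \prod_e F g e (Z e w) = \prod_b g b (Z (u b) w).
Proof.
rewrite [RHS](partition_big u predT) //=; apply: eq_bigr => e _.
by apply: eq_bigr => b /eqP ->.
Qed.

Let gintF g : (forall b, gint (g b)) -> forall e, gint (F g e).
Proof. by move=> gi e; rewrite FE; case: pickP => [b _|_]; [exact: gi|exact: gint1]. Qed.

Lemma sub_integrable (g : 'I_k -> R -> R) : (forall b, gint (g b)) ->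
  P.-integrable setT (fun w => (\prod_b g b (Z (u b) w))%:E).
Proof.
move=> gi; have := prod_integrable mZ lawZ indZ (gintF gi).
by congr (_ .-integrable _ _); apply/funext => w; rewrite prodF.
Qed.

Lemma sub_indep (g : 'I_k -> R -> R) : (forall b, gint (g b)) ->
  \int[P]_w (\prod_b g b (Z (u b) w)) = \prod_b gexp (g b).
Proof.
move=> gi; have := indep mZ lawZ indZ (gintF gi) => h.
rewrite /Rintegral; under eq_integral do rewrite -prodF.
rewrite h /= [RHS](partition_big u predT) //=; apply: eq_bigr => e _.
rewrite FE; case: pickP => [b /eqP ube|hb]; last by rewrite big_pred0 // gexp1.
by rewrite (big_pred1 b) // => b' /=; rewrite -ube (inj_eq u_inj).
Qed.

Definition vdm_real (w : T) : R :=
  \prod_(i < k) \prod_(l < k | (i < l)%N) (Z (u i) w ^+ 2 - Z (u l) w ^+ 2).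

Lemma vdm_real_sqr w : vdm_real w ^+ 2 =
  \sum_(st : 'S_k * 'S_k) (-1) ^+ st.1 * (-1) ^+ st.2 *
     \prod_b Z (u b) w ^+ (2 * (st.1 b + st.2 b)).
Proof.
pose a : 'rV[R]_k := \row_b (Z (u b) w ^+ 2).
have -> : vdm_real w ^+ 2 = (\det (Vandermonde k a)^T) ^+ 2.
  rewrite det_tr det_Vandermonde /vdm_real -!prodrXl; apply: eq_bigr => i _.
  by rewrite -!prodrXl; apply: eq_bigr => j _; rewrite !mxE -sqrrN opprB.
rewrite expr2 /determinant mulr_suml.
rewrite -(pair_bigA _ (fun s t : 'S_k => (-1) ^+ s * (-1) ^+ t * \prod_b Z (u b) w ^+ (2 * (s b + t b)))) /=.
apply: eq_bigr => s _; rewrite mulr_sumr; apply: eq_bigr => t _.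
rewrite mulrACA -big_split /=; congr (_ * _); apply: eq_bigr => b _.
by rewrite !mxE -exprD exprM.
Qed.

(** The squared Vandermonde determinant is a double sum over permutations. For each first
    permutation the sum over the second is the same determinant with permuted rows, so all [k!]
    contributions are equal. *)
Lemma andreief (g : R -> R) : (forall a, gint (fun x => x ^+ (2 * a) * g x)) ->
  \int[P]_w (vdm_real w ^+ 2 * \prod_b g (Z (u b) w)) =
  k`!%:R * \det (\matrix_(i < k, j < k) gexp (fun x => x ^+ (2 * (i + j)) * g x)).
Proof.
move=> gi; pose M := \matrix_(i < k, j < k) gexp (fun x => x ^+ (2 * (i + j)) * g x).
pose G (st : 'S_k * 'S_k) w := \prod_b (Z (u b) w ^+ (2 * (st.1 b + st.2 b)) * g (Z (u b) w)).
transitivity (\int[P]_w (\sum_(st : 'S_k * 'S_k) ((-1) ^+ st.1 * (-1) ^+ st.2) * G st w)).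
  apply: eq_Rintegral => w _; rewrite vdm_real_sqr mulr_suml; apply: eq_bigr => st _.
  by rewrite -[LHS]mulrA -big_split.
rewrite Rintegral_lin_sum; last first.
  move=> st; apply: (@sub_integrable (fun b x => x ^+ (2 * (st.1 b + st.2 b)) * g x)) => b; exact: gi.
have GE st : \int[P]_w G st w = \prod_b M (st.1 b) (st.2 b).
  rewrite (@sub_indep (fun b x => x ^+ (2 * (st.1 b + st.2 b)) * g x)) => [|b]; last exact: gi.
  by apply: eq_bigr => b _; rewrite mxE.
under eq_bigr do rewrite GE.
rewrite -(pair_bigA _ (fun s t : 'S_k => (-1) ^+ s * (-1) ^+ t * \prod_b M (s b) (t b))) /=.
transitivity (\sum_(s : 'S_k) \det M).
  apply: eq_bigr => s _; transitivity ((-1) ^+ s * \det (row_perm s M)).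
    rewrite /determinant mulr_sumr; apply: eq_bigr => t _; rewrite -mulrA; congr (_ * (_ * _)).
    by apply: eq_bigr => b _; rewrite [RHS]mxE.
  by rewrite row_permE det_mulmx det_perm mulrA -expr2 sqrr_sign mul1r.
rewrite sumr_const mulr_natl; congr (_ *+ _).
by rewrite -card_Sn; apply: eq_card => s; rewrite !inE.
Qed.

End Andreief.

(** * Spectrum of the aGUE matrix *)

Lemma conjugate_diag_exp (F : fieldType) l (Q : 'M[F]_l) (d : 'rV[F]_l) r : Q \in unitmx ->
  (invmx Q *m diag_mx d *m Q) ^+ r = invmx Q *m diag_mx (\row_i d 0 i ^+ r) *m Q.
Proof.
move=> Qu; elim: r => [|r IH].
  rewrite expr0 (_ : \row_i _ = const_mx 1) ?diag_const_mx ?mulmx1 ?mulVmx //.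
  by apply/rowP => i; rewrite !mxE expr0.
rewrite exprS IH -mulmxE !mulmxA mulmxK //; congr (_ *m _).
rewrite -!mulmxA; congr (_ *m _); rewrite mulmx_diag; congr diag_mx.
by apply/rowP => i; rewrite !mxE exprS.
Qed.

Lemma map_mx_exp (A B : nzRingType) (f : {rmorphism A -> B}) l (M : 'M[A]_l) r :
  map_mx f (M ^+ r) = (map_mx f M) ^+ r.
Proof.
elim: r => [|r IH]; first by rewrite !expr0 map_mx1.
by rewrite !exprS -IH -!mulmxE map_mxM.
Qed.

Lemma scale_mx_exp (A : comNzRingType) l (M : 'M[A]_l) (c : A) r :
  (c *: M) ^+ r = c ^+ r *: M ^+ r.
Proof.
elim: r => [|r IH]; first by rewrite !expr0 scale1r.
by rewrite exprS IH -mulmxE -scalemxAl -scalemxAr scalerA mulmxE -!exprS.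
Qed.

Section AntisymmetricSpectrum.
Variables (R : realType) (l : nat) (y : 'I_l -> 'I_l -> R).
Local Notation C := R[i].
Local Notation H := (aGUE y).

Definition antisym_mx : 'M[R]_l := \matrix_(i, j) (2^-1 * (y i j - y j i)).
Local Notation M := antisym_mx.

Definition eig (i : 'I_l) : R := complex.Re (spectral_diag H 0 i).

Lemma aGUE_antisym : H = 'i%C *: map_mx (@real_complex R) M.
Proof.
apply/matrixP => i j; rewrite !mxE rmorphM rmorphB /= fmorphV /= rmorph_nat.
by rewrite mulrA.
Qed.

Lemma aGUE_herm : H \is hermsymmx.
Proof.
apply/is_hermitianmxP; rewrite expr0 scale1r; apply/matrixP => i j; rewrite !mxE.
rewrite !rmorphM rmorphB /= fmorphV rmorph_nat /=.
have cr (x : R) : Num.conj (x%:C)%C = (x%:C)%C by exact: conjc_real.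
by rewrite !cr conjCi; ring.
Qed.

Lemma spectral_aGUE : H = invmx (spectralmx H) *m diag_mx (\row_i (eig i)%:C%C) *m spectralmx H.
Proof.
have -> : \row_i (eig i)%:C%C = spectral_diag H.
  apply/rowP => i; rewrite mxE /eig.
  by have /mxOverP/(_ 0 i)/complex_realP[x ->] := hermitian_spectral_diag_real aGUE_herm.
exact/orthomx_spectralP/hermitian_normalmx/aGUE_herm.
Qed.

Lemma eigenvalue_aGUE (t : R) : eigenvalue H t%:C%C <-> exists i, eig i = t.
Proof.
have Pu := spectral_unit H; have HE := spectral_aGUE.
set Q := spectralmx H in Pu HE; set D := diag_mx _ in HE.
split.
  case/eigenvalueP => v vH v0.
  have u0 : v *m invmx Q != 0.
    by apply: contra_neq v0 => e; rewrite -[v](mulmxKV Pu) e mul0mx.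
  have uD : v *m invmx Q *m D = (t%:C)%C *: (v *m invmx Q).
    by rewrite scalemxAl -vH [in RHS]HE !mulmxA mulmxK.
  have /rV0Pn[i ui] := u0; exists i.
  move/rowP: uD => /(_ i); rewrite mul_mx_diag !mxE mulrC.
  have /mulIf h : (v *m invmx Q) 0 i != 0 by [].
  by rewrite mxE in h; move/h => -[].
case=> i <-; apply/eigenvalueP; exists (row i Q).
  rewrite -row_mul {1}HE !mulmxA mulmxV // mul1mx row_mul.
  have -> : row i D = (eig i)%:C%C *: delta_mx 0 i.
    apply/rowP => j; rewrite !mxE eqxx /= eq_sym; by case: eqP => _; rewrite ?mulr1 ?mulr0.
  by rewrite -scalemxAl -rowE.
apply: contraTneq Pu => q0; rewrite -row_free_unit -kermx_eq0.
apply/eqP => k0; have : (delta_mx 0 i : 'rV[C]_l) = 0.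
  by apply/eqP; rewrite -submx0 -k0; apply/sub_kermxP; rewrite -rowE.
by move/matrixP => /(_ 0 i)/eqP; rewrite !mxE !eqxx oner_eq0.
Qed.

(** The matrix is ['i] times a real one, so conjugation changes its sign, and conjugate eigenvectors
    have opposite eigenvalues. *)
Lemma eig_opp (i : 'I_l) : exists j, eig j = - eig i.
Proof.
have /eigenvalue_aGUE/eigenvalueP[v vH v0] : exists j, eig j = eig i by exists i.
apply/eigenvalue_aGUE/eigenvalueP; exists (map_mx (@conjc R) v); last by rewrite map_mx_eq0.
have HN : map_mx (@conjc R) H = - H.
  by apply/matrixP => a b; rewrite !mxE; simpc.
rewrite -[H]opprK -HN mulmxN -map_mxM vH.
by rewrite map_mxZ rmorphN scaleNr; congr (- (_ *: _)); exact: conjc_real.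
Qed.

Lemma mxtrace_aGUE r : \tr (H ^+ r) = \sum_i ((eig i)%:C%C) ^+ r.
Proof.
rewrite {1}spectral_aGUE conjugate_diag_exp ?spectral_unit //.
rewrite mxtrace_mulC mulmxA mulmxV ?spectral_unit // mul1mx mxtrace_diag.
by apply: eq_bigr => i _; rewrite !mxE.
Qed.

Lemma sum_eig_sqr j : \sum_i (eig i ^+ 2) ^+ j = (-1) ^+ j * \tr (M ^+ (2 * j)).
Proof.
have : \tr (H ^+ (2 * j)) = (((-1) ^+ j * \tr (M ^+ (2 * j)))%:C)%C.
  have -> : H ^+ (2 * j) = (-1) ^+ j *: map_mx (@real_complex R) (M ^+ (2 * j)).
    by rewrite aGUE_antisym scale_mx_exp exprM sqr_i -map_mx_exp.
  rewrite mxtraceZ trace_map_mx rmorphM rmorphXn rmorphN1.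
  by [].
rewrite mxtrace_aGUE => h; apply: (@complexI R); rewrite -h rmorph_sum.
by apply: eq_bigr => i _; rewrite -exprM rmorphXn.
Qed.

(** The left side is the squared Frobenius norm of the antisymmetric part of [y]; the difference is
    that of the symmetric part. *)
Lemma sum_eig_sqr_le : \sum_i eig i ^+ 2 <= \sum_i \sum_j y i j ^+ 2.
Proof.
have -> : \sum_i eig i ^+ 2 = \sum_i \sum_j M i j ^+ 2.
  have := sum_eig_sqr 1; under eq_bigr do rewrite expr1.
  move=> ->; rewrite expr1 mulN1r muln1 expr2 /mxtrace -sumrN; apply: eq_bigr => i _.
  rewrite mxE -sumrN; apply: eq_bigr => j _; rewrite !mxE; ring.
have -> : \sum_i \sum_j y i j ^+ 2 = \sum_i \sum_j (2^-1 * y i j ^+ 2 + 2^-1 * y j i ^+ 2).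
  under [RHS]eq_bigr do rewrite big_split /=.
  rewrite big_split /= [X in _ = _ + X]exchange_big /= -big_split; apply: eq_bigr => i _ /=.
  by rewrite -big_split; apply: eq_bigr => j _ /=; field.
apply: ler_sum => i _; apply: ler_sum => j _; rewrite mxE.
rewrite -subr_ge0.
have -> : 2^-1 * y i j ^+ 2 + 2^-1 * y j i ^+ 2 - (2^-1 * (y i j - y j i)) ^+ 2
   = (2^-1 * (y i j + y j i)) ^+ 2 by field.
exact: sqr_ge0.
Qed.

(* Zero eigenvalues are ignored by [smallest_pos_eig], hence the first alternative. *)
Lemma smallest_pos_eig_gt (t : R) : 0 < t ->
  ((t%:E < smallest_pos_eig H)%E <-> forall i, eig i ^+ 2 = 0 \/ t ^+ 2 < eig i ^+ 2).
Proof.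
move=> t0; split.
  move=> h i; have [e0|e0] := eqVneq (eig i) 0; first by left; rewrite e0 expr0n.
  right; rewrite -[ltRHS]ger0_norm ?sqr_ge0 // normrX.
  have e1 : eigenvalue H (`|eig i|%:C)%C.
    apply/eigenvalue_aGUE; have [j ej] := eig_opp i.
    by case: (ger0P (eig i)) => _; [exists i|exists j].
  have : (t%:E < `|eig i|%:E)%E.
    apply: (lt_le_trans h); apply: ereal_inf_lbound; exists `|eig i| => //.
    by split=> //; rewrite normr_gt0.
  by rewrite lte_fin => lt; rewrite ltrXn2r // ?nnegrE ?normr_ge0 // ltW.
move=> h.
(* The spectrum is finite, so the infimum stays away from [t]; the default [t + 1] covers the
   absence of eigenvalues above [t]. *)
pose m := \big[Num.min/(t + 1)]_(i | t < eig i) eig i.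
have tm : t < m by apply: lt_bigmin => //; rewrite ltrDl.
apply: (@lt_le_trans _ _ m%:E); first by rewrite lte_fin.
apply/le_ereal_inf_tmp => _ [s [s0 /eigenvalue_aGUE[i ei]] <-]; rewrite lee_fin.
rewrite -ei; apply: bigmin_le_cond; rewrite ei.
case: (h i) => [/eqP|]; rewrite ei; first by rewrite sqrf_eq0 gt_eqF.
by rewrite ltr_pXn2r // nnegrE ltW.
Qed.

End AntisymmetricSpectrum.

(** * Dominated convergence and doubled index sets *)

Lemma Rintegral_dominated_cvg (R : realType) (d : measure_display) (T : measurableType d)
    (mu : {measure set T -> \bar R}) (f_ : nat -> T -> R) (f g : T -> R) :
  (forall m, measurable_fun setT (f_ m)) ->
  (forall x, f_ m x @[m --> \oo] --> f x) ->
  mu.-integrable setT (fun x => (g x)%:E) -> (forall m x, `|f_ m x| <= g x) ->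
  \int[mu]_x f_ m x @[m --> \oo] --> \int[mu]_x f x.
Proof.
move=> mf ff gi fg.
have mff : measurable_fun setT f by apply: (measurable_fun_cvg mf) => x _; exact: ff.
have [||||fi _ c] := @dominated_convergence _ _ _ mu _ measurableT
  (fun m x => (f_ m x)%:E) (fun x => (f x)%:E) (fun x => (g x)%:E) _ _ _ gi.
- by move=> m; exact/measurable_EFinP.
- exact/measurable_EFinP.
- by apply: aeW => x _; apply: cvg_EFin; [exact: nearW|exact: ff].
- by apply: aeW => x m _; rewrite abse_EFin lee_fin.
by apply: fine_cvg; rewrite fineK //; exact: integrable_fin_num.
Qed.

Lemma gexp_dominated_cvg (R : realType) (f_ : nat -> R -> R) (f g : R -> R) :
  (forall m, measurable_fun setT (f_ m)) -> (forall x, f_ m x @[m --> \oo] --> f x) ->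
  lebesgue_measure.-integrable setT (fun x : R => (g x * normal_pdf 0 1 x)%:E) ->
  (forall m x, `|f_ m x| <= g x) ->
  gexp (f_ m) @[m --> \oo] --> gexp f.
Proof.
move=> mf ff gi fg.
apply: (@Rintegral_dominated_cvg R _ _ (@lebesgue_measure R) (fun m x => f_ m x * normal_pdf 0 1 x)
  (fun x => f x * normal_pdf 0 1 x) (fun x => g x * normal_pdf 0 1 x)) => //.
- by move=> m; apply: measurable_funM; [exact: mf|exact: measurable_phi].
- by move=> x; apply: cvgM; [exact: ff|exact: cvg_cst].
- have key m (x : R) : `|f_ m x * normal_pdf 0 1 x| <= g x * normal_pdf 0 1 x.
    by rewrite normrM (ger0_norm (phi_ge0 x)) ler_wpM2r ?phi_ge0.
  by move=> m x; exact: key.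
Qed.

(** Reduction modulo [k] meets each index twice, which models the pairs of opposite eigenvalues. *)
Lemma big_mod2 (V : Type) (idx : V) (op : Monoid.com_law idx) k (k0 : (0 < k)%N) (F : 'I_k -> V) :
  \big[op/idx]_(i < 2 * k) F (Ordinal (ltn_pmod i k0)) =
  op (\big[op/idx]_(b < k) F b) (\big[op/idx]_(b < k) F b).
Proof.
rewrite mul2n -addnn big_split_ord /=; congr (op _ _); apply: eq_bigr => b _; congr F; apply: val_inj => /=.
  by rewrite modn_small.
by rewrite modnDl modn_small.
Qed.

(** * Law of the smallest positive eigenvalue *)

Section SmallestEigenvalue.
Variables (R : realType) (d : measure_display) (T : measurableType d) (P : probability T R).
Variables (k : nat) (Y : 'I_(2 * k) -> 'I_(2 * k) -> T -> R).
Hypothesis k0 : (0 < k)%N.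
Hypothesis HY : iid_std_gaussian P Y.
Notation mu := (@lebesgue_measure R).
Local Notation phi := (@normal_pdf R 0 1).
Local Notation l := (2 * k)%N.
Local Notation n := (2 * k * (2 * k))%N.
Local Notation A := (mpoly.mpoly n R).

Let Z (t : 'I_n) (w : T) : R := mxvec (\matrix_(i, j) Y i j w) 0 t.

Let Z_index i j : Z (mxvec_index i j) = Y i j.
Proof. by apply/funext => w; rewrite /Z mxvecE mxE. Qed.

Let mZ t : measurable_fun setT (Z t).
Proof. by case/mxvec_indexP: t => i j; rewrite Z_index; case: HY. Qed.

Let lawZ t (B : set R) : measurable B -> P (Z t @^-1` B) = normal_prob 0 1 B.
Proof. by case/mxvec_indexP: t => i j; rewrite Z_index; case: HY => _ h _; exact: h. Qed.

Let big_index (V : Type) (idx : V) (op : Monoid.com_law idx) (F : 'I_n -> V) :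
  \big[op/idx]_t F t = \big[op/idx]_i \big[op/idx]_j F (mxvec_index i j).
Proof.
rewrite pair_bigA (reindex _ (curry_mxvec_bij _ _)) /=.
by apply: eq_bigr => -[i j] _.
Qed.

Let indZ (B : 'I_n -> set R) : (forall e, measurable (B e)) ->
  fine (P [set w | forall e, B e (Z e w)]) = \prod_e fine (P (Z e @^-1` B e)).
Proof.
move=> mB; rewrite big_index; case: HY => _ _ h.
have := h (fun i j => B (mxvec_index i j)) (fun i j => mB _).
under [in X in _ -> X]eq_bigr do under eq_bigr do rewrite Z_index.
move=> <-; congr (fine (P _)); apply/seteqP; split => w /= hw.
  by move=> i j; have := hw (mxvec_index i j); rewrite Z_index.
by move=> t; case/mxvec_indexP: t => i j; rewrite Z_index.
Qed.

Let mxvec_index_eq (a b c e : 'I_l) :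
  (mxvec_index a b == mxvec_index c e) = (a == c) && (b == e).
Proof.
apply/eqP/andP => [|[/eqP-> /eqP->] //].
have [g gK _] := curry_mxvec_bij l l => h.
have := gK (a, b) isT; have := gK (c, e) isT; rewrite /= h => -> [-> ->].
by rewrite !eqxx.
Qed.

Let var (t : 'I_n) : A := mpoly.mpolyX R (mpoly.mnm1 t).

Let deriv_var s t : mpoly.mderiv s (var t) = (s == t)%:R.
Proof.
rewrite /var mpoly.mderivX mpoly.mnm1E eq_sym; case: eqP => [->|_]; last by rewrite scale0r.
have -> : mpoly.mnm_sub (mpoly.mnm1 t) (mpoly.mnm1 t) = mpoly.mnm0 :> mpoly.multinom n.
  by apply/mpoly.mnmP => i; rewrite mpoly.mnmBE subnn mpoly.mnm0E.
by rewrite mpoly.mpolyX0 scale1r.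
Qed.

Let deriv_lin s (t : R) (x y : A) :
  mpoly.mderiv s (t *: x + y) = t *: mpoly.mderiv s x + mpoly.mderiv s y.
Proof. by rewrite mpoly.mderivD mpoly.mderivZ. Qed.

Let X (a b : 'I_l) : A := var (mxvec_index a b).
Let DX (a b : 'I_l) : A -> A := mpoly.mderiv (mxvec_index a b).

Let trace_system : loop_system l%:R (mE P Z) (trace_p X) (trace_D X DX).
Proof.
apply: matrix_loop_system.
- by move=> a b t x y; exact: deriv_lin.
- by move=> a b x y; exact: mpoly.mderivM.
- by move=> a b c e; rewrite /DX deriv_var mxvec_index_eq.
- exact: mE_lin mZ lawZ indZ.
- exact: mE_1 mZ lawZ indZ.
- by move=> a b F; exact: (mE_ibp mZ lawZ indZ).
Qed.

Let wd (b : 'I_k) : 'I_l := widen_ord (leq_pmull k (isT : (0 < 2)%N)) b.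
(** The [k] independent Gaussians of the Vandermonde side are diagonal entries of [Y], so that both
    expectations live on the same probability space. *)
Let cu (b : 'I_k) : 'I_n := mxvec_index (wd b) (wd b).

Let cu_inj : injective cu.
Proof.
by move=> a b /eqP; rewrite mxvec_index_eq andbb => /eqP/(congr1 val) /= h; exact: val_inj.
Qed.

Let U (b : 'I_k) : A := var (cu b).

Let mevM w p q : mev Z w (p * q) = mev Z w p * mev Z w q.
Proof. exact: mpoly.mevalM. Qed.
Let mev1 w : mev Z w 1 = 1.
Proof. exact: mpoly.meval1. Qed.
Let mev_var w t : mev Z w (var t) = Z t w.
Proof. exact: mpoly.mevalXU. Qed.
Let mevD w p q : mev Z w (p + q) = mev Z w p + mev Z w q.
Proof. exact: mpoly.mevalD. Qed.
Let mev0 w : mev Z w 0 = 0.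
Proof. exact: mpoly.meval0. Qed.
Let mevZ w (c : R) p : mev Z w (c *: p) = c * mev Z w p.
Proof. exact: mpoly.mevalZ. Qed.
Let mevX w p r : mev Z w (p ^+ r) = mev Z w p ^+ r.
Proof. by elim: r => [|r IH]; rewrite ?expr0 ?mev1 // !exprS mevM IH. Qed.
Let mev_prod w (I : Type) (s : seq I) (Q : pred I) (F : I -> A) :
  mev Z w (\prod_(i <- s | Q i) F i) = \prod_(i <- s | Q i) mev Z w (F i).
Proof. exact: (big_morph _ (mevM w) (mev1 w)). Qed.

Let sq (w : T) (i : 'I_l) : R := eig (fun i j => Y i j w) i ^+ 2.

Let sq_ge0 w i : 0 <= sq w i. Proof. exact: sqr_ge0. Qed.

Let mev_trace w j : mev Z w (trace_p X j) = psum (sq w) j.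
Proof.
rewrite /psum /sq sum_eig_sqr /trace_p mevM mevX; congr (_ ^+ _ * _).
  by rewrite -scaleN1r mevZ mev1 mulr1.
rewrite /trace_pow /mev -trace_map_mx.
rewrite (map_mx_exp (mpoly.meval (Z^~ w) : {rmorphism A -> R})); congr (\tr (_ ^+ _)).
apply/matrixP => a b; rewrite !mxE.
transitivity (mev Z w (2^-1 *: (X a b - X b a))); first by [].
by rewrite mevZ mevD -scaleN1r mevZ !mev_var !Z_index mulN1r.
Qed.

Let hz (w : T) (i : 'I_l) : R := Z (cu (Ordinal (ltn_pmod i k0))) w ^+ 2 / 2.

Let mev_diag w j : mev Z w (diag_p U j) = psum (hz w) j.
Proof.
rewrite /psum /hz (big_mod2 (+%R : Monoid.com_law (0 : R)) k0 (fun b => (Z (cu b) w ^+ 2 / 2) ^+ j)) /=.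
rewrite -mulr2n -[RHS]mulr_natl /diag_p mevZ (big_morph _ (mevD w) (mev0 w)) -mulrA; congr (_ * _).
rewrite mulr_sumr; apply: eq_bigr => b _; rewrite mevX mev_var expr_div_n -exprM mulrC.
by [].
Qed.

Let mev_vdm w : mev Z w (vdm2 U) = vdm_real Z cu w.
Proof.
rewrite /vdm2 mev_prod; apply: eq_bigr => i _; rewrite mev_prod; apply: eq_bigr => j _.
by rewrite mevD -scaleN1r mevZ mulN1r !mevX !mev_var.
Qed.

Let gmom_mx : \det (\matrix_(i < k, j < k) gexp (fun x : R => x ^+ (2 * (i + j)) * 1)) =
  2 ^+ k * \det (gmat k (0 : R)).
Proof.
rewrite -detZ; congr (\det _); apply/matrixP => i j; rewrite !mxE -gmom_gtail /gmom.
by congr gexp; apply/funext => x; rewrite mulr1.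
Qed.

Let EV : mE P Z (vdm2 U ^+ 2) = k`!%:R * (2 ^+ k * \det (gmat k (0 : R))).
Proof.
rewrite -gmom_mx -(andreief mZ lawZ indZ cu_inj) => [|a].
  by apply: eq_Rintegral => w _; rewrite mevX mev_vdm big1 ?mulr1.
by have := gint_pow R (2 * a); congr gint; apply/funext => x; rewrite mulr1.
Qed.

Let EV_neq0 : mE P Z (vdm2 U ^+ 2) != 0.
Proof.
by rewrite EV !mulf_neq0 ?expf_neq0 ?pnatr_eq0 -?lt0n ?fact_gt0 ?gmat0_neq0.
Qed.

Let diag_system : loop_system l%:R (diag_E U (mE P Z)) (diag_p U)
  (diag_D U (fun b => mpoly.mderiv (cu b))).
Proof.
apply: diag_loop_system => //.

- by move=> a x y; exact: mpoly.mderivM.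
- by move=> a b; rewrite deriv_var (inj_eq cu_inj).
- exact: mE_lin mZ lawZ indZ.
- by move=> a F; exact: (mE_ibp mZ lawZ indZ).
Qed.

Let stat (q : {poly R}) (w : T) : R := \prod_i q.[sq w i].

Let mev_ev w p (pe : seq (R * seq nat)) (f : nat -> R) : (forall j, mev Z w (p j) = f j) ->
  ev f pe = \sum_(c <- pe) c.1 * mev Z w (\prod_(j <- c.2) p j).
Proof.
move=> h; apply: eq_bigr => c _; rewrite mev_prod; congr (_ * _).
by apply: eq_bigr => j _; rewrite h.
Qed.

(** Written through traces the statistic is a polynomial in the entries; no measurable choice of
    eigenvalues is involved. *)
Let measurable_stat q : measurable_fun setT (stat q).
Proof.
have [pe hpe] := rep_prod_poly l q.
have -> : stat q = fun w => \sum_(c <- pe) c.1 * mev Z w (\prod_(j <- c.2) trace_p X j).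
  by apply/funext => w; rewrite /stat hpe (@mev_ev w (trace_p X)).
elim: pe {hpe} => [|c pe IH]; first by under eq_fun do rewrite big_nil; exact: measurable_cst.
under eq_fun do rewrite big_cons; apply: measurable_funD => //.
apply: measurable_funM; first exact: measurable_cst.
by apply/measurable_EFinP; exact: measurable_int (integrable_mev mZ lawZ indZ _).
Qed.

(** One polynomial in the power sums has the same expectation on both sides, by uniqueness for the
    loop equations. On the Vandermonde side the doubled values turn the product into [q ^+ 2] over
    [k] variables. *)
Let stat_integral q : (forall a, gint (fun x : R => x ^+ (2 * a) * q.[x ^+ 2 / 2] ^+ 2)) ->
  \int[P]_w stat q w =
  \det (\matrix_(i < k, j < k) gexp (fun x : R => x ^+ (2 * (i + j)) * q.[x ^+ 2 / 2] ^+ 2))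
   / (2 ^+ k * \det (gmat k (0 : R))).
Proof.
move=> gi; have [pe hpe] := rep_prod_poly l q.
have im p : P.-integrable setT (fun w => (mev Z w p)%:E) by exact: integrable_mev.
transitivity (\sum_(c <- pe) c.1 * mE P Z (\prod_(j <- c.2) trace_p X j)).
  rewrite /mE -Rintegral_lin_sum //; apply: eq_Rintegral => w _.
  by rewrite /stat hpe (@mev_ev w (trace_p X)).
transitivity ((\sum_(c <- pe) c.1 * mE P Z (vdm2 U ^+ 2 * \prod_(j <- c.2) diag_p U j))
     / mE P Z (vdm2 U ^+ 2)).
  rewrite mulr_suml; apply: eq_bigr => c _.
  by rewrite (loop_unique _ trace_system diag_system) /diag_E mulrA.
rewrite /mE -Rintegral_lin_sum // -/(mE P Z _) EV.
have -> : \int[P]_w (\sum_(c <- pe) c.1 * mev Z w (vdm2 U ^+ 2 * \prod_(j <- c.2) diag_p U j)) =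
  k`!%:R * \det (\matrix_(i < k, j < k) gexp (fun x : R => x ^+ (2 * (i + j)) * q.[x ^+ 2 / 2] ^+ 2)).
  rewrite -(andreief mZ lawZ indZ cu_inj) //; apply: eq_Rintegral => w _.
  rewrite -mev_vdm -mevX.
  transitivity (mev Z w (vdm2 U ^+ 2) * ev (psum (hz w)) pe).
    rewrite (@mev_ev w (diag_p U)) // mulr_sumr; apply: eq_bigr => c _.
    by rewrite mevM mulrCA.
  congr (_ * _); rewrite -hpe.
  by rewrite (big_mod2 ( *%R : Monoid.com_law (1 : R)) k0 (fun b => q.[Z (cu b) w ^+ 2 / 2])) /= -expr2 prodrXl.
by rewrite -mulf_div divff ?mul1r // pnatr_eq0 -lt0n fact_gt0.
Qed.

Let dom (w : T) : R := 2 ^+ l * expR (4^-1 * \sum_t Z t w ^+ 2).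

Let dom_int : P.-integrable setT (fun w => (dom w)%:E).
Proof.
have gi : gint (fun x : R => expR (4^-1 * x ^+ 2)).
  have m : measurable_fun setT (fun x : R => expR (4^-1 * x ^+ 2)).
    apply: continuous_measurable_fun => x; apply: continuous_comp; last exact: continuous_expR.
    by apply: cvgM; [exact: cvg_cst|exact: exprn_continuous].
  split=> //; apply: (@gauss_dom _ _ 1 4^-1) => //; first by rewrite ltf_pV2 ?posrE // ltr_nat.
  by move=> x; rewrite mul1r ger0_norm // expR_ge0.
have := integrableZl measurableT (2 ^+ l) (prod_integrable mZ lawZ indZ (fun=> gi)).
congr (_ .-integrable _ _); apply/funext => w /=.
by rewrite -EFinM /dom mulr_sumr expR_sum.
Qed.

Let stat_dom q w : (forall t : R, 0 <= t -> `|q.[t]| <= 2 * expR (4^-1 * t)) ->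
  `|stat q w| <= dom w.
Proof.
move=> qb; rewrite /stat normr_prod.
apply: (@le_trans _ _ (\prod_i (2 * expR (4^-1 * sq w i)))).
  by apply: ler_prod => i _; rewrite normr_ge0 qb // sq_ge0.
rewrite big_split /= prodr_const card_ord -expR_sum -mulr_sumr /dom.
rewrite ler_pM2l ?exprn_gt0 // ler_expR ler_pM2l ?invr_gt0 // big_index.
under [leRHS]eq_bigr do under eq_bigr do rewrite Z_index.
exact: sum_eig_sqr_le.
Qed.

Let big_eig (th : R) : set T := [set w | forall i, th < sq w i].

Let prod_big_eig th w : \prod_i ((th < sq w i)%R%:R : R) = \1_(big_eig th) w.
Proof.
rewrite indicE; have [h|h] := boolP (w \in big_eig th).
  by rewrite big1 // => i _; move: h; rewrite inE => ->.
have [i ih] : exists i, ~ (th < sq w i).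
  by apply/not_existsP => h'; case/negP: h; rewrite inE => i; apply: contrapT; exact: h'.
by rewrite (bigD1 i) //=; case: (th < sq w i) ih => // _; rewrite mul0r.
Qed.

Let stat_cvg (q : nat -> {poly R}) (g : R -> R) w :
  (forall t : R, 0 <= t -> (q m).[t] @[m --> \oo] --> g t) ->
  stat (q m) w @[m --> \oo] --> \prod_i g (sq w i).
Proof. by move=> qg; apply: cvg_bigprod => i; apply: qg; exact: sq_ge0. Qed.

Let indic_measurable (A : set T) : measurable_fun setT (\1_A : T -> R) -> measurable A.
Proof.
move=> mA; have := mA measurableT _ (measurable_set1 (1 : R)); rewrite setTI.
congr measurable; apply/seteqP; split => w /=; rewrite indicE.
  by case: (boolP (w \in A)) => [|_ /eqP]; rewrite ?inE // eq_sym oner_eq0.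
by move=> wA; rewrite mem_set.
Qed.

Let measurable_big_eig th : 0 <= th -> measurable (big_eig th).
Proof.
move=> th0; have [q [_ qc]] := poly_indicator th0.
apply: indic_measurable; apply: (@measurable_fun_cvg _ _ _ _ (fun m => stat (q m))) => // w _.
by rewrite -prod_big_eig; exact: (stat_cvg (g := fun t => (th < t)%R%:R)).
Qed.

Lemma eig_tail (th : R) : 0 <= th -> fine (P (big_eig th)) = Sdet k (Num.sqrt th).
Proof.
move=> th0; have [q [qb qc]] := poly_indicator th0.
have mB := measurable_big_eig th0.
have c1 : \int[P]_w stat (q m) w @[m --> \oo] --> fine (P (big_eig th)).
  have -> : fine (P (big_eig th)) = \int[P]_w (\1_(big_eig th) w : R).
    by rewrite /Rintegral integral_indic // setIT.
  apply: (Rintegral_dominated_cvg (g := dom)) => //.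
  - by move=> w; rewrite -prod_big_eig; exact: (stat_cvg (g := fun t => (th < t)%R%:R)).
  - by move=> m w; apply: stat_dom => t; exact: qb.
(* The square of [q] at [x^2 / 2] costs [exp (x^2 / 4)] and the power [exp (x^2 / 8)], together
   still below [exp (x^2 / 2)]. *)
pose C (a : nat) : R := 4 * (1 + (2 * a)`!%:R * (8^-1) ^- (2 * a)).
pose G (a : nat) (x : R) : R := C a * expR ((8^-1 + 4^-1) * x ^+ 2).
have Gi a : mu.-integrable setT (fun x : R => (G a x * phi x)%:E).
  have mG : measurable_fun setT (G a).
    apply: continuous_measurable_fun => x; apply: cvgM; first exact: cvg_cst.
    apply: continuous_comp; last exact: continuous_expR.
    by apply: cvgM; [exact: cvg_cst|exact: exprn_continuous].
  apply: (@gauss_dom _ _ (C a) (8^-1 + 4^-1)) => //; first by lra.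
  move=> x; rewrite ger0_norm // /G mulr_ge0 ?expR_ge0 // /C.
  by apply: mulr_ge0 => //; apply: addr_ge0 => //; apply: mulr_ge0 => //; rewrite invr_ge0 exprn_ge0 // invr_ge0.
have x20 (x : R) : 0 <= x ^+ 2 / 2 by rewrite divr_ge0 ?sqr_ge0.
have qG a m (x : R) : `|x ^+ (2 * a) * (q m).[x ^+ 2 / 2] ^+ 2| <= G a x.
  rewrite normrM normrX normrX.
  have e8 : 0 < 8^-1 :> R by rewrite invr_gt0.
  have h1 := absX_le_expR x (2 * a) e8.
  have h2 : `|(q m).[x ^+ 2 / 2]| ^+ 2 <= 4 * expR (4^-1 * x ^+ 2).
    apply: (@le_trans _ _ ((2 * expR (4^-1 * (x ^+ 2 / 2))) ^+ 2)).
      by rewrite lerXn2r ?nnegrE ?normr_ge0 ?mulr_ge0 ?expR_ge0 ?qb.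
    rewrite exprMn -expRM_natl; apply: ler_pM; rewrite ?expR_ge0 //; first by rewrite expr2 -natrM.
    by rewrite ler_expR; lra.
  apply: (le_trans (ler_pM _ _ h1 h2)); rewrite ?exprn_ge0 ?normr_ge0 //.
  by rewrite /G (mulrDl _ _ (x ^+ 2)) expRD /C mulrACA [_ * 4]mulrC.
have gi a m : gint (fun x : R => x ^+ (2 * a) * (q m).[x ^+ 2 / 2] ^+ 2).
  have mf : measurable_fun setT (fun x : R => x ^+ (2 * a) * (q m).[x ^+ 2 / 2] ^+ 2).
    apply: continuous_measurable_fun => x; apply: cvgM; first exact: exprn_continuous.
    apply: (@continuous_comp _ _ _ (fun x : R => (q m).[x ^+ 2 / 2]) (fun y => y ^+ 2)); last exact: exprn_continuous.
    apply: (@continuous_comp _ _ _ (fun x : R => x ^+ 2 / 2) (horner (q m))); last exact: continuous_horner.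
    by apply: cvgM; [exact: exprn_continuous|exact: cvg_cst].
  split=> //; apply: (le_integrable measurableT _ _ (Gi a)).
    by apply/measurable_EFinP; apply: measurable_funM => //; exact: measurable_phi.
  have key (x : R) : `|x ^+ (2 * a) * (q m).[x ^+ 2 / 2] ^+ 2 * phi x| <= `|G a x * phi x|.
    by rewrite [leLHS]normrM [leRHS]normrM ler_wpM2r // (le_trans (qG a m x)) // ler_norm.
  by move=> x _; rewrite !abse_EFin lee_fin; exact: key.
pose L := \matrix_(i < k, j < k) gexp (fun x : R => x ^+ (2 * (i + j)) * (th < x ^+ 2 / 2)%R%:R).
have c2 : \int[P]_w stat (q m) w @[m --> \oo] --> \det L / (2 ^+ k * \det (gmat k (0 : R))).
  under eq_fun do rewrite stat_integral => [|//].
  apply: cvgM; last exact: cvg_cst.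
  apply: cvg_det => i j; rewrite mxE; under eq_fun do rewrite mxE.
  apply: (@gexp_dominated_cvg R _ _ (G (i + j)%N)) => //.
  - by move=> m; case: (gi (i + j)%N m).
  - move=> x; apply: cvgM; first exact: cvg_cst.
    have -> : (th < x ^+ 2 / 2)%R%:R = ((th < x ^+ 2 / 2)%R%:R) ^+ 2 :> R.
      by case: (th < _); rewrite ?expr1n ?expr0n.
    by have hq := qc _ (x20 x); rewrite expr2; exact: (cvgM hq hq).
have -> : fine (P (big_eig th)) = \det L / (2 ^+ k * \det (gmat k (0 : R))).
  exact: cvg_unique _ c1 c2.
have -> : L = 2 *: gmat k (Num.sqrt 2 * Num.sqrt th).
  apply/matrixP => i j; rewrite !mxE -gexp_tail ?mulr_ge0 ?sqrtr_ge0 //.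
  congr gexp; apply/funext => x; congr (_ * _%:R); congr (nat_of_bool _).
  rewrite -[RHS](ltr_pXn2r (n := 2)) // ?nnegrE ?mulr_ge0 ?sqrtr_ge0 //.
  by rewrite exprMn !sqr_sqrtr // real_normK ?num_real // ltr_pdivlMr // mulrC.
by rewrite detZ -mulf_div divff ?mul1r // expf_neq0.
Qed.

(** The tail event tolerates zero eigenvalues, [big_eig] does not. The difference lies in the
    complement of [big_eig 0], a null set because [Sdet 0 = 1]. *)
Lemma TFS_tailE (y : R) : 0 < y -> TFS_tail P Y y = Sdet k y.
Proof.
move=> y0; have y20 : 0 <= y ^+ 2 by exact: sqr_ge0.
pose E : set T := [set w | forall i, sq w i = 0 \/ y ^+ 2 < sq w i].
have -> : TFS_tail P Y y = fine (P E).
  by congr (fine (P _)); apply/seteqP; split => w /= /(smallest_pos_eig_gt _ y0).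
have mE : measurable E.
  (* For [t >= 0], the indicator of [t = 0] or [y^2 < t] is one minus the indicator of [0 < t] plus
     that of [y^2 < t]; both are limits of polynomials. *)
  have [r [_ rc]] := poly_indicator (lexx (0 : R)).
  have [q [_ qc]] := poly_indicator y20.
  apply: indic_measurable.
  apply: (@measurable_fun_cvg _ _ _ _ (fun m => stat (1 - r m + q m))) => // w _.
  have -> : \1_E w = \prod_i ((1 - (0 < sq w i)%R%:R + (y ^+ 2 < sq w i)%R%:R) : R).
    have tm (t : R) : 0 <= t -> 1 - (0 < t)%R%:R + (y ^+ 2 < t)%R%:R =
        (if (t == 0) || (y ^+ 2 < t) then 1 else 0) :> R.
      rewrite le_eqVlt => /orP[/eqP<-|t0].
        by rewrite ltxx eqxx subr0 ltNge y20 addr0.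
      by rewrite t0 gt_eqF //= subrr add0r; case: (y ^+ 2 < t).
    under eq_bigr do rewrite tm ?sq_ge0 //.
    rewrite indicE; have [h|h] := boolP (w \in E).
      by rewrite big1 // => i _; move: h; rewrite inE => /(_ i)[->|->]; rewrite ?eqxx ?orbT.
    have [i ih] : exists i, ~ (sq w i = 0 \/ y ^+ 2 < sq w i).
      by apply/not_existsP => h'; case/negP: h; rewrite inE => i; apply: contrapT; exact: h'.
    rewrite (bigD1 i) //=; case: ifP; last by rewrite mul0r.
    by case/orP => [/eqP e|e]; case: ih; [left|right].
  apply: (stat_cvg (g := fun t => 1 - (0 < t)%R%:R + (y ^+ 2 < t)%R%:R)) => t t0.
  under eq_fun do rewrite hornerD hornerD hornerN hornerC.
  apply: cvgD; last exact: qc.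
  by apply: cvgB; [exact: cvg_cst|exact: rc].
have P0 : P (~` big_eig 0) = 0%E.
  rewrite probability_setC; last exact: measurable_big_eig.
  rewrite -[P _]fineK ?fin_num_measure //; last exact: measurable_big_eig.
  have -> : fine (P (big_eig 0)) = 1 by rewrite eig_tail // sqrtr0 Sdet0.
  by apply: (@subee R 1%:E).
rewrite -[in RHS](ger0_norm (ltW y0)) -sqrtr_sqr -eig_tail //; congr fine.
have mB := measurable_big_eig y20; have mB0 := measurable_big_eig (lexx (0 : R)).
have -> : big_eig (y ^+ 2) = E `\` (~` big_eig 0).
  apply/seteqP; split => w /=.
    move=> h; split; first by move=> i; right; exact: h.
    by apply; move=> i; apply: le_lt_trans (h i).
  move=> [h /contrapT h0] i; case: (h i) => // e; by have := h0 i; rewrite e ltxx.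
rewrite measureD ?fin_num_measure //=.
- rewrite (_ : P (E `&` _) = 0%E) ?sube0 //; apply/eqP; rewrite -measure_le0 -P0.
  by apply: le_measure; rewrite ?inE //; [apply: measurableI => //; exact: measurableC|exact: measurableC].
- exact: measurableC.
- by rewrite (le_lt_trans (probability_le1 _ _)) ?ltry.
Qed.

End SmallestEigenvalue.

(** * The limit density *)

Section LimitDensity.
Variables (R : realType) (k : nat) (a : int).
Hypothesis k0 : (0 < k)%N.
Notation mu := (@lebesgue_measure R).

(** A primitive of [y * S2 k y]; its value -1 at 0 and its limit 0 at infinity give the total mass
    1. *)
Let G (y : R) : R := y * S1 k y - Sdet k y.

Let is_derive_G (y : R) : is_derive y 1 G (y * S2 k y).
Proof.
have h := is_deriveB (is_deriveM (is_derive_id y 1) (is_derive_S1 k y)) (is_derive_S0 k y).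
have e : y *: S2 k y + S1 k y *: 1 - S1 k y = y * S2 k y.
  by rewrite /GRing.scale /= mulr1 addrK.
by move: h; rewrite e.
Qed.

Let continuous_G : continuous G.
Proof. by move=> y; apply/differentiable_continuous/derivable1_diffP; case: (is_derive_G y). Qed.

Let derive_G (y : R) : derive1 G y = y * S2 k y.
Proof. by rewrite derive1E; case: (is_derive_G y). Qed.

Let continuous_g : continuous (fun y : R => y * S2 k y).
Proof. by move=> y; apply: cvgM; [exact: cvg_id|exact: continuous_S2]. Qed.

Let G0 : G 0 = -1.
Proof. by rewrite /G mul0r Sdet0 // sub0r. Qed.

(* [1 + G (2 x)] is the limit of the distribution functions of the rescaled spacing *)
Let G_mono (x y : R) : 0 < x -> x <= y -> G x <= G y.
Proof.
move=> x0 xy; have y0 := lt_le_trans x0 xy.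
have lim (z : R) : 0 < z -> Sp_cdf k a (z / 2) n @[n --> \oo] --> 1 + G z.
  move=> z0; have z2 : 0 < z / 2 by rewrite divr_gt0.
  have := Sp_cdf_cvg k0 a z2; rewrite (mulrC 2 (z / 2)) divfK ?pnatr_eq0 // /G.
  by rewrite addrA addrAC.
rewrite -(lerD2l 1); apply: ler_cvg_to (lim x x0) (lim y y0) _.
by apply: nearW => n; apply: Sp_cdf_mono; rewrite ler_pM2r ?invr_gt0.
Qed.

(** Nonnegativity is inherited from the monotone distribution functions rather than read off the
    determinants. Adding [e * z] makes [G] strictly increasing, and [e] is arbitrary. *)
Lemma density_ge0 (y : R) : 0 < y -> 0 <= y * S2 k y.
Proof.
move=> y0; apply/ler_addgt0Pr => e e0.
pose H (z : R) := G z + e * z.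
have dH (z : R) : is_derive z 1 H (z * S2 k z + e).
  have h := is_deriveD (is_derive_G z) (is_deriveZ e (is_derive_id z 1)).
  have e1 : z * S2 k z + e *: 1 = z * S2 k z + e by rewrite /GRing.scale /= mulr1.
  by move: h; rewrite e1.
have := @incr_derive1_ge0_itvy R H false 0 y.
rewrite derive1E; have [_ ->] := dH y; apply.
- by move=> z _; case: (dH z).
- move=> u v; rewrite !in_itv /= !andbT => u0 v0 uv.
  by apply: ler_ltD; [exact: G_mono (ltW uv)|rewrite ltr_pM2l].
- by rewrite in_itv /= y0.
Qed.

Lemma density_ge0_cl (y : R) : 0 <= y -> 0 <= y * S2 k y.
Proof. by rewrite le_eqVlt => /orP[/eqP<-|]; [rewrite mul0r|exact: density_ge0]. Qed.

Lemma integral_density : (\int[mu]_(x in `]0%R, +oo[) (x * S2 k x)%:E = 1)%E.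
Proof.
rewrite integral_itv_obnd_cbnd; last first.
  by apply/measurable_EFinP; apply: measurable_funTS; exact: continuous_measurable_fun.
rewrite (@ge0_continuous_FTC2y R (fun x => x * S2 k x) G 0 0).
- by rewrite G0 -EFinB opprK add0r.
- exact: density_ge0_cl.
- exact: continuous_subspaceT.
- rewrite -[X in _ --> X](subr0 0); apply: cvgB; [exact: yS1_cvg0|exact: Sdet_cvg0].
- by move=> x _; case: (is_derive_G x).
- exact/cvg_at_right_filter/continuous_G.
- by move=> x _; exact: derive_G.
Qed.

Lemma integral_density_itv (b : R) : 0 < b ->
  (\int[mu]_(x in `]0%R, b]) (x * S2 k x)%:E = (1 + G b)%:E)%E.
Proof.
move=> b0; rewrite integral_itv_obnd_cbnd; last first.
  by apply/measurable_EFinP; apply: measurable_funTS; exact: continuous_measurable_fun.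
rewrite (@continuous_FTC2 R (fun x => x * S2 k x) G 0 b) //.
- by rewrite G0 -EFinB opprK addrC.
- exact: continuous_subspaceT.
- split; first by move=> x _; case: (is_derive_G x).
    exact/cvg_at_right_filter/continuous_G.
  exact/cvg_at_left_filter/continuous_G.
Qed.

Lemma Sp_cdf_density (x : R) : Sp_cdf k a x n @[n --> \oo] -->
  fine (\int[mu]_(y in `]0%R, 2 * x]) (y * S2 k y)%:E).
Proof.
have [x0|x0] := ltP 0 x.
  rewrite integral_density_itv ?mulr_gt0 //= /G.
  by rewrite addrA addrAC; exact: Sp_cdf_cvg.
rewrite set_itv_ge ?integral_set0 /=; last by rewrite bnd_simp -leNgt; lra.
apply: cvg_near_cst; near=> n; apply: Sp_cdf_le0 => //.
by near: n; exact: nbhs_infty_gt.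
Unshelve. all: by end_near. Qed.

End LimitDensity.

(** * Transfer of the limit law to the eigenvalue tail *)

Theorem theorem1p11 (R : realType) (k : nat) (a : int) (k_ge1 : (1 <= k)%N)
  (d : measure_display) (T : measurableType d) (P : probability T R)
  (Y : 'I_(2 * k) -> 'I_(2 * k) -> T -> R)
  (HY : iid_std_gaussian P Y) :
  let S := TFS_tail P Y in
  let g := fun x : R => x * derive1 (derive1 S) x in
  [/\ (forall x : R, 0 < x -> derivable S x 1 /\ derivable (derive1 S) x 1),
      (forall x : R, 0 < x -> 0 <= g x),
      (\int[@lebesgue_measure R]_(x in [set x : R | (0 < x)%R]) (g x)%:E = 1)%E &
      (forall x : R,
         Sp_cdf k a x n @[n --> \oo] -->
           fine (\int[@lebesgue_measure R]_(y in [set y : R | 0 < y <= 2 * x]) (g y)%:E))].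
Proof.
move=> S g.
have SE (x : R) : 0 < x -> S x = Sdet k x by exact: TFS_tailE.
(* [S] is known to agree with [Sdet k] on the positive reals, an open set, so the derivatives at
   positive points agree as well. *)
have near_pos (x : R) (Q : R -> Prop) : 0 < x -> (forall y, 0 < y -> Q y) -> \forall y \near x, Q y.
  by move=> x0 h; near=> y; apply: h; near: y; exact: lt_nbhsr.
have S'E (x : R) : 0 < x -> derive1 S x = S1 k x.
  move=> x0; rewrite derive1E (@near_eq_derive _ _ _ S (Sdet k)).
    by case: (is_derive_S0 k x).
  exact: near_pos.
have S''E (x : R) : 0 < x -> derive1 (derive1 S) x = S2 k x.
  move=> x0; rewrite derive1E (@near_eq_derive _ _ _ (derive1 S) (S1 k)).
    by case: (is_derive_S1 k x).
  exact: near_pos.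
have gE (x : R) : 0 < x -> g x = x * S2 k x by move=> x0; rewrite /g S''E.
split.
- move=> x x0; split.
    apply: (@near_eq_derivable _ _ _ (Sdet k)); last by case: (is_derive_S0 k x).
    by apply: near_pos => // y y0; rewrite SE.
  apply: (@near_eq_derivable _ _ _ (S1 k)); last by case: (is_derive_S1 k x).
  by apply: near_pos => // y y0; rewrite S'E.
- by move=> x x0; rewrite gE //; exact: density_ge0.
- rewrite -(@integral_density R k a k_ge1) -set_itvoy; apply: eq_integral => x.
  by rewrite inE /= in_itv /= andbT => x0; rewrite gE.
- move=> x; have -> : [set y : R | 0 < y <= 2 * x] = `]0, 2 * x]%classic.
    by apply/seteqP; split => y /=; rewrite in_itv.
  suff -> : (\int[@lebesgue_measure R]_(y in `]0%R, (2 * x)%R]) (g y)%:E =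
      \int[@lebesgue_measure R]_(y in `]0%R, (2 * x)%R]) (y * S2 k y)%:E)%E.
    exact: Sp_cdf_density.
  by apply: eq_integral => y; rewrite inE /= in_itv /= => /andP[y0 _]; rewrite gE.
Unshelve. all: by end_near. Qed.
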